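(* Let $G$ be a simple series-parallel graph with $n$ vertices. Then $G$ admits a path cover of size at most $\lceil n/2 \rceil$. Moreover, such a path cover can be computed in time linear in $n$.
   Context: An $st$-graph is a directed acyclic graph with a unique source vertex $s$ and a unique sink vertex $t$. A series-parallel graph is an $st$-graph defined recursively as follows. (1) The graph $(\{s,t\},\{(s,t)\})$ consisting of a single edge is series-parallel with source $s$ and sink $t$. (2) (Series composition) If $G_1$ is series-parallel with source $s_1$ and sink $t_1$, and $G_2$ is series-parallel with source $s_2$ and sink $t_2$, then the graph obtained from disjoint copies of $G_1$ and $G_2$ by identifying $t_1$ with $s_2$ is series-parallel with source $s_1$ and sink $t_2$. (3) (Parallel composition) With $G_1,G_2$ as before, the graph obtained by identifying $s_1$ with $s_2$ and $t_1$ with $t_2$ is series-parallel with source $s_1$ and sink $t_1$. Once the series-parallel graph is constructed, edge orientations are ignored; in particular paths need not respect them. Simple means that there are no multiple edges. A path cover of a graph is a collection of edge-disjoint simple paths of the graph such that every edge of the graph is contained in exactly one of the paths. The size of a path cover is the number of paths it contains. *)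

(* Defs.v *)
From HB Require Import structures.
From mathcomp Require Import all_boot.

Set Implicit Arguments.
Unset Strict Implicit.
Unset Printing Implicit Defensive.

(** * Series-parallel graphs and path covers

    A (multi)graph on a finite vertex type [V] is a sequence of pairs, one pair
    for each edge. *)

Section Graphs.
Variable V : finType.
Implicit Types (A B : {set V}) (es : seq (V * V)) (s t m : V) (p : seq V).

(** [sp A es s t]: the oriented multigraph with vertex set [A] and edges [es] is
    series-parallel with source [s] and sink [t].  All graphs of the recursion
    live in the single vertex type [V]: up to renaming, gluing disjoint copies
    along terminals is the union of two graphs whose vertex sets share exactly
    the identified vertices. *)
Inductive sp : {set V} -> seq (V * V) -> V -> V -> Prop :=
| SpEdge s t :
    s != t -> sp [set s; t] [:: (s, t)] s t
| SpSeries A B es1 es2 s m t :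
    sp A es1 s m -> sp B es2 m t -> A :&: B = [set m] ->
    sp (A :|: B) (es1 ++ es2) s t
| SpParallel A B es1 es2 s t :
    sp A es1 s t -> sp B es2 s t -> A :&: B = [set s; t] ->
    sp (A :|: B) (es1 ++ es2) s t.

(** An edge with its orientation forgotten. *)
Definition uedge (e : V * V) : {set V} := [set e.1; e.2].

(** The vertices are all of [V]; neither the order nor the orientation of the
    edges listed in [es] matters. *)
Definition series_parallel es : Prop :=
  exists ds s t, sp [set: V] ds s t /\ perm_eq (map uedge es) (map uedge ds).

Definition simple_graph es : bool := uniq (map uedge es).

Definition path_edges p : seq {set V} :=
  if p is x :: q then pairmap (fun a b => [set a; b]) x q else [::].

(** A simple path is given by its nonempty, duplicate-free sequence of
    vertices. *)
Definition simple_path es p : bool :=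
  [&& p != [::], uniq p & all (mem (map uedge es)) (path_edges p)].

(** Counting positions in [P] makes "exactly one of the paths" include the
    edge-disjointness of the paths. *)
Definition path_cover es (P : seq (seq V)) : Prop :=
  all (simple_path es) P /\
  {in map uedge es, forall e, count (fun p => e \in path_edges p) P = 1}.

End Graphs.

(** * Word RAM

    A random access machine programmed with structured control flow.  The memory
    consists of arrays of words, of which a program names only finitely many, and
    scalar variables are array cells.  Words range over [0 .. W-1]; results of
    operations are reduced modulo [W].  Subtraction is truncated at 0. *)

Inductive binop := Add | Sub | Mul | Div | Lt.

Inductive expr :=
| Const of nat
| Read of nat & expr               (* array name, index *)
| Binop of binop & expr & expr.

Inductive cmd :=
| Skip
| Write of nat & expr & expr       (* array name, index, value *)
| Seq of cmd & cmd
| If of expr & cmd & cmd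
| While of expr & cmd.

Definition memory := nat -> nat -> nat.

Definition update (mu : memory) (a i v : nat) : memory :=
  fun b j => if (b == a) && (j == i) then v else mu b j.

Definition eval_binop (o : binop) (x y : nat) : nat :=
  match o with
  | Add => x + y
  | Sub => x - y
  | Mul => x * y
  | Div => x %/ y
  | Lt => x < y
  end.

Section Semantics.
Variable W : nat.

Fixpoint eval (mu : memory) (e : expr) : nat :=
  match e with
  | Const v => v %% W
  | Read a i => mu a (eval mu i)
  | Binop o e1 e2 => eval_binop o (eval mu e1) (eval mu e2) %% W
  end.

Fixpoint cost (e : expr) : nat :=
  match e with
  | Const _ => 1
  | Read _ i => (cost i).+1
  | Binop _ e1 e2 => (cost e1 + cost e2).+1
  end.

(** [exec c mu t nu]: started in memory [mu], the program [c] halts after [t]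
    unit-cost steps in memory [nu]. *)
Inductive exec : cmd -> memory -> nat -> memory -> Prop :=
| ExecSkip mu :
    exec Skip mu 1 mu
| ExecWrite mu a i e :
    exec (Write a i e) mu (cost i + cost e).+1
         (update mu a (eval mu i) (eval mu e))
| ExecSeq c1 c2 mu nu xi t1 t2 :
    exec c1 mu t1 nu -> exec c2 nu t2 xi ->
    exec (Seq c1 c2) mu (t1 + t2).+1 xi
| ExecIfTrue e c1 c2 mu nu t :
    eval mu e != 0 -> exec c1 mu t nu ->
    exec (If e c1 c2) mu (cost e + t).+1 nu
| ExecIfFalse e c1 c2 mu nu t :
    eval mu e = 0 -> exec c2 mu t nu ->
    exec (If e c1 c2) mu (cost e + t).+1 nu
| ExecWhileTrue e c mu nu xi t1 t2 :
    eval mu e != 0 -> exec c mu t1 nu -> exec (While e c) nu t2 xi ->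
    exec (While e c) mu (cost e + t1 + t2).+1 xi
| ExecWhileFalse e c mu :
    eval mu e = 0 ->
    exec (While e c) mu (cost e).+1 mu.

End Semantics.

(** * Input and output conventions *)

(** A graph on the vertices [0 .. n-1] is given by the numbers of vertices and
    edges (array 0) and the list of its edges (arrays 1 and 2).  The terminals
    and the series-parallel decomposition are not part of the input. *)
Definition graph_input (n : nat) (es : seq ('I_n * 'I_n)) : memory :=
  fun a i =>
    match a with
    | 0 => nth 0 [:: n; size es] i
    | 1 => nth 0 [seq val e.1 | e <- es] i
    | 2 => nth 0 [seq val e.2 | e <- es] i
    | _ => 0
    end.

(** Number of paths (array 3), their numbers of vertices (array 4), and the
    concatenation of their vertex sequences (array 5). *)
Definition outputs (n : nat) (mu : memory) (P : seq (seq 'I_n)) : Prop :=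
  [/\ mu 3 0 = size P,
      mkseq (mu 4) (size P) = shape P
    & mkseq (mu 5) (size (flatten P)) = map val (flatten P)].

(* Main.v *)
Require Import Defs.
From mathcomp Require Import all_boot fingroup perm zify.

(** Series-parallel graphs reduce to a single edge by eliminating vertices of
    degree 2: a vertex [u] with neighbours [x] and [y] is replaced by the edge
    [xy] ([sp_reducible_ctx]). The vertices may be eliminated in any order
    ([reducible_elim]), so a program can eliminate whichever vertex of degree 2 it
    meets and never has to find the terminals.

    A cover of the reduced graph is turned into one of the original graph. If
    [xy] is a new edge, the path through it is led over [u] instead, and no path
    is added. If [xy] has been an edge before, [u] is set aside as an ear of
    this edge. Ears are removed in pairs, two at the same vertex or on the same
    edge, or together with an eliminated vertex next to them; each time two
    vertices disappear and one path is added ([inv_pair], [inv_ear_present],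
    [inv_ear_absent], [inv_combine]). To cover all edges of two such vertices by
    a single additional path, it can be necessary to cut the path through [xy]
    and to prolong both parts ([good_split]). The last edge takes one path for
    its two vertices, and a last ear without a partner one more, so there are at
    most [n / 2] paths, rounded up ([inv_final]).

    For linear time, the eliminations are not retraced backwards. An edge of
    the reduced graph stands for a path, of which only the vertices next to its
    two ends matter, its ports. A step decides which edges are joined at some
    vertices, whatever the cover of the reduced graph will be, and this is
    recorded as links, triples of consecutive vertices of the final paths; a cut
    exchanges a port ([good]). The program keeps adjacency and links in matrices
    addressed by pairs of vertices, of which it uses only a linear number of
    cells. It finds the neighbours of a vertex of degree 2 from their sum and
    the sum of their squares ([wp_decode]) and the vertices of degree 2 in a
    queue ([main_step]). In the end the links describe a cover ([exec_cover]),
    whose paths are written by following them from their ends ([exec_walk_cmd]).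
    The number of edges is linear in [n], because an elimination removes at most
    two ([card_arcs_reducible]). *)

Set Implicit Arguments.
Unset Strict Implicit.
Unset Printing Implicit Defensive.

(** * Eliminating vertices of degree two *)

Ltac dec_eq := repeat (match goal with
  | H : is_true (?a != ?a) |- _ => by rewrite eqxx in H
  | H : ?a <> ?a |- _ => by case: H
  | H : is_true (?a != ?b) |- context [?a == ?b] => rewrite (negbTE H)
  | H : is_true (?a != ?b) |- context [?b == ?a] => rewrite (eq_sym b a) (negbTE H)
  | |- context [?a == ?a] => rewrite eqxx
  | |- context [?a == ?b] => case: (eqVneq a b) => [?|?]; subst
  end; rewrite ?eqxx ?andbT ?andbF ?orbT ?orbF ?andbb ?orbb //=).

Section Elimination.
Variable V : finType.
Implicit Types (H C : rel V) (a b c d s t u v w x y z : V).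

Definition same_edge x y : rel V :=
  fun a b => (a == x) && (b == y) || (a == y) && (b == x).

Lemma eq_set2 a b x y : ([set a; b] == [set x; y]) = same_edge x y a b.
Proof.
rewrite /same_edge; apply/eqP/idP => [E|].
  move: (set21 a b) (set22 a b) (set21 x y) (set22 x y).
  by rewrite {1 2}E -{3 4}E !in_set2; dec_eq.
by case/orP=> []/andP[/eqP-> /eqP->] //; rewrite setUC.
Qed.

Lemma same_edgeC x y a b : same_edge x y a b = same_edge x y b a.
Proof. by rewrite /same_edge orbC andbC [(a == x) && _]andbC. Qed.

Lemma same_edge_sym x y a b : same_edge x y a b = same_edge y x a b.
Proof. by rewrite /same_edge orbC. Qed.

(** As a relation has no multiplicities, the new edge [xy] merges with one that
    is already there. *)
Definition elim H u x y : rel V :=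
  fun a b => [&& a != u, b != u & H a b || same_edge x y a b].

Definition nbrs2 H u x y := x != y /\ forall z, H u z = (z == x) || (z == y).

(** The ends of the last edge are not fixed in advance, so that no terminals
    have to be known. *)
Inductive reducible : rel V -> Prop :=
| ReducibleEdge H s t :
    s != t -> H =2 same_edge s t -> reducible H
| ReducibleElim H u x y :
    nbrs2 H u x y -> reducible (elim H u x y) -> reducible H.

Definition graph_rel H := symmetric H /\ irreflexive H.

Lemma eq_elim H H' u x y : H =2 H' -> elim H u x y =2 elim H' u x y.
Proof. by move=> E a b; rewrite /elim E. Qed.

Lemma eq_nbrs2 H H' u x y : H =2 H' -> nbrs2 H u x y -> nbrs2 H' u x y.
Proof. by move=> E [xy Hu]; split=> // z; rewrite -E. Qed.

Lemma eq_reducible H H' : H =2 H' -> reducible H -> reducible H'.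
Proof.
move=> E HH; elim: HH H' E => {}H.
  move=> s t st Hst H' E; apply: (ReducibleEdge st) => a b.
  by rewrite -E Hst.
move=> u x y nb _ IH H' E; apply: (ReducibleElim (eq_nbrs2 E nb)).
exact/IH/eq_elim.
Qed.

Lemma nbrs2C H u x y : nbrs2 H u x y -> nbrs2 H u y x.
Proof. by case=> xy Hu; split=> [|z]; [rewrite eq_sym | rewrite Hu orbC]. Qed.

Lemma elimC H u x y : elim H u x y =2 elim H u y x.
Proof. by move=> a b; rewrite /elim same_edge_sym. Qed.

Lemma graph_elim H u x y : graph_rel H -> x != y -> graph_rel (elim H u x y).
Proof.
case=> Hs Hi xy; split=> [a b|a]; first by rewrite /elim Hs same_edgeC andbCA.
by rewrite /elim Hi /same_edge; dec_eq.
Qed.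

Lemma same_edge_inj (f : V -> V) x y a b :
  injective f -> same_edge (f x) (f y) (f a) (f b) = same_edge x y a b.
Proof. by move=> fi; rewrite /same_edge !(inj_eq fi). Qed.

Lemma reducible_bij (f g : V -> V) H :
  cancel f g -> cancel g f -> reducible H ->
  reducible (fun a b => H (f a) (f b)).
Proof.
move=> fK gK; have fi := can_inj fK; have gi := can_inj gK.
elim=> {}H.
  move=> s t st E; apply: (@ReducibleEdge _ (g s) (g t)).
    by rewrite (inj_eq gi).
  by move=> a b; rewrite E -{1}(gK s) -{1}(gK t) same_edge_inj.
move=> u x y [xy Hu] _ IH; apply: (@ReducibleElim _ (g u) (g x) (g y)).
  by split=> [|z]; rewrite ?(inj_eq gi) // gK Hu -!(can2_eq fK gK).
apply: eq_reducible IH => a b.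
by rewrite /elim -{1}(gK x) -{1}(gK y) same_edge_inj // -!(can2_eq fK gK).
Qed.

Lemma nbrs2_neq H u x y : graph_rel H -> nbrs2 H u x y -> u != x /\ u != y.
Proof.
case=> _ Hi [_ Hu]; split; apply/negP=> /eqP E.
  by have := Hi u; rewrite Hu E eqxx.
by have := Hi u; rewrite Hu E eqxx orbT.
Qed.

Lemma elim_disjoint H u x y w a b :
  graph_rel H -> nbrs2 H u x y -> nbrs2 H w a b -> u != w -> ~~ H u w ->
  nbrs2 (elim H u x y) w a b.
Proof.
move=> gH nu nw uw Huw; have [ux uy] := nbrs2_neq gH nu.
have [wa wb] := nbrs2_neq gH nw.
have wu : H w u = false by rewrite gH.1; apply/negbTE.
case: nu nw => xy Hu [ab Hw]; split=> // z.
move: Huw; rewrite Hu negb_or => /andP[wx wy].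
rewrite /elim /same_edge eq_sym uw Hw (negbTE wx) (negbTE wy) !orbF /=.
by move: wu; rewrite Hw; dec_eq.
Qed.

Lemma elim_elim H u x y w a b :
  graph_rel H -> nbrs2 H u x y -> nbrs2 H w a b -> u != w -> ~~ H u w ->
  elim (elim H u x y) w a b =2 elim (elim H w a b) u x y.
Proof.
move=> gH nu nw uw Huw c d.
have [ux uy] := nbrs2_neq gH nu; have [wa wb] := nbrs2_neq gH nw.
have wu : H w u = false by rewrite gH.1; apply/negbTE.
case: nu nw => xy Hu [ab Hw].
move: Huw wu; rewrite Hu Hw !negb_or => /andP[wx wy] /negbT.
rewrite negb_or => /andP[ua ub].
rewrite /elim /same_edge; case: (H c d); dec_eq.
Qed.

(** Two adjacent vertices of degree 2 have one further neighbour each, which the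
    elimination of either vertex connects to the other one: only the name of the
    surviving vertex differs. *)
Lemma elim_swap H u w y b :
  graph_rel H -> nbrs2 H u w y -> nbrs2 H w u b ->
  forall c d, elim H w u b c d = elim H u w y (tperm u w c) (tperm u w d).
Proof.
move=> gH nu nw c d.
have [uw uy] := nbrs2_neq gH nu; have [_ wb] := nbrs2_neq gH nw.
case: nu nw => wy Hu [ub Hw].
have Hu' z : H z u = (z == w) || (z == y) by rewrite gH.1 Hu.
have Hw' z : H z w = (z == u) || (z == b) by rewrite gH.1 Hw.
have [Hs Hi] := gH.
have [E|nc] := altP (c =P u); first subst c.
  rewrite tpermL.
  have [E|nd] := altP (d =P u); first subst d.
    by rewrite tpermL /elim !Hi /same_edge; dec_eq.
  have [E|nd'] := altP (d =P w); first subst d.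
    by rewrite tpermR /elim !eqxx /= !andbF.
  rewrite tpermD 1?eq_sym // /elim Hu Hw /same_edge; dec_eq.
have [E|nc'] := altP (c =P w); first subst c.
  by rewrite tpermR /elim !eqxx.
rewrite (tpermD (z := c)) 1?eq_sym //.
have [E|nd] := altP (d =P u); first subst d.
  rewrite tpermL /elim Hu' Hw' /same_edge; dec_eq.
have [E|nd'] := altP (d =P w); first subst d.
  by rewrite tpermR /elim !eqxx /= !andbF.
rewrite tpermD 1?eq_sym // /elim /same_edge; case: (H c d); dec_eq.
Qed.

(** Eliminations of non-adjacent vertices commute, those of adjacent ones give
    isomorphic graphs; hence no order of elimination gets stuck. *)
Lemma reducible_elim H w a b :
  graph_rel H -> reducible H -> nbrs2 H w a b -> reducible (elim H w a b).
Proof.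
move=> gH rH; elim: rH w a b gH => {}H.
  move=> s t st E w a b _ [ab Hw].
  have := Hw a; have := Hw b; rewrite !E !eqxx orbT /same_edge.
  by move: ab st; dec_eq.
move=> u x y nu rH IH w a b gH nw.
have [E|uw] := eqVneq u w.
  subst w; case: (nu) (nw) => xy Hu [ab Hu'].
  have : same_edge x y a b.
    have := Hu' a; have := Hu' b; rewrite !Hu !eqxx orbT /same_edge.
    by move: ab; dec_eq.
  case/orP=> []/andP[/eqP-> /eqP->] //.
  exact: eq_reducible (elimC _ _ _ _) _.
have [Huw|Huw] := boolP (H u w); last first.
  apply: (@ReducibleElim _ u x y).
    by apply: elim_disjoint; rewrite // 1?eq_sym // gH.1.
  apply: eq_reducible (elim_elim gH nu nw uw Huw) _.
  apply: IH; first exact: graph_elim gH nu.1.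
  exact: elim_disjoint.
wlog Ex : x y nu rH IH / w = x.
  move=> wl; have := Huw; rewrite nu.2 => /orP[/eqP E|/eqP E].
    exact: (wl x y).
  apply: (wl y x) => //; first exact: nbrs2C.
    exact: eq_reducible (elimC _ _ _ _) _.
  move=> w' a' b' gH' nw'; apply: eq_reducible (eq_elim _ _ _ (elimC _ _ _ _)) _.
  apply: IH.
    by apply: graph_elim => //; case: nu.
  exact: eq_nbrs2 (elimC _ _ _ _) nw'.
subst x.
wlog Ea : a b nw / u = a.
  move=> wl; have := Huw; rewrite gH.1 nw.2 => /orP[/eqP E|/eqP E].
    exact: (wl a b).
  apply: eq_reducible (elimC _ _ _ _) _; apply: (wl b a) => //.
  exact: nbrs2C.
subst a.
have K : cancel (tperm u w) (tperm u w) := tpermK u w.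
apply: eq_reducible (reducible_bij K K rH) => c d.
by rewrite (elim_swap gH nu nw).
Qed.

Definition alive H := [set v | [exists w, H v w]].

Lemma alive_elim H u x y :
  graph_rel H -> nbrs2 H u x y -> #|alive H| = #|alive (elim H u x y)|.+1.
Proof.
move=> gH nu; have [ux uy] := nbrs2_neq gH nu; have [xy Hu] := nu.
rewrite (cardsD1 u (alive H)) inE.
have -> : [exists w, H u w] by apply/existsP; exists x; rewrite Hu eqxx.
congr _.+1; apply: eq_card => v; rewrite !inE.
apply/andP/existsP => [[vu /existsP[w Hvw]]|[w]].
  have [E|wu] := eqVneq w u; last by exists w; rewrite /elim vu wu Hvw.
  subst w; move: Hvw; rewrite gH.1 Hu => /orP[]/eqP ?; subst v.
    by exists y; rewrite /elim /same_edge !eqxx orbT vu eq_sym uy.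
  by exists x; rewrite /elim /same_edge !eqxx !orbT vu eq_sym ux.
case/and3P=> vu wu Hvw; split=> //.
case/orP: Hvw => [Hvw|]; first by apply/existsP; exists w.
by case/orP=> []/andP[/eqP-> _]; apply/existsP; exists u;
  rewrite gH.1 Hu eqxx ?orbT.
Qed.

(** An elimination destroys at most four arcs, that is, two edges. This makes
    time linear in the number of edges linear in the number of vertices. *)
Lemma card_arcs_reducible H :
  graph_rel H -> reducible H ->
  #|[set p : V * V | H p.1 p.2]| + 6 <= 4 * #|alive H|.
Proof.
move=> gH rH; elim: rH gH => {}H.
  move=> s t st E _.
  have -> : alive H = [set s; t].
    apply/setP=> v; rewrite !inE; apply/existsP/idP=> [[w]|].
      by rewrite E /same_edge; dec_eq.
    by case/orP=> /eqP->; [exists t|exists s]; rewrite E /same_edge !eqxx ?orbT.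
  have -> : [set p : V * V | H p.1 p.2] = [set (s, t); (t, s)].
    by apply/setP=> [[a b]]; rewrite !inE E.
  by rewrite !cards2 st xpair_eqE; case: (s == t) (t == s) => [] [].
move=> u x y nu _ IH gH; have [xy Hu] := nu.
rewrite (alive_elim gH nu) mulnS.
have {}IH := IH (graph_elim _ gH xy).
suff le : #|[set p : V * V | H p.1 p.2]| <=
          #|[set p : V * V | elim H u x y p.1 p.2]| + 4.
  by lia.
have sub : [set p : V * V | H p.1 p.2] \subset
    [set p : V * V | elim H u x y p.1 p.2] :|:
    ([set (u, x); (x, u)] :|: [set (u, y); (y, u)]).
  apply/subsetP=> [[a b]]; rewrite !inE /elim /= !xpair_eqE => Hab.
  have := Hu a; have := Hu b; rewrite Hab gH.1.
  have [E|_] := eqVneq a u; first by subst a; rewrite gH.1 Hab; dec_eq.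
  have [E|_] := eqVneq b u; first by subst b; rewrite gH.1 Hab; dec_eq.
  by [].
apply: leq_trans (subset_leq_card sub) _.
apply: leq_trans (leq_card_setU _ _).1 _; rewrite leq_add2l.
apply: leq_trans (leq_card_setU _ _).1 _; rewrite !cards2.
by case: (_ != _); case: (_ != _).
Qed.

(** * Series-parallel graphs reduce to an edge *)

Definition edge_rel (es : seq (V * V)) : rel V :=
  fun a b => [set a; b] \in map (@uedge V) es.

Lemma edge_rel_cat es1 es2 a b :
  edge_rel (es1 ++ es2) a b = edge_rel es1 a b || edge_rel es2 a b.
Proof. by rewrite /edge_rel map_cat mem_cat. Qed.

Lemma edge_relC es : symmetric (edge_rel es).
Proof. by move=> a b; rewrite /edge_rel setUC. Qed.

Lemma sp_terminals A es s t : sp A es s t -> [/\ s \in A, t \in A & s != t].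
Proof.
elim=> {A es s t} [s t st|A B es1 es2 s m t _ [sA mA sm] _ [mB tB mt] AB|
    A B es1 es2 s t _ [sA tA st] _ _ _].
- by rewrite set21 set22.
- rewrite !in_setU sA tB orbT; split=> //; apply: contraNneq sm => E.
  by rewrite -in_set1 -AB in_setI sA E.
- by rewrite !in_setU sA tA.
Qed.

Lemma sp_edge_in A es s t a b :
  sp A es s t -> edge_rel es a b -> (a \in A) && (a != b).
Proof.
elim=> {A es s t} [s t st|A B es1 es2 s m t _ IH1 _ IH2 AB|
    A B es1 es2 s t _ IH1 _ IH2 _].
- by rewrite /edge_rel /= inE eq_set2 in_set2 /same_edge; move: st; dec_eq.
- rewrite edge_rel_cat in_setU.
  by case/orP=> [/IH1|/IH2] /andP[->]; rewrite ?orbT.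
- rewrite edge_rel_cat in_setU.
  by case/orP=> [/IH1|/IH2] /andP[->]; rewrite ?orbT.
Qed.

(** The context [C] stands for the rest of a larger graph: in a composition, each
    part is the context in which the other one is reduced, and the common vertex
    of a series composition has degree 2 once both parts are single edges. *)
Lemma sp_reducible_ctx A es s t C :
  sp A es s t -> symmetric C ->
  (forall a b, C a b -> a \in A -> (a == s) || (a == t)) ->
  reducible (fun a b => C a b || same_edge s t a b) ->
  reducible (fun a b => C a b || edge_rel es a b).
Proof.
move=> spA; elim: spA C => {A es s t}.
- move=> s t st C _ _; apply: eq_reducible => a b.
  by rewrite /edge_rel /= inE eq_set2.
- move=> A B es1 es2 s m t spA IH1 spB IH2 AB C Cs CAB rC.
  have [sA mA sm] := sp_terminals spA; have [mB tB mt] := sp_terminals spB.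
  have [_ _ st] := sp_terminals (SpSeries spA spB AB).
  have inAB z : z \in A -> z \in B -> z = m.
    by move=> zA zB; apply/set1P; rewrite -AB in_setI zA zB.
  pose C1 : rel V := fun a b => C a b || edge_rel es2 a b.
  pose C2 : rel V := fun a b => C a b || same_edge s m a b.
  apply: (@eq_reducible (fun a b => C1 a b || edge_rel es1 a b)).
    by move=> a b; rewrite /C1 edge_rel_cat -orbA [edge_rel es2 _ _ || _]orbC.
  apply: IH1 => [a b|a b|]; first by rewrite /C1 Cs edge_relC.
    case/orP=> [Cab aA|Eab aA].
      have := CAB _ _ Cab; rewrite in_setU aA => /(_ isT).
      by case/orP=> /eqP E; subst a; rewrite ?eqxx // (inAB t) ?eqxx ?orbT.
    have /andP[aB _] := sp_edge_in spB Eab.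
    by rewrite (inAB a) // eqxx orbT.
  apply: (@eq_reducible (fun a b => C2 a b || edge_rel es2 a b)).
    by move=> a b; rewrite /C1 /C2 orbAC.
  apply: IH2 => [a b|a b|]; first by rewrite /C2 Cs same_edgeC.
    case/orP=> [Cab aB|/orP[]/andP[/eqP-> _] aB].
    - have := CAB _ _ Cab; rewrite in_setU aB orbT => /(_ isT).
      by case/orP=> /eqP E; subst a; rewrite ?eqxx ?orbT // (inAB s) ?eqxx.
    - by rewrite (inAB s) ?eqxx.
    - by rewrite eqxx.
  have Cm z : C m z = false.
    apply/negP=> /CAB; rewrite in_setU mA => /(_ isT).
    by rewrite eq_sym (negbTE sm) (negbTE mt).
  apply: (@ReducibleElim _ m s t).
    split=> // z; rewrite /C2 Cm /same_edge.
    by move: sm mt; dec_eq.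
  apply: eq_reducible rC => a b; rewrite /C2 /elim.
  have [->|am] := eqVneq a m.
    by rewrite Cm /same_edge; move: sm mt; dec_eq.
  have [->|bm] := eqVneq b m.
    by rewrite Cs Cm /same_edge; move: sm mt; dec_eq.
  by rewrite /same_edge; case: (C a b) => //=; dec_eq.
- move=> A B es1 es2 s t spA IH1 spB IH2 AB C Cs CAB rC.
  have inAB z : z \in A -> z \in B -> (z == s) || (z == t).
    by move=> zA zB; rewrite -in_set2 -AB in_setI zA zB.
  pose C1 : rel V := fun a b => C a b || edge_rel es2 a b.
  pose C2 : rel V := fun a b => C a b || same_edge s t a b.
  apply: (@eq_reducible (fun a b => C1 a b || edge_rel es1 a b)).
    by move=> a b; rewrite /C1 edge_rel_cat -orbA [edge_rel es2 _ _ || _]orbC.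
  apply: IH1 => [a b|a b|]; first by rewrite /C1 Cs edge_relC.
    case/orP=> [Cab aA|/(sp_edge_in spB)/andP[aB _] aA]; last exact: inAB.
    by apply: (CAB _ _ Cab); rewrite in_setU aA.
  apply: (@eq_reducible (fun a b => C2 a b || edge_rel es2 a b)).
    by move=> a b; rewrite /C1 /C2 orbAC.
  apply: IH2 => [a b|a b|]; first by rewrite /C2 Cs same_edgeC.
    case/orP=> [Cab aB|]; first by apply: (CAB _ _ Cab); rewrite in_setU aB orbT.
    by case/orP=> []/andP[-> _]; rewrite ?orbT.
  by apply: eq_reducible rC => a b; rewrite /C2 -orbA orbb.
Qed.

Lemma series_parallel_reducible es :
  series_parallel es -> graph_rel (edge_rel es) /\ reducible (edge_rel es).
Proof.
case=> ds [s [t [spA E]]].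
have Eds : edge_rel ds =2 edge_rel es.
  by move=> a b; rewrite /edge_rel (perm_mem E).
split; last first.
  apply: (@eq_reducible (fun a b => false || edge_rel ds a b)) => //.
  apply: (sp_reducible_ctx spA) => //.
  by have [_ _ st] := sp_terminals spA; apply: (ReducibleEdge st).
split; first exact: edge_relC.
move=> a; apply/negP; rewrite -Eds => /(sp_edge_in spA).
by rewrite eqxx andbF.
Qed.

End Elimination.

(** * Path covers and their links *)

Ltac perm_count :=
  repeat match goal with H : is_true (perm_eq _ _) |- _ => move/seq.permP in H end;
  let f := fresh "f" in apply/seq.permP=> f;
  repeat match goal with H : _ =1 _ |- _ => move: (H f); clear H end;
  rewrite /= ?count_cat /= ?count_cat /=; lia.

Section Covers.
Variable V : finType.
Implicit Types (E R : seq {set V}) (p q : seq V) (P Q : seq (seq V)).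
Implicit Types (port : V -> V -> V) (L : seq (V * V * V)).
Implicit Types (a b c u v w x y z : V).

(** Excluding one-vertex paths places every vertex of a path on an edge of the
    graph, so that a vertex off all edges is off all paths. *)
Definition covers E Q : bool :=
  all (fun q => uniq q && (1 < size q)) Q &&
  perm_eq (flatten (map (@path_edges V) Q)) E.

(** A path is determined by its links, the pairs of edges that it joins at a
    vertex. The edges of [q] may stand for whole paths between their ends;
    [port b a] is the vertex next to [b] on the path that stands for [ba]. *)
Fixpoint plinks port q : seq (V * V * V) :=
  if q is a :: q1 then
    if q1 is b :: c :: _ then (port b a, b, port b c) :: plinks port q1
    else [::]
  else [::].

Definition links port Q := flatten (map (plinks port) Q).

(** Paths have no direction, so links are read in both ways. *)
Definition slink L a b c := ((a, b, c) \in L) || ((c, b, a) \in L).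

Lemma slink_cat L1 L2 a b c :
  slink (L1 ++ L2) a b c = slink L1 a b c || slink L2 a b c.
Proof.
rewrite /slink !mem_cat.
by case: ((a, b, c) \in L1); case: ((a, b, c) \in L2); rewrite ?orbT.
Qed.

Lemma path_edges_cat q1 x q2 :
  path_edges (q1 ++ x :: q2) = path_edges (rcons q1 x) ++ path_edges (x :: q2).
Proof. by elim: q1 => //= a [|b q1] /= IH; [|rewrite IH]. Qed.

Lemma plinks_cat port q1 x y q2 :
  plinks port (q1 ++ x :: y :: q2) =
  plinks port (q1 ++ [:: x; y]) ++ plinks port (x :: y :: q2).
Proof.
elim: q1 => // a [|b [|c q1]] IH //.
all: rewrite -[_ :: _]/(_ :: _) /= in IH *; by rewrite IH.
Qed.

Lemma path_edges_rev q : perm_eq (path_edges (rev q)) (path_edges q).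
Proof.
elim: q => // a [|b q] IH //.
rewrite rev_cons -cats1 rev_cons cat_rcons path_edges_cat -rev_cons /=.
by rewrite [[set b; a]]setUC cats1 perm_rcons perm_cons.
Qed.

Lemma plinks_rev port q a b c :
  ((a, b, c) \in plinks port (rev q)) = ((c, b, a) \in plinks port q).
Proof.
elim: q => // x [|y [|z q]] IH //.
rewrite rev_cons -cats1 rev_cons rev_cons !cat_rcons.
rewrite plinks_cat mem_cat -cat_rcons cats1 -2!rev_cons IH /= !inE orbC.
by congr (_ || _); apply/eqP/eqP=> -[-> -> ->].
Qed.

Lemma mem_path_edges q e :
  e \in path_edges q -> exists q1 a b q2, q = q1 ++ a :: b :: q2 /\ e = [set a; b].
Proof.
elim: q => // a [|b q] IH //; rewrite inE => /orP[/eqP->|/IH].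
  by exists [::], a, b, q.
by case=> q1 [a' [b' [q2 [-> ->]]]]; exists (a :: q1), a', b', q2.
Qed.

Lemma mem_plinks port q a b c :
  (a, b, c) \in plinks port q ->
  exists q1 a' c' q2, [/\ q = q1 ++ a' :: b :: c' :: q2, a = port b a' & c = port b c'].
Proof.
elim: q => // x [|y [|z q]] IH //; rewrite inE => /orP[/eqP[-> -> ->]|/IH].
  by exists [::], x, z, q.
by case=> q1 [a' [c' [q2 [-> -> ->]]]]; exists (x :: q1), a', c', q2.
Qed.

Lemma path_edges_mem q1 a b q2 : [set a; b] \in path_edges (q1 ++ a :: b :: q2).
Proof. by rewrite path_edges_cat mem_cat mem_head orbT. Qed.

Lemma plinks_mem port q1 a b c q2 :
  (port b a, b, port b c) \in plinks port (q1 ++ a :: b :: c :: q2).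
Proof. by rewrite plinks_cat mem_cat mem_head orbT. Qed.

Lemma eq_plinks port port' q :
  (forall a b, [set a; b] \in path_edges q -> port' a b = port a b) ->
  plinks port' q = plinks port q.
Proof.
elim: q => // a [|b [|c q]] IH // eqp.
have -> : plinks port' [:: a, b, c & q] = (port' b a, b, port' b c) :: plinks port' [:: b, c & q] by [].
rewrite IH => [|x y xy]; last by apply: eqp; rewrite inE xy orbT.
by rewrite !eqp //= ?inE ?eqxx ?orbT // [[set b; a]]setUC eqxx.
Qed.

Lemma vertex_in_edge q z :
  1 < size q -> z \in q -> exists2 e, e \in path_edges q & z \in e.
Proof.
elim: q => // a [|b q] IH // _; rewrite inE => /orP[/eqP->|zq].
  by exists [set a; b]; rewrite ?mem_head ?set21.
case: q IH zq => [|c q] IH zq.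
  by exists [set a; b]; rewrite ?mem_head // in_set2 -(mem_seq1 z b) zq orbT.
by have [//|e eq ze] := IH _ zq; exists e; rewrite // inE eq orbT.
Qed.

Lemma plinks_cons port a b c q :
  plinks port [:: a, b, c & q] =
  (port b a, b, port b c) :: plinks port [:: b, c & q].
Proof. by []. Qed.

Lemma plinks2 port a b : plinks port [:: a; b] = [::].
Proof. by []. Qed.

Lemma links_cons port q Q : links port (q :: Q) = plinks port q ++ links port Q.
Proof. by []. Qed.

Lemma covers_perm E E' Q : perm_eq E E' -> covers E Q = covers E' Q.
Proof. by move=> EE; rewrite /covers (permPr EE). Qed.


Lemma flatten_path_edges_mem Q q e :
  q \in Q -> e \in path_edges q -> e \in flatten (map (@path_edges V) Q).
Proof. by move=> qQ eq; apply/flatten_mapP; exists q. Qed.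

Lemma covers_perm_paths E P Q : perm_eq P Q -> covers E P -> covers E Q.
Proof.
move=> PQ /andP[aP pP]; rewrite /covers -(perm_all _ PQ) aP.
by apply: perm_trans pP; rewrite perm_sym; apply/perm_flatten/perm_map.
Qed.

Lemma slink_perm_paths port P Q a b c :
  perm_eq P Q -> slink (links port P) a b c = slink (links port Q) a b c.
Proof.
by move=> PQ; rewrite /slink !(perm_mem (perm_flatten (perm_map (plinks port) PQ))).
Qed.

Lemma covers_rev E p P : covers E (p :: P) -> covers E (rev p :: P).
Proof.
case/andP=> /= /andP[up aP] pP; rewrite /covers /= rev_uniq size_rev up aP /=.
by rewrite (permPl (perm_cat (path_edges_rev p) (perm_refl _))).
Qed.

Lemma slink_rev_head port p P a b c :
  slink (links port (rev p :: P)) a b c = slink (links port (p :: P)) a b c.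
Proof.
rewrite !links_cons !slink_cat /slink !plinks_rev.
by congr (_ || _); rewrite orbC.
Qed.

(** Paths may be reversed, so the one through [xy] can be taken to visit [x]
    first. *)
Lemma covers_orient x y R Q :
  covers ([set x; y] :: R) Q -> exists q1 q2 Q1,
    [/\ covers ([set x; y] :: R) ((q1 ++ x :: y :: q2) :: Q1),
        size Q = (size Q1).+1
      & forall port a b c, slink (links port Q) a b c =
          slink (links port ((q1 ++ x :: y :: q2) :: Q1)) a b c].
Proof.
move=> cQ; have /andP[_ pQ] := cQ.
have : [set x; y] \in flatten (map (@path_edges V) Q).
  by rewrite (perm_mem pQ) mem_head.
case/flatten_mapP=> q qQ eq; have pq := perm_to_rem qQ.
have cq := covers_perm_paths pq cQ.
have lk port a b c := slink_perm_paths port a b c pq.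
have [q1 [a [b [q2 [Eq /eqP]]]]] := mem_path_edges eq.
rewrite eq_set2 => /orP[]/andP[/eqP Ea /eqP Eb]; subst a b.
  by exists q1, q2, (rem q Q); rewrite -Eq; split=> //; apply: perm_size pq.
have Er : rev q = rev q2 ++ x :: y :: rev q1.
  by rewrite Eq rev_cat !rev_cons !cat_rcons.
exists (rev q2), (rev q1), (rem q Q); rewrite -Er.
split; [exact: covers_rev | exact: perm_size pq |].
by move=> port a b c; rewrite slink_rev_head.
Qed.

Definition fresh z E := all (fun e : {set V} => z \notin e) E.

Lemma fresh_covers z E Q q : covers E Q -> fresh z E -> q \in Q -> z \notin q.
Proof.
case/andP=> aQ pQ fz qQ; apply/negP=> zq.
have /andP[_ sq] := allP aQ _ qQ.
have [e eq ze] := vertex_in_edge sq zq.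
have : e \in E by rewrite -(perm_mem pQ); apply: flatten_path_edges_mem eq.
by move/(allP fz); rewrite ze.
Qed.

Lemma eq_links port port' Q :
  {in Q, forall q, plinks port' q = plinks port q} -> links port' Q = links port Q.
Proof. by move=> eqp; congr flatten; apply/eq_in_map. Qed.

(** * Expanding covers of reduced graphs *)

Section Good.

Variable E0 : seq {set V}.

(** [E] is a reduced graph whose edges stand for paths of the original graph
    [E0]. The links [L] are already decided, all others come from the cover of
    [E]; [k] paths of the original graph are already split off. *)
Definition good E port L k := forall Q, covers E Q -> exists P,
  [/\ covers E0 P, size P = size Q + k
    & forall a b c, slink (links (fun _ => id) P) a b c =
        slink (L ++ links port Q) a b c].

Lemma good_perm E E' port L k :
  perm_eq E E' -> good E port L k -> good E' port L k.
Proof. by move=> EE g Q; rewrite -(covers_perm _ EE); apply: g. Qed.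

(** A path can be split off at any time, at the cost of one path. *)
Lemma good_add p E port L k :
  uniq p -> 1 < size p -> good (path_edges p ++ E) port L k ->
  good E port (plinks port p ++ L) k.+1.
Proof.
move=> up sp g Q /andP[aQ pQ].
have [|P [cP sP lP]] := g (p :: Q).
  by rewrite /covers /= up sp aQ perm_cat2l.
exists P; split=> // [|a b c]; first by rewrite sP /= addSnnS.
rewrite lP links_cons !slink_cat.
by case: (slink L a b c); rewrite ?orbT ?orbF.
Qed.

(** The first edge of a path enters its links only by its port at its second
    end. *)
Lemma plinks_head port port' x u y q :
  (forall a b, ~~ same_edge x y a b -> port' a b = port a b) ->
  port' y x = port y u -> x != y -> x \notin q -> y \notin q ->
  plinks port (u :: y :: q) = plinks port' (x :: y :: q).
Proof.
move=> eqp py xy xq yq.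
have E : plinks port (y :: q) = plinks port' (y :: q).
  apply: eq_plinks => a b /mem_path_edges[q1 [a' [b' [q2 [E /eqP]]]]].
  rewrite eq_set2 => sab; symmetry; apply: eqp; apply/negP=> sxy.
  have : x \in y :: q.
    rewrite E mem_cat !inE; move: sab sxy; rewrite /same_edge.
    by move: xy; dec_eq.
  by rewrite inE (negbTE xy) (negbTE xq).
case: q xq yq E => // c q xq yq E.
rewrite -[LHS]/((port y u, y, port y c) :: plinks port [:: y, c & q]).
rewrite -[RHS]/((port' y x, y, port' y c) :: plinks port' [:: y, c & q]).
rewrite E py (eqp y c) //; move: xq yq; rewrite !inE /same_edge.
by move: xy; dec_eq.
Qed.

Lemma plinks_last port port' x u y q :
  (forall a b, ~~ same_edge x y a b -> port' a b = port a b) ->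
  port' x y = port x u -> x != y -> x \notin q -> y \notin q ->
  plinks port (q ++ [:: x; u]) =i plinks port' (q ++ [:: x; y]).
Proof.
move=> eqp py xy xq yq [[a b] c].
have rE v : q ++ [:: x; v] = rev (v :: x :: rev q).
  by rewrite !rev_cons revK -!cats1 -catA.
rewrite !rE !plinks_rev (@plinks_head port port' y u x) ?mem_rev //.
  by move=> a' b'; rewrite same_edge_sym; apply: eqp.
by rewrite eq_sym.
Qed.

Opaque plinks.

(** Only the path through [xy] is affected by a change of the ports of [xy]. *)
Lemma links_eq_port port port' x y R p Q :
  (forall a b, ~~ same_edge x y a b -> port' a b = port a b) ->
  uniq ([set x; y] :: R) -> covers ([set x; y] :: R) (p :: Q) ->
  [set x; y] \in path_edges p -> links port' Q = links port Q.
Proof.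
move=> eqp uR /andP[_ pQ] xyp.
apply: eq_links => q qQ; apply: eq_plinks => a b ab; apply: eqp.
rewrite -eq_set2; apply/negP=> /eqP Eab; subst.
have : uniq (flatten (map (@path_edges V) (p :: Q))) by rewrite (perm_uniq pQ).
rewrite /= cat_uniq => /and3P[_ /hasPn nh _].
have /nh : [set x; y] \in flatten (map (@path_edges V) Q).
  by rewrite -Eab; apply: flatten_path_edges_mem ab.
by rewrite /= xyp.
Qed.

(** The path through [xy] makes a detour over the new vertex [u]; no path is
    added. *)
Lemma good_sub x y u R port port' L k :
  (forall a b, ~~ same_edge x y a b -> port' a b = port a b) ->
  port' x y = port x u -> port' y x = port y u -> x != y ->
  uniq ([set x; y] :: R) -> fresh u ([set x; y] :: R) ->
  good ([set x; u] :: [set u; y] :: R) port L k ->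
  good ([set x; y] :: R) port' ((port u x, u, port u y) :: L) k.
Proof.
rewrite /good => eqp px py xy uR fu g Q /covers_orient[q1 [q2 [Q1 [cQ sQ lQ]]]].
have lQ1 := links_eq_port eqp uR cQ (path_edges_mem _ _ _ _).
case/andP: (cQ) => /= /andP[/andP[uq _] aQ1] pQ.
have uq1 := fresh_covers cQ fu (mem_head _ _).
have cQ' : covers ([set x; u] :: [set u; y] :: R) ((q1 ++ [:: x, u, y & q2]) :: Q1).
  apply/andP; split=> /=.
    rewrite aQ1 andbT size_cat /= !addnS andbT.
    move: uq uq1; rewrite !cat_uniq mem_cat /= !inE !negb_or.
    case/and3P=> -> /and3P[-> -> ->] /and3P[/andP[_ ->] -> ->].
    by case/and4P=> -> ux -> ->; rewrite xy eq_sym ux.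
  by move: pQ; rewrite !path_edges_cat /= => pQ; clear -pQ; perm_count.
have [P [cP sP lP]] := g _ cQ'.
exists P; split=> //; first by rewrite sP sQ.
move=> a b c; rewrite lP -(cat1s (port u x, u, port u y)) !slink_cat lQ [RHS]orbCA.
congr (_ || _).
rewrite !links_cons lQ1 !slink_cat orbA; congr (_ || _).
move: uq; rewrite cat_uniq /= !inE !negb_or => /and3P[_ /and3P[xq1 yq1 _] /and3P[/andP[_ xq2] yq2 _]].
rewrite (plinks_cat _ _ x y) (plinks_cat _ _ x u) !slink_cat.
rewrite -(plinks_head eqp py) //.
rewrite -[plinks port [:: x, u, y & q2]]cat1s slink_cat orbCA.
by rewrite /slink !(plinks_last eqp px).
Qed.

(** The path [... x y ...] is cut into [... x h alpha] and [beta x y ...]. The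
    first part no longer contains [y], so it may return to it, and the second
    part may pass through [x] for the same reason: this is how one additional
    path covers more edges than a path that is split off. *)
Lemma good_split x y h alpha beta R port port' L k :
  (forall a b, ~~ same_edge x y a b -> port' a b = port a b) ->
  port' x y = port x h -> port' y x = port y x -> x != y ->
  uniq ([set x; y] :: R) ->
  all (fun z => (z == y) || fresh z ([set x; y] :: R)) (h :: alpha) ->
  all (fun z => fresh z ([set x; y] :: R)) beta ->
  uniq (h :: alpha) -> uniq beta -> x \notin h :: alpha ->
  good (path_edges (x :: h :: alpha) ++ path_edges (rcons beta x) ++
        [set x; y] :: R) port L k ->
  good ([set x; y] :: R) port'
    (plinks port (x :: h :: alpha) ++ plinks port (beta ++ [:: x; y]) ++ L) k.+1.
Proof.
rewrite /good => eqp px py xy uR fa fb ua ub xa g Q /covers_orient[q1 [q2 [Q1 [cQ sQ lQ]]]].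
have lQ1 := links_eq_port eqp uR cQ (path_edges_mem _ _ _ _).
case/andP: (cQ) => /= /andP[/andP[uq _] aQ1] pQ.
have fq z : fresh z ([set x; y] :: R) -> z \notin q1 ++ [:: x, y & q2].
  by move=> fz; apply: (fresh_covers cQ fz); rewrite mem_head.
move: (uq); rewrite cat_uniq /= !inE !negb_or => /and3P[uq1 /and3P[xq1 yq1 q12] /and3P[/andP[_ xq2] yq2 uq2]].
have cQ' : covers (path_edges (x :: h :: alpha) ++ path_edges (rcons beta x) ++
        [set x; y] :: R) ((q1 ++ x :: h :: alpha) :: (beta ++ [:: x, y & q2]) :: Q1).
  apply/andP; split=> /=.
    have fb' z : z \in beta -> z \notin q1 ++ [:: x, y & q2] by move/(allP fb)/fq.
    rewrite aQ1 !size_cat /= !addnS !andbT.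
    apply/andP; split; rewrite cat_uniq; apply/and3P; split=> //.
    - apply/hasPn=> z; rewrite inE => /orP[/eqP->//|/(allP fa)/orP[/eqP->//|/fq]].
      by rewrite mem_cat negb_or => /andP[].
    - by rewrite cons_uniq xa.
    - apply/hasPn=> z zq; apply/negP=> /fb'.
      by rewrite mem_cat zq orbT.
    - by rewrite /= inE negb_or xy xq2 yq2.
  move: pQ; rewrite !path_edges_cat /= -!cats1 => pQ; clear -pQ; perm_count.
have [P [cP sP lP]] := g _ cQ'.
exists P; split=> //; first by rewrite sP sQ /= addSnnS.
move=> a b c; rewrite lP !links_cons !slink_cat lQ links_cons lQ1 slink_cat.
rewrite (plinks_cat _ q1 x y) (plinks_cat _ q1 x h) (plinks_cat _ beta x y).
rewrite !slink_cat -(plinks_head eqp py) //.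
have -> : slink (plinks port (q1 ++ [:: x; h])) a b c =
          slink (plinks port' (q1 ++ [:: x; y])) a b c.
  by rewrite /slink !(plinks_last eqp px).
repeat match goal with |- context [slink ?l a b c] =>
  generalize (slink l a b c) end; clear; by do ![case=> //=].
Qed.

Lemma good_init port :
  (forall a b, [set a; b] \in E0 -> port a b = b) -> good E0 port [::] 0.
Proof.
move=> pE Q cQ; exists Q; split=> // [|a b c]; first by rewrite addn0.
rewrite cat0s (@eq_links (fun _ => id) port) // => q qQ.
apply: eq_plinks => u v uv; rewrite pE //.
by case/andP: cQ => _ pQ; rewrite -(perm_mem pQ); apply: flatten_path_edges_mem uv.
Qed.

End Good.
End Covers.

Arguments plinks : simpl never.

(** * Ears *)

Lemma neqF (T : eqType) (a b : T) :
  a != b -> ((a == b) = false) * ((b == a) = false).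
Proof. by move=> ab; rewrite [b == a]eq_sym (negbTE ab). Qed.

Section Ears.
Variable V : finType.
Implicit Types (H : rel V) (F : seq (V * {set V})) (ear : V -> V -> option V).
Implicit Types (a b c u v w x y z : V).

Definition edges H : seq {set V} :=
  enum [set [set p.1; p.2] | p : V * V & H p.1 p.2].

Lemma edges_uniq H : uniq (edges H).
Proof. exact: enum_uniq. Qed.

Lemma mem_edgesP H e :
  reflect (exists a b, H a b /\ e = [set a; b]) (e \in edges H).
Proof.
rewrite mem_enum; apply: (iffP imsetP) => [[[a b]]|[a [b [Hab ->]]]].
  by rewrite inE => Hab ->; exists a, b.
by exists (a, b) => //; rewrite inE.
Qed.

Lemma mem_edges H a b : symmetric H -> ([set a; b] \in edges H) = H a b.
Proof.
move=> Hs; apply/mem_edgesP/idP => [[c [d [Hcd /eqP]]]|]; last by exists a, b.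
by rewrite eq_set2 => /orP[]/andP[/eqP-> /eqP->] //; rewrite Hs.
Qed.

Lemma edges_elim H u x y :
  graph_rel H -> nbrs2 H u x y -> exists R,
    perm_eq (edges (elim H u x y)) ([set x; y] :: R) /\
    perm_eq (edges H) ([set x; u] :: [set u; y] ::
      (if H x y then [set x; y] :: R else R)).
Proof.
move=> gH nu; have [ux uy] := nbrs2_neq gH nu; have [xy Hu] := nu.
have [Hs Hi] := gH; have [Hs' Hi'] := graph_elim u gH xy.
have Hu' z : H z u = (z == x) || (z == y) by rewrite Hs Hu.
set E' := edges _; have xyE' : [set x; y] \in E'.
  by rewrite mem_edges // /elim /same_edge !eqxx !(eq_sym _ u) ux uy /= orbT.
have pE' := perm_to_rem xyE'; exists (rem [set x; y] E'); split=> //.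
suff : perm_eq (edges H) ([set x; u] :: [set u; y] ::
    if H x y then E' else rem [set x; y] E').
  by case: (H x y) => // /permPl ->; rewrite !perm_cons.
have uE' := edges_uniq (elim H u x y).
have rE' a b : ([set a; b] \in (if H x y then E' else rem [set x; y] E')) =
    [&& a != u, b != u & H a b].
  have Ha : same_edge x y a b -> H a b = H x y.
    by case/orP=> /andP[/eqP-> /eqP->] //; rewrite Hs.
  case: ifP => Hxy; rewrite ?mem_rem_uniq // ?inE /= mem_edges // ?eq_set2 /elim.
    have [/Ha->|_] := boolP (same_edge x y a b); last by rewrite orbF.
    by rewrite Hxy.
  have [/Ha->|_] := boolP (same_edge x y a b); last by rewrite orbF.
  by rewrite Hxy !andbF.
have nE' a b : a = u \/ b = u ->
    [set a; b] \notin (if H x y then E' else rem [set x; y] E').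
  by rewrite rE'; case=> ->; rewrite eqxx ?andbF.
apply: uniq_perm; first exact: edges_uniq.
  rewrite !cons_uniq inE negb_or !nE' /=; auto.
  rewrite eq_set2 /same_edge (negbTE xy) eq_sym (negbTE ux) /=.
  by case: ifP => // _; rewrite rem_uniq.
move=> e; rewrite !inE; apply/mem_edgesP/idP => [[a [b [Hab ->]]]|].
  rewrite !eq_set2 rE' Hab andbT.
  have := Hu a; have := Hu b; rewrite /same_edge.
  have [E|_] := eqVneq a u; first by subst a; rewrite Hab => /esym/orP[]/eqP->; rewrite eqxx ?orbT.
  have [E|_] := eqVneq b u; last by rewrite !orbT.
  by subst b; rewrite -Hs Hab => _ /esym/orP[]/eqP->; rewrite eqxx ?orbT.
case/or3P=> [/eqP->|/eqP->|eE].
- by exists x, u; rewrite Hu' eqxx.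
- by exists u, y; rewrite Hu eqxx orbT.
have /mem_edgesP[a [b [_ E]]] : e \in E'.
  by move: eE; case: ifP => // _; rewrite mem_rem_uniq // inE => /andP[].
by exists a, b; move: eE; rewrite E rE' => /and3P[].
Qed.

Definition ear_edges F : seq {set V} :=
  flatten [seq [seq [set f.1; x] | x <- enum (f.2 : {set V})] | f : V * {set V} <- F].

Lemma perm_enum_set2 x y : x != y -> perm_eq (enum [set x; y]) [:: x; y].
Proof.
move=> xy; apply: uniq_perm; rewrite ?enum_uniq //= ?inE ?xy // => z.
by rewrite mem_enum !inE.
Qed.

Lemma ear_edges_cons v x y F :
  x != y -> perm_eq (ear_edges ((v, [set x; y]) :: F))
                    ([set v; x] :: [set v; y] :: ear_edges F).
Proof.
move=> xy.
rewrite -[X in perm_eq _ X]/([:: [set v; x]; [set v; y]] ++ ear_edges F).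
apply: perm_cat => //.
exact: (perm_map (fun z => [set v; z]) (perm_enum_set2 xy)).
Qed.

Lemma perm_ear_edges F F' : perm_eq F F' -> perm_eq (ear_edges F) (ear_edges F').
Proof. by move=> FF; apply/perm_flatten/perm_map. Qed.

Lemma perm_ear_edges_cons v x y F F' :
  x != y -> perm_eq F ((v, [set x; y]) :: F') ->
  perm_eq (ear_edges F) ([set v; x] :: [set v; y] :: ear_edges F').
Proof.
by move=> xy /perm_ear_edges FF; apply: perm_trans FF (ear_edges_cons _ _ _).
Qed.

Definition isolated H v := forall z, ~~ H v z.

Lemma isolated_notin H v e :
  symmetric H -> isolated H v -> e \in edges H -> v \notin e.
Proof.
move=> Hs Hv /mem_edgesP[a [b [Hab ->]]]; rewrite in_set2 negb_or.
apply/andP; split; apply/eqP=> E; subst.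
  by move/negP: (Hv b).
by move/negP: (Hv a); rewrite Hs.
Qed.

(** An ear is a vertex of degree 2 that is set aside because its neighbours are
    adjacent: removing it would merge the new edge with the edge [e] between
    them. It waits for a partner to be removed with, and as [ear] is a function,
    no edge carries two of them. *)
Record ears H ear F : Prop := Ears {
  ears_uniq : uniq (unzip1 F);
  ears_edge : forall v e, (v, e) \in F -> e \in edges H /\ isolated H v;
  ears_mem : forall x y v, H x y -> (ear x y == Some v) = ((v, [set x; y]) \in F)
}.

Lemma ears_perm H ear F F' : perm_eq F F' -> ears H ear F -> ears H ear F'.
Proof.
move=> FF [uF eF mF]; split=> [|v e|x y v Hxy].
- by rewrite -(perm_uniq (perm_map _ FF)).
- by rewrite -(perm_mem FF); apply: eF.
- by rewrite -(perm_mem FF); apply: mF.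
Qed.

Lemma ears_pick H ear F x y v :
  ears H ear F -> H x y -> ear x y = Some v ->
  exists2 F', perm_eq F ((v, [set x; y]) :: F') &
    ears H ear ((v, [set x; y]) :: F').
Proof.
move=> eF Hxy exy; have : (v, [set x; y]) \in F.
  by rewrite -(ears_mem eF) // exy.
by move/perm_to_rem=> pF; exists (rem (v, [set x; y]) F) => //; apply: ears_perm eF.
Qed.

Definition setear ear x y o : V -> V -> option V :=
  fun a b => if same_edge x y a b then o else ear a b.

Lemma ears_clear H ear F x y v :
  H x y -> ears H ear ((v, [set x; y]) :: F) -> ears H (setear ear x y None) F.
Proof.
move=> Hxy [/= /andP[vF uF] eF mF]; split=> // [w e wF|a b w Hab].
  by apply: eF; rewrite inE wF orbT.
rewrite /setear -eq_set2; have [E|nE] := eqVneq [set a; b] [set x; y]; last first.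
  by rewrite mF // inE xpair_eqE (negbTE nE) andbF.
symmetry; apply/negbTE/negP=> wF.
have := mF x y w Hxy; rewrite inE -E wF orbT => /eqP Ew.
have := mF x y v Hxy; rewrite inE eqxx Ew => /eqP[E'].
by case/negP: vF; apply/mapP; exists (w, [set a; b]).
Qed.

Lemma ears_isolated_notin H ear F u : ears H ear F -> ~ isolated H u -> u \notin unzip1 F.
Proof. by move=> eF Hu; apply/negP=> /mapP[[v e] /(ears_edge eF)[_ Hv] E]; rewrite E in Hu. Qed.

Lemma nbrs2_isolated H u x y w :
  graph_rel H -> nbrs2 H u x y -> isolated H w ->
  [/\ isolated (elim H u x y) w, w != u, w != x & w != y].
Proof.
move=> [Hs Hi] [xy Hu] Hw.
have [Hux Huy] : H u x /\ H u y by rewrite !Hu !eqxx orbT.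
have wu : w != u by apply: contraTneq (Hw x) => ->; rewrite Hux.
have wx : w != x by apply: contraTneq (Hw u) => ->; rewrite Hs Hux.
have wy : w != y by apply: contraTneq (Hw u) => ->; rewrite Hs Huy.
split=> // z; rewrite /elim /same_edge (negbTE wx) (negbTE wy) /= orbF.
by rewrite (negbTE (Hw z)) !andbF.
Qed.

Lemma isolated_elim H u x y : isolated (elim H u x y) u.
Proof. by move=> z; rewrite /elim eqxx. Qed.

(** An ear on an edge at [u] would lose the edge that it sits on. *)
Lemma ears_elim H ear ear' F u x y :
  graph_rel H -> nbrs2 H u x y -> ears H ear F ->
  ear u x = None -> ear u y = None ->
  (forall a b, a != u -> b != u -> H a b -> ear' a b = ear a b) ->
  (~~ H x y -> ear' x y = None /\ ear' y x = None) ->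
  ears (elim H u x y) ear' F.
Proof.
move=> gH nu eF ux uy eqe nxy; have [xy Hu] := nu.
have [Hs _] := gH; have [Hs' _] := graph_elim u gH xy.
split=> [|v e vF|a b v]; first exact: ears_uniq eF.
  have [/mem_edgesP[a [b [Hab E]]] Hv] := ears_edge eF vF; subst e.
  have [Hv' _ _ _] := nbrs2_isolated gH nu Hv; split=> //.
  rewrite mem_edges // /elim Hab /= andbT.
  have nF z : H u z -> (v, [set u; z]) \notin F.
    move=> Huz; rewrite -(ears_mem eF) //.
    by move: Huz; rewrite Hu => /orP[]/eqP->; rewrite ?ux ?uy.
  apply/andP; split; apply/eqP=> E; subst.
    by move/negP: (nF _ Hab).
  by rewrite Hs in Hab; move/negP: (nF _ Hab); rewrite setUC.
case/and3P=> au bu Hab.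
have [Hab'|nab] := boolP (H a b); first by rewrite eqe // (ears_mem eF).
rewrite (negbTE nab) /= in Hab.
have -> : ear' a b = None.
  move: (Hab) nab; case/orP=> /andP[/eqP-> /eqP->].
    by case/nxy.
  by rewrite Hs => /nxy[].
symmetry; apply/negbTE; apply: contra nab => /(ears_edge eF)[].
by rewrite mem_edges.
Qed.

Lemma ears_add H ear F x y u :
  graph_rel H -> ears H ear F -> H x y -> ear x y = None -> isolated H u ->
  u \notin unzip1 F -> ears H (setear ear x y (Some u)) ((u, [set x; y]) :: F).
Proof.
move=> [Hs _] eF Hxy exy Hu uF; split=> [|v e|a b v Hab]; first by rewrite /= uF (ears_uniq eF).
  rewrite inE => /orP[/eqP[-> ->]|/(ears_edge eF)//].
  by rewrite mem_edges.
rewrite inE xpair_eqE eq_set2 /setear.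
have [sab|_] := boolP (same_edge x y a b); last by rewrite andbF (ears_mem eF).
rewrite andbT (inj_eq Some_inj) eq_sym orbC.
have -> : [set a; b] = [set x; y] by apply/eqP; rewrite eq_set2.
by rewrite -(ears_mem eF) // exy.
Qed.

Lemma ears_fresh H ear F z :
  ears H ear F -> isolated H z -> symmetric H -> z \notin unzip1 F ->
  fresh z (edges H ++ ear_edges F).
Proof.
move=> eF Hz Hs zF; apply/allP=> e; rewrite mem_cat.
have zE e' : e' \in edges H -> z \notin e' := isolated_notin Hs Hz.
case/orP=> [/zE//|/flatten_mapP[[v e'] vF /mapP[x xe ->]]].
rewrite in_set2 negb_or /=; apply/andP; split.
  by apply: contraNneq zF => ->; apply/mapP; exists (v, e').
have [/zE ze' _] := ears_edge eF vF.
by apply: contraNneq ze' => ->; rewrite mem_enum in xe.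
Qed.

Lemma ears_edges_uniq H ear F :
  symmetric H -> ears H ear F -> uniq (edges H ++ ear_edges F).
Proof.
move=> Hs [uF eF _]; elim: F uF eF => [|[v e] F IH] /=.
  by rewrite cats0 edges_uniq.
case/andP=> vF uF eF.
have {}IH : uniq (edges H ++ ear_edges F).
  by apply: IH => // w e' wF; apply: eF; rewrite inE wF orbT.
have [eE Hv] := eF _ _ (mem_head _ _).
have ve e' : e' \in edges H -> v \notin e' := isolated_notin Hs Hv.
have fv : fresh v (edges H ++ ear_edges F).
  apply/allP=> e'; rewrite mem_cat => /orP[/ve//|/flatten_mapP[[w e''] wF /mapP[x xe ->]]].
  rewrite in_set2 negb_or /=; apply/andP; split.
    by apply: contraNneq vF => ->; apply/mapP; exists (w, e'').
  have [|/ve ve' _] := eF w e''; first by rewrite inE wF orbT.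
  by apply: contraNneq ve' => ->; rewrite mem_enum in xe.
rewrite /ear_edges /= -/(ear_edges F) (perm_uniq (permEl (perm_catCA _ _ _))).
rewrite cat_uniq IH andbT; apply/andP; split.
  rewrite map_inj_in_uniq ?enum_uniq // => x x'; rewrite !mem_enum => xe xe' /eqP.
  rewrite eq_set2 => /orP[]/andP[/eqP]; first by move=> _ /eqP.
  by move=> E; move: (ve _ eE); rewrite E xe'.
apply/hasPn=> e' /(allP fv) ve'; apply/negP=> /mapP[x _ E].
by rewrite E set21 in ve'.
Qed.


(** * Elimination steps *)

Section Invariant.
Variable E0 : seq {set V}.

(** Every path that is split off is paid for by the removal of two vertices;
    subdivided vertices are a bonus. *)
Record invariant H ear port L F k : Prop := Invariant {
  inv_graph : graph_rel H;
  inv_reducible : reducible H;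
  inv_ears : ears H ear F;
  inv_good : good E0 (edges H ++ ear_edges F) port L k;
  inv_count : 2 * k + size F + #|alive H| <= #|V|
}.

Definition add_link (port : V -> V -> V) a b c L := (port b a, b, port b c) :: L.

Definition setport (port : V -> V -> V) x y p : V -> V -> V :=
  fun a b => if (a == x) && (b == y) then p else port a b.

Lemma setport_eq port x y p : setport port x y p x y = p.
Proof. by rewrite /setport !eqxx. Qed.

Lemma setport_neq port x y p a b :
  ~~ ((a == x) && (b == y)) -> setport port x y p a b = port a b.
Proof. by rewrite /setport => /negbTE->. Qed.

Implicit Types (port : V -> V -> V) (L : seq (V * V * V)).

(** Two ears [v] and [w] at the same vertex [u] have a common path
    [x v u w y]. *)
Lemma inv_pair H ear port L F k u x y v w :
  invariant H ear port L F k -> nbrs2 H u x y ->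
  ear u x = Some v -> ear u y = Some w ->
  exists F', invariant H (setear (setear ear u x None) u y None) port
    (add_link port x v u (add_link port v u w (add_link port u w y L))) F' k.+1.
Proof.
case=> gH rH eF gL cnt nu eux euy; have [xy Hu] := nu; have [Hs Hi] := gH.
have [ux uy] := nbrs2_neq gH nu.
have [Hux Huy] : H u x /\ H u y by rewrite !Hu !eqxx orbT.
have [F1 pF1 eF1] := ears_pick eF Hux eux.
have eF1' := ears_clear Hux eF1.
have euy1 : setear ear u x None u y = Some w.
  by rewrite /setear /same_edge eqxx eq_sym (negbTE xy) (negbTE ux).
have [F2 pF2 eF2] := ears_pick eF1' Huy euy1.
have eF2' := ears_clear Huy eF2.
have [_ Hv] := ears_edge eF1 (mem_head _ _).
have [_ Hw] := ears_edge eF2 (mem_head _ _).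
have vw : v != w.
  apply/eqP=> E; subst w; move/andP: (ears_uniq eF1) => [/negP[]].
  by rewrite (perm_mem (perm_map _ pF2)) /= mem_head.
have [_ vu vx vy] := nbrs2_isolated gH nu Hv.
have [_ wu wx wy] := nbrs2_isolated gH nu Hw.
have /= s1 := perm_size pF1; have /= s2 := perm_size pF2.
exists F2; split.
- exact: gH.
- exact: rH.
- exact: eF2'.
- have up : uniq [:: x; v; u; w; y].
    by rewrite /= !inE !(neqF vu, neqF vx, neqF vy, neqF vw, neqF wu, neqF wx,
      neqF wy, neqF ux, neqF uy, neqF xy).
  apply: (good_add up) => //; apply: good_perm gL.
  have p1 := perm_ear_edges_cons ux pF1; have p2 := perm_ear_edges_cons uy pF2.
  rewrite /= [[set x; v]]setUC [[set u; w]]setUC; clear -p1 p2.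
  perm_count.
- by clear -cnt s1 s2; lia.
Qed.

(** What the expansion lemmas ask of the graph after an elimination, with the
    edge [xy] in front. *)
Lemma good_elim H ear F x y R :
  graph_rel H -> ears H ear F -> perm_eq (edges H) ([set x; y] :: R) ->
  [/\ uniq ([set x; y] :: R ++ ear_edges F),
      forall z, isolated H z -> z \notin unzip1 F ->
        fresh z ([set x; y] :: R ++ ear_edges F)
    & forall port L k, good E0 ([set x; y] :: R ++ ear_edges F) port L k ->
        good E0 (edges H ++ ear_edges F) port L k].
Proof.
move=> [Hs _] eF pE.
have pEF : perm_eq (edges H ++ ear_edges F) ([set x; y] :: R ++ ear_edges F).
  by rewrite -cat_cons perm_cat2r.
split=> [|z Hz zF|port L k].
- by rewrite -(perm_uniq pEF); apply: ears_edges_uniq eF.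
- by rewrite /fresh -(perm_all _ pEF); apply: ears_fresh eF _ _ _.
- by apply: good_perm; rewrite perm_sym.
Qed.

Lemma nbrs2_notin H ear F u x y :
  ears H ear F -> nbrs2 H u x y -> u \notin unzip1 F.
Proof.
move=> eF [xy Hu]; apply: ears_isolated_notin eF _ => /(_ x).
by rewrite Hu eqxx.
Qed.

(** The path through [xy] is cut into [... x u y] and [u v x y ...], which
    removes [u] together with its ear [v]. *)
Lemma inv_ear_present H ear port L F k u x y v :
  invariant H ear port L F k -> nbrs2 H u x y ->
  ear u x = Some v -> ear u y = None -> H x y ->
  exists F', invariant (elim H u x y) ear (setport port x y (port x u))
    (add_link port x u y (add_link port u v x (add_link port v x y L))) F' k.+1.
Proof.
case=> gH rH eF gL cnt nu eux euy Hxy; have [xy Hu] := nu; have [Hs Hi] := gH.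
have [ux uy] := nbrs2_neq gH nu.
have [Hux Huy] : H u x /\ H u y by rewrite !Hu !eqxx orbT.
have [F1 pF1 eF1] := ears_pick eF Hux eux.
have [_ Hv] := ears_edge eF1 (mem_head _ _).
have vF1 : v \notin unzip1 F1 by case/andP: (ears_uniq eF1).
have /ears_clear eF1' := eF1; have {eF1'} eF1' := eF1' Hux.
have [Hv' vu vx vy] := nbrs2_isolated gH nu Hv.
have /= s1 := perm_size pF1; have sA := alive_elim gH nu.
have gH' := graph_elim u gH xy.
have eF' : ears (elim H u x y) ear F1.
  apply: (ears_elim gH nu eF1'); rewrite ?Hxy //.
  - by rewrite /setear /same_edge !eqxx.
  - by rewrite /setear; case: ifP.
  - by move=> a b au bu _; rewrite /setear /same_edge (negbTE au) (negbTE bu) andbF.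
have [R [pR]] := edges_elim gH nu; rewrite Hxy => pH.
have [uR fR gR] := good_elim gH' eF' pR.
exists F1; split=> //; first exact: reducible_elim.
  have fu : fresh u ([set x; y] :: R ++ ear_edges F1).
    apply: fR; first exact: isolated_elim.
    exact: nbrs2_notin eF1' nu.
  have fv := fR v Hv' vF1.
  apply: gR; apply: (@good_split V E0 x y u [:: y] [:: u; v]
    (R ++ ear_edges F1) port _ L k).
  - by move=> a b /norP[/setport_neq].
  - by rewrite setport_eq.
  - by rewrite setport_neq // negb_and eq_sym xy.
  - exact: xy.
  - exact: uR.
  - by apply/allP=> z; rewrite !inE => /orP[]/eqP->; rewrite ?fu ?eqxx ?orbT.
  - by apply/allP=> z; rewrite !inE => /orP[]/eqP->.
  - by rewrite /= inE uy.
  - by rewrite /= inE eq_sym vu.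
  - by rewrite !inE !(neqF ux, neqF xy).
  - apply: good_perm gL; have p1 := perm_ear_edges_cons ux pF1.
    by rewrite /= [[set u; v]]setUC; clear -p1 pH; perm_count.
by clear -cnt s1 sA; lia.
Qed.

(** Without an edge [xy], the path [x v u] is split off and [u] subdivides the
    new edge. *)
Lemma inv_ear_absent H ear port L F k u x y v :
  invariant H ear port L F k -> nbrs2 H u x y ->
  ear u x = Some v -> ear u y = None -> ~~ H x y ->
  exists F', invariant (elim H u x y) (setear ear x y None)
    (setport (setport port x y (port x u)) y x (port y u))
    (add_link port x u y (add_link port x v u L)) F' k.+1.
Proof.
case=> gH rH eF gL cnt nu eux euy Hxy; have [xy Hu] := nu; have [Hs Hi] := gH.
have [ux uy] := nbrs2_neq gH nu.
have [Hux Huy] : H u x /\ H u y by rewrite !Hu !eqxx orbT.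
have [F1 pF1 eF1] := ears_pick eF Hux eux.
have [_ Hv] := ears_edge eF1 (mem_head _ _).
have vF1 : v \notin unzip1 F1 by case/andP: (ears_uniq eF1).
have /ears_clear eF1' := eF1; have {eF1'} eF1' := eF1' Hux.
have [Hv' vu vx vy] := nbrs2_isolated gH nu Hv.
have /= s1 := perm_size pF1; have sA := alive_elim gH nu.
have gH' := graph_elim u gH xy.
have eF' : ears (elim H u x y) (setear ear x y None) F1.
  apply: (ears_elim gH nu eF1').
  - by rewrite /setear /same_edge !eqxx.
  - by rewrite /setear; case: ifP.
  - move=> a b au bu Hab; rewrite /setear -!eq_set2.
    have -> : ([set a; b] == [set x; y]) = false.
      by apply: contraNF Hxy => /eqP E; rewrite -mem_edges // -E mem_edges.
    by rewrite eq_set2 /same_edge (negbTE au) (negbTE bu) andbF.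
  - by move=> _; rewrite /setear /same_edge !eqxx orbT.
have [R [pR]] := edges_elim gH nu; rewrite (negbTE Hxy) => pH.
have [uR fR gR] := good_elim gH' eF' pR.
exists F1; split=> //; first exact: reducible_elim.
  have fu : fresh u ([set x; y] :: R ++ ear_edges F1).
    apply: fR; first exact: isolated_elim.
    exact: nbrs2_notin eF1' nu.
  apply: gR; apply: good_sub.
  - by move=> a b /norP[n1]; rewrite andbC => n2; rewrite !setport_neq // andbC.
  - by rewrite setport_neq ?setport_eq // negb_and xy.
  - by rewrite setport_eq.
  - exact: xy.
  - exact: uR.
  - exact: fu.
  have up : uniq [:: x; v; u] by rewrite /= !inE !(neqF vx, neqF vu, neqF ux).
  have := @good_add _ E0 [:: x; v; u] _ port L k up; rewrite plinks_cons plinks2.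
  apply=> //; apply: good_perm gL; have p1 := perm_ear_edges_cons ux pF1.
  by rewrite /= [[set x; v]]setUC; clear -p1 pH; perm_count.
by clear -cnt s1 sA; lia.
Qed.

(** Two vertices [u] and [w] with the neighbours [x] and [y]: the path through
    [xy] is cut into [... x u y w] and [w x y ...]. *)
Lemma inv_combine H ear port L F k u x y w :
  invariant H ear port L F k -> nbrs2 H u x y ->
  ear u x = None -> ear u y = None -> H x y -> ear x y = Some w ->
  exists F', invariant (elim H u x y) (setear ear x y None)
    (setport port x y (port x u))
    (add_link port x u y (add_link port u y w (add_link port w x y L))) F' k.+1.
Proof.
case=> gH rH eF gL cnt nu eux euy Hxy exy; have [xy Hu] := nu; have [Hs Hi] := gH.
have [ux uy] := nbrs2_neq gH nu.
have [F1 pF1 eF1] := ears_pick eF Hxy exy.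
have [_ Hw] := ears_edge eF1 (mem_head _ _).
have wF1 : w \notin unzip1 F1 by case/andP: (ears_uniq eF1).
have /ears_clear eF1' := eF1; have {eF1'} eF1' := eF1' Hxy.
have [Hw' wu wx wy] := nbrs2_isolated gH nu Hw.
have /= s1 := perm_size pF1; have sA := alive_elim gH nu.
have gH' := graph_elim u gH xy.
have eF' : ears (elim H u x y) (setear ear x y None) F1.
  apply: (ears_elim gH nu eF1'); rewrite ?Hxy //.
  - by rewrite /setear; case: ifP.
  - by rewrite /setear; case: ifP.
have [R [pR]] := edges_elim gH nu; rewrite Hxy => pH.
have [uR fR gR] := good_elim gH' eF' pR.
exists F1; split=> //; first exact: reducible_elim.
  have fu : fresh u ([set x; y] :: R ++ ear_edges F1).
    apply: fR; first exact: isolated_elim.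
    exact: nbrs2_notin eF1' nu.
  have fw := fR w Hw' wF1.
  apply: gR; apply: (@good_split V E0 x y u [:: y; w] [:: w]
    (R ++ ear_edges F1) port _ L k).
  - by move=> a b /norP[/setport_neq].
  - by rewrite setport_eq.
  - by rewrite setport_neq // negb_and eq_sym xy.
  - exact: xy.
  - exact: uR.
  - by apply/allP=> z; rewrite !inE => /or3P[]/eqP->; rewrite ?fu ?fw ?eqxx ?orbT.
  - by apply/allP=> z; rewrite !inE => /eqP->.
  - by rewrite /= !inE !(neqF uy, neqF wu, neqF wy).
  - by [].
  - by rewrite !inE !(neqF ux, neqF xy, neqF wx).
  - apply: good_perm gL; have p1 := perm_ear_edges_cons xy pF1.
    by rewrite /= [[set y; w]]setUC; clear -p1 pH; perm_count.
by clear -cnt s1 sA; lia.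
Qed.

Lemma inv_new_ear H ear port L F k u x y :
  invariant H ear port L F k -> nbrs2 H u x y ->
  ear u x = None -> ear u y = None -> H x y -> ear x y = None ->
  exists F', invariant (elim H u x y) (setear ear x y (Some u)) port L F' k.
Proof.
case=> gH rH eF gL cnt nu eux euy Hxy exy; have [xy Hu] := nu; have [Hs Hi] := gH.
have [ux uy] := nbrs2_neq gH nu; have sA := alive_elim gH nu.
have gH' := graph_elim u gH xy.
have eF' : ears (elim H u x y) ear F.
  by apply: (ears_elim gH nu eF); rewrite ?Hxy.
have [R [pR]] := edges_elim gH nu; rewrite Hxy => pH.
exists ((u, [set x; y]) :: F); split=> //; first exact: reducible_elim.
- apply: ears_add => //; last exact: nbrs2_notin eF nu.
    by rewrite /elim Hxy /= !(neqF ux, neqF uy).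
  exact: isolated_elim.
- have := perm_ear_edges_cons xy (perm_refl ((u, [set x; y]) :: F)).
  move: (ear_edges (_ :: F)) => F1 p1.
  apply: good_perm gL; rewrite [[set x; u]]setUC in pH.
  by clear -p1 pH pR; perm_count.
by rewrite /= in cnt *; clear -cnt sA; lia.
Qed.

Lemma inv_subdivide H ear port L F k u x y :
  invariant H ear port L F k -> nbrs2 H u x y ->
  ear u x = None -> ear u y = None -> ~~ H x y ->
  exists F', invariant (elim H u x y) (setear ear x y None)
    (setport (setport port x y (port x u)) y x (port y u))
    (add_link port x u y L) F' k.
Proof.
case=> gH rH eF gL cnt nu eux euy Hxy; have [xy Hu] := nu; have [Hs Hi] := gH.
have [ux uy] := nbrs2_neq gH nu; have sA := alive_elim gH nu.
have gH' := graph_elim u gH xy.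
have eF' : ears (elim H u x y) (setear ear x y None) F.
  apply: (ears_elim gH nu eF) => //.
  - move=> a b au bu Hab; rewrite /setear -eq_set2.
    have -> // : ([set a; b] == [set x; y]) = false.
    by apply: contraNF Hxy => /eqP E; rewrite -mem_edges // -E mem_edges.
  - by move=> _; rewrite /setear /same_edge !eqxx orbT.
have [R [pR]] := edges_elim gH nu; rewrite (negbTE Hxy) => pH.
have [uR fR gR] := good_elim gH' eF' pR.
exists F; split=> //; first exact: reducible_elim.
  have fu : fresh u ([set x; y] :: R ++ ear_edges F).
    apply: fR; first exact: isolated_elim.
    exact: nbrs2_notin eF nu.
  apply: gR; apply: good_sub.
  - by move=> a b /norP[n1]; rewrite andbC => n2; rewrite !setport_neq // andbC.
  - by rewrite setport_neq ?setport_eq // negb_and xy.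
  - by rewrite setport_eq.
  - exact: xy.
  - exact: uR.
  - exact: fu.
  - by apply: good_perm gL; clear -pH; perm_count.
by clear -cnt sA; lia.
Qed.

(** A last ear has no partner and takes a path of its own. The bound is rounded
    up for its sake. *)
Lemma inv_final H ear port L F k s t :
  invariant H ear port L F k -> (forall u x y, ~ nbrs2 H u x y) -> H s t ->
  exists P, [/\ covers E0 P, size P <= uphalf #|V| &
    forall a b c, slink (links (fun _ => id) P) a b c =
      slink (if ear s t is Some v then add_link port s v t L else L) a b c].
Proof.
case=> gH rH eF gL cnt nn Hst; have [Hs Hi] := gH.
have {rH nn} [s' [t' [st' E']]] : exists s' t', s' != t' /\ H =2 same_edge s' t'.
  by case: rH nn => [H' s' t' st' E _|H' u x y nu _ /(_ u x y)//]; exists s', t'.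
have st : s != t by apply: contraTneq Hst => ->; rewrite Hi.
have E : H =2 same_edge s t.
  move: Hst; rewrite E' => /orP[]/andP[/eqP-> /eqP->] // a b.
  by rewrite E' same_edge_sym.
have mE e : e \in edges H -> e = [set s; t].
  case/mem_edgesP=> a [b [Hab ->]]; apply/eqP.
  by rewrite eq_set2 -E.
have pE : perm_eq (edges H) [:: [set s; t]].
  apply: uniq_perm; rewrite ?edges_uniq // => e; rewrite inE.
  by apply/idP/eqP=> [/mE//|->]; rewrite mem_edges.
have cA : 2 <= #|alive H|.
  have <- : #|[set s; t]| = 2 by rewrite cards2 st.
  apply/subset_leq_card/subsetP=> z; rewrite !inE => /orP[]/eqP->.
    by apply/existsP; exists t.
  by apply/existsP; exists s; rewrite Hs.
have c0 : covers [:: [set s; t]] [:: [:: s; t]].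
  by rewrite /covers /= inE st /= perm_refl.
have F0 F1 : ears H (fun _ _ => None) F1 -> F1 = [::].
  case: F1 => // [[v e] F1] [_ eF1 mF1].
  have [/mE Ee _] := eF1 _ _ (mem_head _ _).
  by have := mF1 s t v Hst; rewrite Ee mem_head.
have noear ear' F1 : ears H ear' F1 -> ear' s t = None -> F1 = [::].
  case: F1 => // [[v e] F1] [_ eF1 mF1].
  have [/mE Ee _] := eF1 _ _ (mem_head _ _).
  by have := mF1 s t v Hst; rewrite Ee mem_head => + En; rewrite En.
have fin L' k' : good E0 [:: [set s; t]] port L' k' ->
    k' < uphalf #|V| -> exists P, [/\ covers E0 P, size P <= uphalf #|V| &
      forall a b c, slink (links (fun _ => id) P) a b c = slink L' a b c].
  move=> gL' k'n; have [P [cP sP lP]] := gL' _ c0.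
  exists P; split=> // [|a b c]; first by rewrite sP.
  by rewrite lP links_cons plinks2 cats0.
case est: (ear s t) => [v|]; last first.
  apply: (fin _ k); last by rewrite geq_uphalf_double; clear -cnt cA; lia.
  by apply: good_perm gL; rewrite (noear _ _ eF est) cats0.
have [F1 pF1 eF1] := ears_pick eF Hst est.
have eF1' := ears_clear Hst eF1.
have F10 : F1 = [::] by apply: noear eF1' _; rewrite /setear /same_edge !eqxx.
have [_ Hv] := ears_edge eF1 (mem_head _ _).
have [vs vt] : v != s /\ v != t.
  split; first by apply: contraTneq (Hv t) => ->; rewrite Hst.
  by apply: contraTneq (Hv s) => ->; rewrite Hs Hst.
have /= s1 := perm_size pF1.
apply: (fin _ k.+1); last by rewrite geq_uphalf_double; clear -cnt cA s1; lia.
have up : uniq [:: s; v; t] by rewrite /= !inE !(neqF vs, neqF vt, neqF st).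
have := @good_add _ E0 [:: s; v; t] _ port L k up; rewrite plinks_cons plinks2.
apply=> //; apply: good_perm gL; have p1 := perm_ear_edges_cons st pF1.
rewrite F10 in p1; rewrite /= [[set s; v]]setUC.
by have e0 : ear_edges [::] = [::] :> seq {set V} by []; rewrite e0 in p1; clear -p1 pE; perm_count.
Qed.

End Invariant.

Lemma inv_init (es : seq (V * V)) port :
  series_parallel es -> simple_graph es ->
  (forall a b, edge_rel es a b -> port a b = b) ->
  invariant (map (@uedge V) es) (edge_rel es) (fun _ _ => None) port [::] [::] 0.
Proof.
move=> /series_parallel_reducible[gH rH] se pE; split=> //; last exact: max_card.
apply: (@good_perm _ _ (map (@uedge V) es)); last exact: good_init.
rewrite cats0; apply: uniq_perm => //; first exact: edges_uniq.
move=> e; apply/idP/mem_edgesP => [/mapP[[a b] ab ->]|[a [b [Hab ->]]] //].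
by exists a, b; split=> //; apply/mapP; exists (a, b).
Qed.

Lemma covers_path_cover (es : seq (V * V)) P :
  simple_graph es -> covers (map (@uedge V) es) P -> path_cover es P.
Proof.
move=> se /andP[aP pP]; split.
  apply/allP=> p pP'; have /andP[up sp] := allP aP p pP'.
  rewrite /simple_path up andTb; case: p sp up pP' => //= a p _ _ pP'.
  apply/allP=> e ep; suff : e \in map (@uedge V) es by [].
  by rewrite -(perm_mem pP); exact: (flatten_path_edges_mem pP' ep).
move=> e eE; have uP : uniq (flatten (map (@path_edges V) P)) by rewrite (perm_uniq pP).
have : count_mem e (flatten (map (@path_edges V) P)) = 1.
  by rewrite count_uniq_mem // (perm_mem pP) eE.
rewrite count_flatten -map_comp => <-; rewrite -sumn_count; congr sumn.
apply/eq_in_map => p pP' /=; rewrite count_uniq_mem //.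
have := perm_to_rem pP' => /(perm_map (@path_edges V))/perm_flatten/perm_uniq.
by rewrite uP /= cat_uniq => /esym/and3P[].
Qed.

(** If there is exactly one ear at [u], the names of the neighbours are swapped
    when needed so that it sits on [ux]. *)
Lemma inv_step E0 H ear port L F k u x y :
  invariant E0 H ear port L F k -> nbrs2 H u x y ->
  exists x' y' ear' port' L' F' k',
    nbrs2 H u x' y' /\ invariant E0 (elim H u x' y') ear' port' L' F' k'.
Proof.
move=> I nu; have [xy _] := nu.
have step0 ear1 L1 F1 k1 : invariant E0 H ear1 port L1 F1 k1 ->
    ear1 u x = None -> ear1 u y = None ->
    exists x' y' ear' port' L' F' k',
      nbrs2 H u x' y' /\ invariant E0 (elim H u x' y') ear' port' L' F' k'.
  move=> I1 eux euy; have [Hxy|Hxy] := boolP (H x y); last first.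
    have [F' I'] := inv_subdivide I1 nu eux euy Hxy.
    by do 7!eexists; split; [exact: nu | exact: I'].
  case exy: (ear1 x y) => [w|].
    have [F' I'] := inv_combine I1 nu eux euy Hxy exy.
    by do 7!eexists; split; [exact: nu | exact: I'].
  have [F' I'] := inv_new_ear I1 nu eux euy Hxy exy.
  by do 7!eexists; split; [exact: nu | exact: I'].
have step1 x1 y1 v : nbrs2 H u x1 y1 -> ear u x1 = Some v -> ear u y1 = None ->
    exists x' y' ear' port' L' F' k',
      nbrs2 H u x' y' /\ invariant E0 (elim H u x' y') ear' port' L' F' k'.
  move=> nu1 eux euy; have [Hxy|Hxy] := boolP (H x1 y1).
    have [F' I'] := inv_ear_present I nu1 eux euy Hxy.
    by do 7!eexists; split; [exact: nu1 | exact: I'].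
  have [F' I'] := inv_ear_absent I nu1 eux euy Hxy.
  by do 7!eexists; split; [exact: nu1 | exact: I'].
case ex: (ear u x) => [v|]; case ey: (ear u y) => [w|].
- have [F' I'] := inv_pair I nu ex ey.
  apply: step0 I' _ _; last by rewrite /setear /same_edge !eqxx.
  by rewrite /setear /same_edge !eqxx; case: ifP.
- exact: step1 nu ex ey.
- exact: step1 (nbrs2C nu) ey ex.
- exact: step0 I ex ey.
Qed.

Lemma inv_cover E0 H ear port L F k :
  invariant E0 H ear port L F k ->
  exists2 P, covers E0 P & size P <= uphalf #|V|.
Proof.
have [m] := ubnP #|alive H|; elim: m => // m IH in H ear port L F k *.
rewrite ltnS => Hm I; have [gH rH _ _ _] := I.
case: rH => [H' s t st E|H' u x y nu _] in gH Hm I *.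
  have [||P [cP sP _]] := inv_final (s := s) (t := t) I; last by exists P.
    move=> u x y [xy Hu]; have := Hu x; have := Hu y.
    by rewrite !E !eqxx orbT /same_edge; move: xy st; dec_eq.
  by rewrite E /same_edge !eqxx.
have [x' [y' [ear' [port' [L' [F' [k' [nu' I']]]]]]]] := inv_step I nu.
by apply: IH I'; rewrite -(alive_elim gH nu').
Qed.

Lemma series_parallel_path_cover (es : seq (V * V)) :
  series_parallel es -> simple_graph es ->
  exists P, path_cover es P /\ size P <= uphalf #|V|.
Proof.
move=> sp_es se.
have I := inv_init (port := fun _ b => b) sp_es se (fun _ _ _ => erefl).
have [P cP sP] := inv_cover I.
by exists P; split=> //; apply: covers_path_cover.
Qed.

End Ears.

(** * Total correctness of programs *)

Section Wp.
Variable W : nat.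

(** Running time is treated apart: for programs without loops it has a bound that
    does not depend on the memory. *)
Definition wp c mu (Q : memory -> Prop) := exists t nu, exec W c mu t nu /\ Q nu.

Lemma wp_mono c mu (Q Q' : memory -> Prop) :
  wp c mu Q -> (forall nu, Q nu -> Q' nu) -> wp c mu Q'.
Proof. by case=> t [nu [e q]] QQ; exists t, nu; split=> //; apply: QQ. Qed.

Lemma wp_seq c1 c2 mu Q : wp c1 mu (fun nu => wp c2 nu Q) -> wp (Seq c1 c2) mu Q.
Proof.
by case=> t1 [nu [e1 [t2 [xi [e2 q]]]]]; exists (t1 + t2).+1, xi; split=> //; apply: ExecSeq e1 e2.
Qed.

Lemma wp_skip mu (Q : memory -> Prop) : Q mu -> wp Skip mu Q.
Proof. by exists 1, mu; split=> //; apply: ExecSkip. Qed.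

Lemma wp_write a i e iv ev mu (Q : memory -> Prop) :
  eval W mu i = iv -> eval W mu e = ev -> Q (update mu a iv ev) ->
  wp (Write a i e) mu Q.
Proof. by move=> <- <- q; do 2!eexists; split; [apply: ExecWrite | exact: q]. Qed.

Lemma wp_if (b : bool) e c1 c2 mu Q :
  (eval W mu e != 0) = b -> (b -> wp c1 mu Q) -> (~~ b -> wp c2 mu Q) ->
  wp (If e c1 c2) mu Q.
Proof.
case: b => ev w1 w2.
  have [t [nu [ex q]]] := w1 isT; do 2!eexists; split; last exact: q.
  by apply: ExecIfTrue ex.
have [t [nu [ex q]]] := w2 isT; do 2!eexists; split; last exact: q.
by apply: ExecIfFalse ex; move/negbFE/eqP: ev.
Qed.

Fixpoint loop_free c :=
  match c with
  | Skip | Write _ _ _ => true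
  | Seq c1 c2 | If _ c1 c2 => loop_free c1 && loop_free c2
  | While _ _ => false
  end.

Fixpoint max_time c :=
  match c with
  | Skip => 1
  | Write _ i e => (cost i + cost e).+1
  | Seq c1 c2 => (max_time c1 + max_time c2).+1
  | If e c1 c2 => (cost e + (max_time c1 + max_time c2)).+1
  | While _ _ => 0
  end.

Lemma exec_max_time c mu t nu : exec W c mu t nu -> loop_free c -> t <= max_time c.
Proof.
elim=> //= {c mu t nu}.
- by move=> c1 c2 mu nu xi t1 t2 _ IH1 _ IH2 /andP[/IH1 ? /IH2 ?]; lia.
- by move=> e c1 c2 mu nu t _ _ IH /andP[/IH ? _]; lia.
- by move=> e c1 c2 mu nu t _ _ IH /andP[_ /IH ?]; lia.
Qed.

(** The potential pays for every iteration, so that the cost of a loop, and of a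
    loop nested in it, is bounded by the potential that is used up. *)
Lemma exec_while e c (I : nat -> memory -> Prop) :
  (forall phi mu, I phi mu -> eval W mu e != 0 -> exists t nu psi,
    [/\ exec W c mu t nu, I psi nu & cost e + t + psi < phi]) ->
  forall phi mu, I phi mu -> exists t nu psi,
    [/\ exec W (While e c) mu t nu, I psi nu, eval W nu e = 0
      & t + psi <= phi + (cost e).+1].
Proof.
move=> step phi; have [m] := ubnP phi; elim: m => // m IH in phi *.
rewrite ltnS => pm mu Imu; case: (altP (eval W mu e =P 0)) => ev.
  by exists (cost e).+1, mu, phi; split; rewrite 1?addnC //; apply: ExecWhileFalse.
have [t1 [nu [psi [ex1 Inu lt]]]] := step _ _ Imu ev.
have [|t2 [xi [psi2 [ex2 Ixi ev2 le]]]] := IH psi _ nu Inu.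
  by apply: leq_trans pm; apply: leq_ltn_trans lt; apply: leq_addl.
exists (cost e + t1 + t2).+1, xi, psi2; split=> //.
  exact: ExecWhileTrue ex1 ex2.
by clear -lt le; lia.
Qed.

Lemma exec_loop_free c mu Q : loop_free c -> wp c mu Q ->
  exists t nu, [/\ exec W c mu t nu, t <= max_time c & Q nu].
Proof.
by move=> lf [t [nu [ex q]]]; exists t, nu; split=> //; apply: exec_max_time ex lf.
Qed.

Lemma eval_const mu c : c < W -> eval W mu (Const c) = c.
Proof. exact: modn_small. Qed.

Lemma eval_read mu a e i : eval W mu e = i -> eval W mu (Read a e) = mu a i.
Proof. by move=> /= ->. Qed.

Lemma eval_op mu o e1 e2 x y :
  eval W mu e1 = x -> eval W mu e2 = y -> eval_binop o x y < W ->
  eval W mu (Binop o e1 e2) = eval_binop o x y.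
Proof. by move=> /= -> -> lt; rewrite modn_small. Qed.

Definition Var r := Read r (Const 0).

Lemma eval_var mu r : eval W mu (Var r) = mu r 0.
Proof. by rewrite /= mod0n. Qed.

End Wp.


(** * Memory layout *)

(** A matrix entry [(a, b)] is the cell [a * n + b] of its array. Only a linear
    number of these quadratically many cells is ever written, and the others
    need no initialisation.  Per pair of vertices: adjacency, port, ear on the
    edge, the continuation of a path that comes from [a] to [b], and a mark for
    path ends.  Per vertex: degree, sum and sum of squares of the neighbours.
    Furthermore a table of square roots and a queue of vertices.  Vertices that
    may be missing are stored with an offset of 1, so that 0 means none. *)
Notation ADJ := 6 (only parsing).
Notation DEG := 7 (only parsing).
Notation SUM := 8 (only parsing).
Notation SQS := 9 (only parsing).
Notation PORT := 10 (only parsing).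
Notation EAR := 11 (only parsing).
Notation NXT := 12 (only parsing).
Notation ROOT := 13 (only parsing).
Notation QUE := 14 (only parsing).
Notation DONE := 15 (only parsing).
Notation HEAD := 16 (only parsing).
Notation TAIL := 17 (only parsing).
Notation POS := 18 (only parsing).
Notation OUT := 19 (only parsing).
Notation LEN := 20 (only parsing).
Notation TMP := 21 (only parsing).
Notation TMP2 := 22 (only parsing).
(** The vertex to be eliminated, its two neighbours, and two ears. *)
Notation RU := 30 (only parsing).
Notation RX := 31 (only parsing).
Notation RY := 32 (only parsing).
Notation RV := 33 (only parsing).
Notation RW := 34 (only parsing).

Definition registers := [:: RU; RX; RY; RV; RW].

Definition size_n := Read 0 (Const 0).
Definition pair_at r s := Binop Add (Binop Mul (Var r) size_n) (Var s).
Definition succ e := Binop Add e (Const 1).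
Definition pred_of e := Binop Defs.Sub e (Const 1).
Definition set_reg r e := Write r (Const 0) e.

Definition link_cmd ra rb rc :=
  Seq (set_reg TMP (Read PORT (pair_at rb ra)))
  (Seq (set_reg TMP2 (Read PORT (pair_at rb rc)))
  (Seq (Write NXT (pair_at TMP rb) (succ (Var TMP2)))
       (Write NXT (pair_at TMP2 rb) (succ (Var TMP))))).

Definition set_ear_cmd rx ry e :=
  Seq (Write EAR (pair_at rx ry) e) (Write EAR (pair_at ry rx) e).

Definition set_port_cmd rx ry e := Write PORT (pair_at rx ry) e.

(** The weight [w] of a neighbour is 1 for degrees, its number for sums, and the
    square of its number for sums of squares. *)
Definition update_sum_cmd o arr (w : nat -> expr) ra rb :=
  Seq (Write arr (Var ra) (Binop o (Read arr (Var ra)) (w rb)))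
      (Write arr (Var rb) (Binop o (Read arr (Var rb)) (w ra))).

Definition square_of r := Binop Mul (Var r) (Var r).

Definition change_edge_cmd o bit ra rb :=
  Seq (Write ADJ (pair_at ra rb) (Const bit))
  (Seq (Write ADJ (pair_at rb ra) (Const bit))
  (Seq (update_sum_cmd o DEG (fun _ => Const 1) ra rb)
  (Seq (update_sum_cmd o SUM Var ra rb)
       (update_sum_cmd o SQS square_of ra rb)))).

Section Ram.
Variable n : nat.
Hypothesis n1 : 1 < n.

Local Notation W := (n ^ 8).
Local Notation V := 'I_n.
Implicit Types (H : rel V) (ear : V -> V -> option V) (port : V -> V -> V).
Implicit Types (L : seq (V * V * V)) (rho : nat -> V) (mu nu : memory).

Lemma word_size : [/\ 32 * (n * n * n) <= W, 2 * (n * n) <= n * n * n & 2 * n <= n * n].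
Proof.
have -> : n ^ 8 = (n * n * n) * n ^ 5.
  by rewrite (expnD n 3 5); congr (_ * _); rewrite !expnS expn0 muln1 mulnA.
split; first by rewrite mulnC leq_mul2l (leq_exp2r 2 n (isT : 0 < 5)) n1 orbT.
  by rewrite mulnC leq_mul2l n1 orbT.
by rewrite leq_mul2r n1 orbT.
Qed.

Lemma pair_lt (a b : V) : a * n + b < n * n.
Proof. have := ltn_ord a; have := ltn_ord b; clear; nia. Qed.

Lemma pair_inj (a b c d : V) : (a * n + b == c * n + d) = (a == c) && (b == d).
Proof.
apply/eqP/andP=> [E|[/eqP-> /eqP->] //].
have n0 : 0 < n := ltnW n1.
split; apply/eqP/val_inj => /=.
  by have /(congr1 (divn^~ n)) := E; rewrite !divnMDl // !divn_small ?addn0.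
by have /(congr1 (modn^~ n)) := E; rewrite !modnMDl !modn_small.
Qed.

Definition stores_pairs (f : V -> V -> nat) (arr : nat -> nat) :=
  forall a b : V, arr (a * n + b) = f a b.

Definition stores_sums (f : V -> nat) H (arr : nat -> nat) :=
  forall a : V, arr a = \sum_(b | H a b) f b.

Definition code_opt (o : option V) : nat := if o is Some v then v.+1 else 0.

(** A cell might be written twice, so the array is only required to hold some
    link whenever there is one. In the end there is only one candidate, as the
    links are those of disjoint paths. *)
Definition stores_links L (arr : nat -> nat) :=
  (forall a b : V, arr (a * n + b) = 0 \/
     exists2 c : V, arr (a * n + b) = c.+1 & slink L a b c) /\
  (forall a b c : V, slink L a b c -> arr (a * n + b) != 0).

Record repr H ear port L mu : Prop := Repr {
  repr_n : mu 0 0 = n;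
  repr_adj : stores_pairs (fun a b => H a b) (mu ADJ);
  repr_deg : stores_sums (fun _ => 1) H (mu DEG);
  repr_sum : stores_sums val H (mu SUM);
  repr_sqs : stores_sums (fun b => b * b) H (mu SQS);
  repr_port : stores_pairs (fun a b => port a b) (mu PORT);
  repr_ear : stores_pairs (fun a b => code_opt (ear a b)) (mu EAR);
  repr_links : stores_links L (mu NXT)
}.

Definition env rho mu := forall r, r \in registers -> mu r 0 = rho r.

Definition frame (rs : seq nat) mu nu := forall r j, r \notin rs -> nu r j = mu r j.

Definition elim_arrays :=
  [:: ADJ; DEG; SUM; SQS; PORT; EAR; NXT; TMP; TMP2] ++ registers.

(** [rho] names the vertices in the registers. Everything outside
    [elim_arrays] is as in the memory [mu0] before the elimination. *)
Record state rho H ear port L mu0 mu : Prop := State {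
  state_repr : repr H ear port L mu;
  state_env : env rho mu;
  state_frame : frame elim_arrays mu0 mu
}.

Lemma env_update rho mu a i v :
  a \notin registers -> env rho mu -> env rho (update mu a i v).
Proof.
move=> ar rmu r rr; rewrite /update; case: eqP => [E|_]; last exact: rmu.
by rewrite -E rr in ar.
Qed.

Lemma frame_update rs mu0 mu a i v :
  a \in rs -> frame rs mu0 mu -> frame rs mu0 (update mu a i v).
Proof.
move=> ars f r j rrs; rewrite /update; case: eqP => [E|_]; last exact: f.
by rewrite E ars in rrs.
Qed.

Definition setrho rho r v : nat -> V := fun s => if s == r then v else rho s.

Lemma env_set rho mu r (v : V) :
  env rho mu -> env (setrho rho r v) (update mu r 0 v).
Proof.
by move=> rmu s sr; rewrite /update /setrho eqxx andbT; case: eqP => // _; apply: rmu.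
Qed.

Lemma eval_size mu : mu 0 0 = n -> eval W mu size_n = n.
Proof. by move=> <-; rewrite /= mod0n. Qed.

Lemma eval_pair mu r s (a b : V) :
  mu 0 0 = n -> mu r 0 = a -> mu s 0 = b -> eval W mu (pair_at r s) = a * n + b.
Proof.
move=> mn mr ms; have [W1 W2 W3] := word_size; have ab := pair_lt a b.
have lt1 : a * n + b < W by clear -ab W1 W2; lia.
have lt2 : a * n < W by apply: leq_ltn_trans lt1; apply: leq_addr.
apply: (@eval_op W mu Add _ _ (a * n) b) => //; last by rewrite eval_var.
by apply: (@eval_op W mu Mul _ _ a n); rewrite ?eval_var ?eval_size.
Qed.

Lemma eval_succ mu e x :
  eval W mu e = x -> x <= 2 * (n * n) -> eval W mu (succ e) = x.+1.
Proof.
have [W1 W2 W3] := word_size => ev lt.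
have lt1 : x.+1 < W by clear -n1 lt W1 W2 W3; lia.
rewrite /succ (@eval_op W mu Add e (Const 1) x 1) ?eval_const ?[eval_binop _ _ _]addn1 //.
by clear -n1 lt1; lia.
Qed.

Lemma stores_links_add L arr port (a b c : V) :
  stores_links L arr ->
  stores_links (add_link port a b c L)
    (fun j => if j == port b c * n + b then (port b a).+1
              else if j == port b a * n + b then (port b c).+1 else arr j).
Proof.
case=> l1 l2; split=> [x y|x y z].
  rewrite !pair_inj; case: ifP => [/andP[/eqP-> /eqP->]|_].
    by right; exists (port b a) => //; rewrite /slink !inE eqxx orbT.
  case: ifP => [/andP[/eqP-> /eqP->]|_].
    by right; exists (port b c) => //; rewrite /slink !inE eqxx.
  have [|[z -> lz]] := l1 x y; first by left.
  by right; exists z => //; move: lz; rewrite /slink !inE => /orP[]->; rewrite !orbT.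
rewrite /slink !inE !pair_inj => lz; case: ifP => // n2; case: ifP => // n3.
move: lz; rewrite -orbA; case/or4P.
- by case/eqP=> E1 E2 _; rewrite E1 E2 !eqxx in n3.
- by move=> lz; apply: (l2 x y z); rewrite /slink lz.
- by case/eqP=> _ E1 E2; rewrite E1 E2 !eqxx in n2.
- by move=> lz; apply: (l2 x y z); rewrite /slink lz orbT.
Qed.

Lemma wp_link rho H ear port L mu0 mu ra rb rc :
  ra \in registers -> rb \in registers -> rc \in registers ->
  state rho H ear port L mu0 mu ->
  wp W (link_cmd ra rb rc) mu
    (state rho H ear port (add_link port (rho ra) (rho rb) (rho rc) L) mu0).
Proof.
move=> ar br cr [[mn madj mdeg msum msqs mport mear mlinks] rmu fmu].
set a := rho ra; set b := rho rb; set c := rho rc.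
apply: wp_seq; apply: (@wp_write _ _ _ _ 0 (port b a)); first by rewrite eval_const //; clear -n1; lia.
  by rewrite (eval_read _ (eval_pair mn (rmu _ br) (rmu _ ar))) mport.
set mu1 := update _ _ _ _; have rmu1 : env rho mu1 by apply: env_update.
apply: wp_seq; apply: (@wp_write _ _ _ _ 0 (port b c)); first by rewrite eval_const //; clear -n1; lia.
  by rewrite (eval_read _ (eval_pair (mu := mu1) mn (rmu1 _ br) (rmu1 _ cr))); apply: mport.
set mu2 := update _ _ _ _; have rmu2 : env rho mu2 by apply: env_update.
have lepair (v : V) : v <= 2 * (n * n) by have := ltn_ord v; clear -n1; nia.
apply: wp_seq; apply: (@wp_write _ _ _ _ (port b a * n + b) (port b c).+1).
- exact: (@eval_pair mu2 TMP rb (port b a) b mn (erefl _) (rmu2 _ br)).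
- by apply: eval_succ; rewrite ?eval_var.
set mu3 := update _ _ _ _; have rmu3 : env rho mu3 by apply: env_update.
apply: (@wp_write _ _ _ _ (port b c * n + b) (port b a).+1).
- exact: (@eval_pair mu3 TMP2 rb (port b c) b mn (erefl _) (rmu3 _ br)).
- by apply: eval_succ; rewrite ?eval_var.
split.
- by split=> //; apply: (stores_links_add _ _ _ _ mlinks).
- exact: env_update.
- by do 4!apply: frame_update => //.
Qed.


Lemma const_small c : c <= 3 -> c < W.
Proof. by have [W1 W2 W3] := word_size; clear -n1 W1 W2 W3; nia. Qed.

Lemma eval_succ_reg mu r (v : V) : mu r 0 = v -> eval W mu (succ (Var r)) = v.+1.
Proof.
move=> mv; apply: eval_succ; rewrite ?eval_var ?mv //.
by have := ltn_ord v; clear -n1; nia.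
Qed.

Lemma wp_set_ear rho H ear port L mu0 mu rx ry e o :
  rx \in registers -> ry \in registers ->
  (forall mu', env rho mu' -> eval W mu' e = code_opt o) ->
  state rho H ear port L mu0 mu ->
  wp W (set_ear_cmd rx ry e) mu
    (state rho H (setear ear (rho rx) (rho ry) o) port L mu0).
Proof.
move=> xr yr ev [[mn madj mdeg msum msqs mport mear mlinks] rmu fmu].
apply: wp_seq; apply: (@wp_write _ _ _ _ (rho rx * n + rho ry) (code_opt o)).
- exact: (eval_pair mn (rmu _ xr) (rmu _ yr)).
- exact: ev.
set mu1 := update _ _ _ _; have rmu1 : env rho mu1 by apply: env_update.
apply: (@wp_write _ _ _ _ (rho ry * n + rho rx) (code_opt o)).
- exact: (eval_pair (mu := mu1) mn (rmu1 _ yr) (rmu1 _ xr)).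
- exact: ev.
split; [split=> // a b | exact: env_update | by do 2!apply: frame_update => //].
rewrite /update eqxx /= /mu1 /update eqxx /= !pair_inj /setear /same_edge.
by case: (_ && _) (_ && _) => [] [].
Qed.

Lemma wp_set_port rho H ear port L mu0 mu rx ry e (v : V) :
  rx \in registers -> ry \in registers -> eval W mu e = v ->
  state rho H ear port L mu0 mu ->
  wp W (set_port_cmd rx ry e) mu
    (state rho H ear (setport port (rho rx) (rho ry) v) L mu0).
Proof.
move=> xr yr ev [[mn madj mdeg msum msqs mport mear mlinks] rmu fmu].
apply: (@wp_write _ _ _ _ (rho rx * n + rho ry) v) => //.
  exact: (eval_pair mn (rmu _ xr) (rmu _ yr)).
split; [split=> // a b | exact: env_update | exact: frame_update].
by rewrite /update eqxx /= pair_inj /setport; case: ifP.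
Qed.

Lemma wp_copy_port rho H ear port L mu0 mu rx ry ru :
  rx \in registers -> ry \in registers -> ru \in registers ->
  state rho H ear port L mu0 mu ->
  wp W (set_port_cmd rx ry (Read PORT (pair_at rx ru))) mu
    (state rho H ear (setport port (rho rx) (rho ry) (port (rho rx) (rho ru))) L mu0).
Proof.
move=> xr yr ur st; apply: wp_set_port => //.
have [[mn _ _ _ _ mport _ _] rmu _] := st.
by rewrite (eval_read _ (eval_pair mn (rmu _ xr) (rmu _ ur))) mport.
Qed.

Lemma repr_set_reg H ear port L mu r v :
  r \in registers -> repr H ear port L mu -> repr H ear port L (update mu r 0 v).
Proof.
by rewrite !inE => /or4P[/eqP->|/eqP->|/eqP->|/orP[]/eqP->] [*].
Qed.

Lemma state_set_reg rho H ear port L mu0 mu r (v : V) :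
  r \in registers -> state rho H ear port L mu0 mu ->
  state (setrho rho r v) H ear port L mu0 (update mu r 0 v).
Proof.
move=> rr [re rmu fmu]; split; [exact: repr_set_reg | exact: env_set |].
by apply: frame_update => //; rewrite mem_cat rr orbT.
Qed.

Lemma wp_set_reg rho H ear port L mu0 mu r e (v : V) :
  r \in registers -> eval W mu e = v -> state rho H ear port L mu0 mu ->
  wp W (set_reg r e) mu (state (setrho rho r v) H ear port L mu0).
Proof.
move=> rr ev st; apply: (@wp_write _ _ _ _ 0 v) => //.
  by rewrite eval_const // const_small.
exact: state_set_reg.
Qed.

Lemma eval_ear rho H ear port L mu0 mu rx ry :
  rx \in registers -> ry \in registers -> state rho H ear port L mu0 mu ->
  eval W mu (Read EAR (pair_at rx ry)) = code_opt (ear (rho rx) (rho ry)).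
Proof.
move=> xr yr [[mn _ _ _ _ _ mear _] rmu _].
by rewrite (eval_read _ (eval_pair mn (rmu _ xr) (rmu _ yr))) mear.
Qed.

Lemma eval_adj rho H ear port L mu0 mu rx ry :
  rx \in registers -> ry \in registers -> state rho H ear port L mu0 mu ->
  eval W mu (Read ADJ (pair_at rx ry)) = H (rho rx) (rho ry).
Proof.
move=> xr yr [[mn madj _ _ _ _ _ _] rmu _].
by rewrite (eval_read _ (eval_pair mn (rmu _ xr) (rmu _ yr))) madj.
Qed.

Lemma wp_get_ear rho H ear port L mu0 mu r rx ry (v : V) :
  r \in registers -> rx \in registers -> ry \in registers ->
  ear (rho rx) (rho ry) = Some v -> state rho H ear port L mu0 mu ->
  wp W (set_reg r (pred_of (Read EAR (pair_at rx ry)))) mu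
    (state (setrho rho r v) H ear port L mu0).
Proof.
move=> rr xr yr ev st; apply: wp_set_reg => //.
have -> : v = eval_binop Defs.Sub v.+1 1 :> nat by rewrite /= subn1.
apply: eval_op; first by rewrite (eval_ear xr yr st) ev.
  by rewrite eval_const // const_small.
rewrite /= subn1 /=; have [W1 W2 W3] := word_size; have := ltn_ord v.
by clear -W1 W2 W3; lia.
Qed.

(** Covers both insertion of an edge, with [Add], and deletion, with subtraction. *)
Definition edge_change o (bit : bool) H H' (a b : V) :=
  [/\ forall c d, H' c d = if same_edge a b c d then bit else H c d,
      forall c, c != a -> c != b -> H c =1 H' c
    & forall f : V -> nat,
      eval_binop o (\sum_(d | H a d) f d) (f b) = \sum_(d | H' a d) f d /\
      eval_binop o (\sum_(d | H b d) f d) (f a) = \sum_(d | H' b d) f d].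

Lemma sum_bound (P : pred V) (f : V -> nat) M :
  (forall v, f v <= M) -> \sum_(d | P d) f d <= n * M.
Proof.
move=> fM; apply: (@leq_trans (\sum_(d | P d) M)); first exact: leq_sum.
by rewrite sum_nat_const leq_mul2r -[X in _ <= X]card_ord max_card orbT.
Qed.

Lemma wp_update_sum rho mu o bit arr (w : nat -> expr) f ra rb H H' :
  ra \in registers -> rb \in registers -> arr \in [:: DEG; SUM; SQS] ->
  rho ra != rho rb -> env rho mu ->
  (forall v, f v <= n * n) ->
  (forall mu' r, env rho mu' -> r \in registers -> eval W mu' (w r) = f (rho r)) ->
  edge_change o bit H H' (rho ra) (rho rb) -> stores_sums f H (mu arr) ->
  wp W (update_sum_cmd o arr w ra rb) mu
    (fun nu => stores_sums f H' (nu arr) /\ frame [:: arr] mu nu).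
Proof.
move=> ar br arrE; set a := rho ra; set b := rho rb => ab rmu fM ew [_ eH ch] ms.
have [chA chB] := ch f.
have lt P : \sum_(d | P d) f d < W.
  apply: leq_ltn_trans (sum_bound P fM) _.
  by have [W1 W2 W3] := word_size; clear -n1 W1 W2 W3; lia.
have nreg : arr \notin registers by move: arrE; rewrite !inE => /or3P[]/eqP->.
apply: wp_seq; apply: (@wp_write _ _ _ _ a (\sum_(d | H' a d) f d)).
- by rewrite eval_var rmu.
- rewrite -chA; apply: eval_op; last by rewrite chA.
    by rewrite (eval_read _ (_ : eval W mu (Var ra) = a)) ?eval_var ?rmu // ms.
  exact: ew.
set mu1 := update _ _ _ _; have rmu1 : env rho mu1 by apply: env_update.
apply: (@wp_write _ _ _ _ b (\sum_(d | H' b d) f d)).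
- by rewrite eval_var rmu1.
- rewrite -chB; apply: eval_op; last by rewrite chB.
    rewrite (eval_read _ (_ : eval W mu1 (Var rb) = b)) ?eval_var ?rmu1 //.
    by rewrite /mu1 /update eqxx eq_sym (inj_eq val_inj) (negbTE ab) ms.
  exact: ew.
split; last by move=> r j; rewrite inE /mu1 /update => /negbTE->.
move=> c; rewrite /mu1 /update !eqxx /= !(inj_eq val_inj).
have [->//|cb] := eqVneq c b; have [->//|ca] := eqVneq c a.
by rewrite ms; apply: eq_bigl; apply: eH.
Qed.

Lemma wp_change_edge rho H H' ear port L mu0 mu o (bit : bool) ra rb :
  ra \in registers -> rb \in registers -> rho ra != rho rb ->
  edge_change o bit H H' (rho ra) (rho rb) ->
  state rho H ear port L mu0 mu ->
  wp W (change_edge_cmd o bit ra rb) mu (state rho H' ear port L mu0).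
Proof.
move=> ar br; set a := rho ra; set b := rho rb => ab ch.
move=> [[mn madj mdeg msum msqs mport mear mlinks] rmu fmu].
have ltb : bit < W by apply: const_small; case: bit {ch}.
apply: wp_seq; apply: (@wp_write _ _ _ _ (a * n + b) bit).
- exact: (eval_pair mn (rmu _ ar) (rmu _ br)).
- exact: eval_const.
set mu1 := update _ _ _ _; have rmu1 : env rho mu1 by apply: env_update.
apply: wp_seq; apply: (@wp_write _ _ _ _ (b * n + a) bit).
- exact: (eval_pair (mu := mu1) mn (rmu1 _ br) (rmu1 _ ar)).
- exact: eval_const.
set mu2 := update _ _ _ _; have rmu2 : env rho mu2 by apply: env_update.
have fmu2 : frame elim_arrays mu0 mu2 by do 2!apply: frame_update => //.
have madj2 : stores_pairs (fun a b => H' a b) (mu2 ADJ).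
  case: ch => [chH _ _] c d; rewrite chH /mu2 /update eqxx /= /mu1 /update eqxx /=.
  rewrite !pair_inj /same_edge.
  by case: ((c == a) && _); case: ((c == b) && _); rewrite //= madj.
have lev (v : V) : v < n := ltn_ord v.
apply: wp_seq; apply: wp_mono.
  apply: (@wp_update_sum rho mu2 o bit DEG _ (fun _ => 1) ra rb H H') => //.
    by move=> v /=; clear -n1; nia.
  by move=> mu' r _ _; rewrite eval_const //; apply: const_small.
move=> mu3 [mdeg3 f3]; have rmu3 : env rho mu3.
  by move=> r rr; rewrite f3 ?rmu2 //; move: rr; rewrite !inE => /or4P[/eqP->|/eqP->|/eqP->|/orP[]/eqP->].
apply: wp_seq; apply: wp_mono.
  apply: (@wp_update_sum rho mu3 o bit SUM _ val ra rb H H') => //.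
  - by move=> v /=; have := lev v; clear -n1; nia.
  - by move=> mu' r rmu' rr; rewrite eval_var rmu'.
  - by move=> c; rewrite f3 //; apply: msum.
move=> mu4 [msum4 f4]; have rmu4 : env rho mu4.
  by move=> r rr; rewrite f4 ?rmu3 //; move: rr; rewrite !inE => /or4P[/eqP->|/eqP->|/eqP->|/orP[]/eqP->].
apply: wp_mono.
  apply: (@wp_update_sum rho mu4 o bit SQS _ (fun b => b * b) ra rb H H') => //.
  - by move=> v /=; have := lev v; clear -n1; nia.
  - move=> mu' r rmu' rr; apply: eval_op; rewrite ?eval_var ?rmu' //=.
    have [W1 W2 W3] := word_size; have := lev (rho r).
    by clear -n1 W1 W2; nia.
  - by move=> c; rewrite f4 // f3 //; apply: msqs.
move=> mu5 [msqs5 f5]; have rmu5 : env rho mu5.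
  by move=> r rr; rewrite f5 ?rmu4 //; move: rr; rewrite !inE => /or4P[/eqP->|/eqP->|/eqP->|/orP[]/eqP->].
have f25 r j : r \notin [:: DEG; SUM; SQS] -> mu5 r j = mu2 r j.
  by rewrite !inE !negb_or => /and3P[r1 r2 r3]; rewrite f5 ?inE // f4 ?inE // f3 ?inE.
split=> //; last first.
  move=> r j rt; rewrite f25 ?fmu2 //.
  by apply: contra rt; rewrite !inE => /or3P[]/eqP->.
split=> //.
- by rewrite f25.
- by move=> c d; rewrite f25.
- by move=> c; rewrite f5 // f4.
- by move=> c; rewrite f5.
- by move=> c d; rewrite f25 //; apply: mport.
- by move=> c d; rewrite f25 //; apply: mear.
case: mlinks => l1 l2; split=> [c d|c d e]; rewrite f25 //; first exact: l1.
exact: l2.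
Qed.

Definition add_edge H a b : rel V := fun c d => H c d || same_edge a b c d.
Definition del_edge H a b : rel V := fun c d => H c d && ~~ same_edge a b c d.

Lemma sum_add_edge (f : V -> nat) H a b :
  ~~ H a b -> a != b ->
  \sum_(d | H a d) f d + f b = \sum_(d | add_edge H a b a d) f d.
Proof.
move=> nH ab; rewrite [RHS](bigD1 b) /=; last by rewrite /add_edge /same_edge !eqxx orbT.
rewrite addnC; congr (_ + _); apply: eq_bigl => d.
rewrite /add_edge /same_edge eqxx (negbTE ab) /= orbF.
by have [->|] := eqVneq d b; rewrite ?(negbTE nH) ?orbF ?andbT.
Qed.

Lemma add_edgeC H a b : add_edge H a b =2 add_edge H b a.
Proof. by move=> c d; rewrite /add_edge same_edge_sym. Qed.

Lemma change_add H a b :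
  symmetric H -> ~~ H a b -> a != b -> edge_change Add true H (add_edge H a b) a b.
Proof.
move=> Hs nH ab; split=> [c d|c ca cb d|f].
- by rewrite /add_edge; case: ifP => _; rewrite ?orbT ?orbF.
- by rewrite /add_edge /same_edge (negbTE ca) (negbTE cb) orbF.
split=> /=; first exact: sum_add_edge.
rewrite sum_add_edge 1?eq_sym // 1?Hs //.
by apply: eq_bigl => d; rewrite add_edgeC.
Qed.

Lemma change_del H a b :
  graph_rel H -> H a b -> edge_change Defs.Sub false H (del_edge H a b) a b.
Proof.
move=> [Hs Hi] Hab; have ab : a != b by apply: contraTneq Hab => ->; rewrite Hi.
have nH : ~~ del_edge H a b a b by rewrite /del_edge /same_edge !eqxx andbF.
have nH' : ~~ del_edge H a b b a by rewrite /del_edge /same_edge !eqxx orbT andbF.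
have E c d : add_edge (del_edge H a b) a b c d = H c d.
  rewrite /add_edge /del_edge; have [s|_] := boolP (same_edge a b c d).
    by move: s => /orP[]/andP[/eqP-> /eqP->]; rewrite ?Hab // Hs Hab.
  by rewrite andbT orbF.
split=> [c d|c ca cb d|f].
- by rewrite /del_edge; case: ifP => _; rewrite ?andbT ?andbF.
- by rewrite /del_edge /same_edge (negbTE ca) (negbTE cb) andbT.
split=> /=.
  rewrite -(eq_bigl _ _ (E a)) -sum_add_edge // addnK //.
rewrite -(eq_bigl _ _ (E b)) -(eq_bigl _ _ (add_edgeC _ _ _ _)).
by rewrite -sum_add_edge 1?eq_sym // addnK.
Qed.

Lemma eq_state rho H H' ear port L mu0 mu :
  H =2 H' -> state rho H ear port L mu0 mu -> state rho H' ear port L mu0 mu.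
Proof.
move=> E [[mn madj mdeg msum msqs mport mear mlinks] rmu fmu]; split=> //.
split=> // [a b|a|a|a]; rewrite -?E ?madj //.
- by rewrite mdeg; apply: eq_bigl => b; rewrite E.
- by rewrite msum; apply: eq_bigl => b; rewrite E.
- by rewrite msqs; apply: eq_bigl => b; rewrite E.
Qed.

End Ram.

(** * Eliminating a vertex in constant time *)

Definition ear_of r s := Read EAR (pair_at r s).
Definition edge_of r s := Read ADJ (pair_at r s).
Definition sum_of r := Read SUM (Var r).
Definition get_ear_cmd t r s := set_reg t (pred_of (ear_of r s)).
Definition copy_port_cmd rx ry ru := set_port_cmd rx ry (Read PORT (pair_at rx ru)).
Definition clear_ear_cmd rx ry := set_ear_cmd rx ry (Const 0).

Definition seqs cs := foldr Seq Skip cs.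

Definition decode_cmd := seqs
  [:: set_reg TMP (Read ROOT (Binop Defs.Sub
        (Binop Mul (Const 2) (Read SQS (Var RU)))
        (Binop Mul (sum_of RU) (sum_of RU))));
      set_reg RX (Binop Div (Binop Add (sum_of RU) (Var TMP)) (Const 2));
      set_reg RY (Binop Div (Binop Defs.Sub (sum_of RU) (Var TMP)) (Const 2))].

(** If only one of the edges at [u] carries an ear, it becomes [ux]. *)
Definition swap_cmd :=
  If (ear_of RU RX) Skip
    (seqs [:: set_reg TMP (Var RX); set_reg RX (Var RY); set_reg RY (Var TMP)]).

Definition pair_cmd :=
  If (ear_of RU RY)
    (seqs [:: get_ear_cmd RV RU RX; get_ear_cmd RW RU RY;
              link_cmd RU RW RY; link_cmd RV RU RW; link_cmd RX RV RU;
              clear_ear_cmd RU RX; clear_ear_cmd RU RY])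
    Skip.

Definition case_cmd :=
  If (ear_of RU RX)
    (Seq (get_ear_cmd RV RU RX)
      (If (edge_of RX RY)
        (seqs [:: link_cmd RV RX RY; link_cmd RU RV RX; link_cmd RX RU RY;
                  copy_port_cmd RX RY RU])
        (seqs [:: link_cmd RX RV RU; link_cmd RX RU RY;
                  copy_port_cmd RX RY RU; copy_port_cmd RY RX RU;
                  clear_ear_cmd RX RY])))
    (If (edge_of RX RY)
      (If (ear_of RX RY)
        (seqs [:: get_ear_cmd RW RX RY;
                  link_cmd RW RX RY; link_cmd RU RY RW; link_cmd RX RU RY;
                  copy_port_cmd RX RY RU; clear_ear_cmd RX RY])
        (set_ear_cmd RX RY (succ (Var RU))))
      (seqs [:: link_cmd RX RU RY;
                copy_port_cmd RX RY RU; copy_port_cmd RY RX RU;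
                clear_ear_cmd RX RY])).

Definition update_cmd := seqs
  [:: change_edge_cmd Defs.Sub false RU RX; change_edge_cmd Defs.Sub false RU RY;
      If (edge_of RX RY) Skip (change_edge_cmd Add true RX RY)].

Definition eliminate_cmd := seqs [:: decode_cmd; swap_cmd; pair_cmd; case_cmd; update_cmd].

Section Eliminate.
Variable n : nat.
Hypothesis n1 : 1 < n.

Local Notation W := (n ^ 8).
Local Notation V := 'I_n.
Implicit Types (H : rel V) (ear : V -> V -> option V) (port : V -> V -> V).
Implicit Types (L : seq (V * V * V)) (rho : nat -> V) (mu nu : memory).

Lemma wp_seqs c cs mu (Q : memory -> Prop) :
  wp W c mu (fun nu => wp W (seqs cs) nu Q) -> wp W (seqs (c :: cs)) mu Q.
Proof. exact: wp_seq. Qed.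

Lemma wp_done mu (Q : memory -> Prop) : Q mu -> wp W (seqs [::]) mu Q.
Proof. exact: wp_skip. Qed.

Lemma eval_clear rho mu : env rho mu -> eval W mu (Const 0) = code_opt (None : option V).
Proof. by move=> _; rewrite eval_const // const_small. Qed.

Lemma sum_nbrs2 H u x y (f : V -> nat) :
  nbrs2 H u x y -> \sum_(b | H u b) f b = f x + f y.
Proof.
case=> xy Hu; rewrite (bigD1 x) /=; last by rewrite Hu eqxx.
congr (_ + _); rewrite (big_pred1 y) // => z /=.
by rewrite Hu; have [->|] := eqVneq z x; rewrite ?(negbTE xy) ?andbT ?andbF.
Qed.

Lemma state_tmp rho H ear port L mu0 mu v :
  state rho H ear port L mu0 mu -> state rho H ear port L mu0 (update mu TMP 0 v).
Proof.
case=> [[? ? ? ? ? ? ? ?] rmu fmu].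
by split; [split | exact: env_update | exact: frame_update].
Qed.

Definition roots mu := forall d, d < n -> mu ROOT (d * d) = d.

Definition same_uxy rho rho' :=
  [/\ rho' RU = rho RU, rho' RX = rho RX & rho' RY = rho RY].

(** The sum [s] and the sum of squares [q] of two numbers determine them: their
    difference is the root of [2 * q - s ^ 2]. *)
Lemma wp_decode rho H ear port L mu0 mu (x y : V) :
  state rho H ear port L mu0 mu -> roots mu0 -> nbrs2 H (rho RU) x y -> y < x ->
  wp W decode_cmd mu (state (setrho (setrho rho RX x) RY y) H ear port L mu0).
Proof.
move=> st ro nu yx; have [W1 W2 W3] := word_size n1.
have lx := ltn_ord x; have xx : x * x <= n * n by rewrite leq_mul // ltnW.
have yy : y * y <= x * x by rewrite leq_mul // ltnW.
have yx2 : y * x <= x * x by rewrite leq_mul // ltnW.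
have esum rho' mu' : state rho' H ear port L mu0 mu' -> rho' RU = rho RU ->
    eval W mu' (sum_of RU) = x + y.
  case=> [[_ _ _ msum _ _ _ _] rmu _] E.
  rewrite /sum_of (eval_read _ (_ : eval W mu' (Var RU) = rho RU)) ?eval_var ?rmu ?E //.
  by rewrite msum (sum_nbrs2 _ nu).
have esqs : eval W mu (Read SQS (Var RU)) = x * x + y * y.
  case: st => [[_ _ _ _ msqs _ _ _] rmu _].
  rewrite (eval_read _ (_ : eval W mu (Var RU) = rho RU)) ?eval_var ?rmu //.
  by rewrite msqs (sum_nbrs2 _ nu).
have e2 mu' : eval W mu' (Const 2) = 2 by rewrite eval_const // const_small.
apply: wp_seqs; apply: (@wp_write _ _ _ _ 0 (x - y)).
- by rewrite eval_const // const_small.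
- rewrite (@eval_read _ _ _ _ ((x - y) * (x - y))).
    have [_ _ fmu] := st; rewrite fmu // ro //.
    by apply: leq_ltn_trans lx; apply: leq_subr.
  have -> : (x - y) * (x - y) =
      eval_binop Defs.Sub (2 * (x * x + y * y)) ((x + y) * (x + y)).
    have [d ->] : exists d, x = y + d :> nat.
      by exists (x - y); rewrite subnKC // ltnW.
    by rewrite addKn /=; clear; nia.
  apply: eval_op.
  - apply: (@eval_op _ _ Mul _ _ 2 (x * x + y * y)); rewrite ?e2 ?esqs //=.
    by clear -W1 W2 W3 xx yy n1; lia.
  - apply: (@eval_op _ _ Mul _ _ (x + y) (x + y)); rewrite ?(esum _ _ st) //=.
    by clear -W1 W2 W3 xx yy yx2 n1; lia.
  - rewrite /=; apply: (@leq_ltn_trans (2 * (x * x + y * y))); first exact: leq_subr.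
    by clear -W1 W2 W3 xx yy n1; lia.
set mu1 := update _ _ _ _.
have st1 : state rho H ear port L mu0 mu1 by apply: state_tmp.
have eT : eval W mu1 (Var TMP) = x - y by rewrite eval_var.
have c0 mu' : eval W mu' (Const 0) = 0 by rewrite eval_const // const_small.
apply: wp_seqs; apply: (@wp_write _ _ _ _ 0 x) => //.
  have -> : x = eval_binop Div (x + y + (x - y)) 2 :> nat.
    by rewrite /=; clear -yx; lia.
  apply: eval_op; rewrite ?e2 //; last by rewrite /=; clear -yx lx W1 W2 W3; lia.
  apply: (@eval_op _ _ Add _ _ (x + y) (x - y)); rewrite ?(esum _ _ st1) //=.
  by clear -yx lx W1 W2 W3; lia.
set mu2 := update _ _ _ _.
have st2 : state (setrho rho RX x) H ear port L mu0 mu2 by apply: state_set_reg.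
have eT2 : eval W mu2 (Var TMP) = x - y by rewrite eval_var.
apply: wp_seqs; apply: (@wp_write _ _ _ _ 0 y) => //.
  have -> : y = eval_binop Div (x + y - (x - y)) 2 :> nat.
    by rewrite /=; clear -yx; lia.
  apply: eval_op; rewrite ?e2 //; last by rewrite /=; clear -yx lx W1 W2 W3; lia.
  apply: (@eval_op _ _ Defs.Sub _ _ (x + y) (x - y)); rewrite ?(esum _ _ st2) //=.
  by clear -yx lx W1 W2 W3; lia.
by apply: wp_done; apply: state_set_reg.
Qed.

Lemma wp_swap rho H ear port L mu0 mu :
  state rho H ear port L mu0 mu -> nbrs2 H (rho RU) (rho RX) (rho RY) ->
  wp W swap_cmd mu (fun nu => exists rho',
    [/\ rho' RU = rho RU, nbrs2 H (rho' RU) (rho' RX) (rho' RY),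
        ear (rho' RU) (rho' RX) = None -> ear (rho' RU) (rho' RY) = None
      & state rho' H ear port L mu0 nu]).
Proof.
move=> st nu; apply: (@wp_if _ (ear (rho RU) (rho RX) != None)).
- by rewrite (eval_ear n1 _ _ st) //; case: (ear _ _).
- by case E: (ear _ _) => [v|] // _; apply: wp_skip; exists rho; rewrite E.
rewrite negbK => /eqP eux.
have c0 mu' : eval W mu' (Const 0) = 0 by rewrite eval_const // const_small.
have rmu := state_env st.
apply: wp_seqs; apply: (@wp_write _ _ _ _ 0 (rho RX)); rewrite ?eval_var ?rmu //.
set mu1 := update _ _ _ _.
have st1 : state rho H ear port L mu0 mu1 by apply: state_tmp.
apply: wp_seqs; apply: (@wp_write _ _ _ _ 0 (rho RY)) => //.
  by rewrite eval_var (state_env st1).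
set mu2 := update _ _ _ _.
have st2 : state (setrho rho RX (rho RY)) H ear port L mu0 mu2 by apply: state_set_reg.
apply: wp_seqs; apply: (@wp_write _ _ _ _ 0 (rho RX)); rewrite ?eval_var //.
apply: wp_done; exists (setrho (setrho rho RX (rho RY)) RY (rho RX)).
split; [by [] | exact: nbrs2C | by [] | exact: state_set_reg].
Qed.

Let ru : RU \in registers := isT.
Let rx : RX \in registers := isT.
Let ry : RY \in registers := isT.
Let rv : RV \in registers := isT.
Let rw : RW \in registers := isT.

Lemma wp_pair E0 rho H ear port L F k mu0 mu :
  state rho H ear port L mu0 mu -> invariant E0 H ear port L F k ->
  nbrs2 H (rho RU) (rho RX) (rho RY) ->
  (ear (rho RU) (rho RX) = None -> ear (rho RU) (rho RY) = None) ->
  wp W pair_cmd mu (fun nu => exists rho' ear' L' F' k',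
    [/\ same_uxy rho rho', ear' (rho RU) (rho RY) = None,
        invariant E0 H ear' port L' F' k' & state rho' H ear' port L' mu0 nu]).
Proof.
move=> st I nu exy; apply: (@wp_if _ (ear (rho RU) (rho RY) != None)).
- by rewrite (eval_ear n1 ru ry st); case: (ear _ _).
- case ey: (ear (rho RU) (rho RY)) exy => [w|] //.
  case ex: (ear (rho RU) (rho RX)) => [v|] => [_ _|/(_ erefl)//].
  have [F' I'] := inv_pair I nu ex ey.
  apply: wp_seqs; apply: (wp_mono (wp_get_ear n1 rv ru rx ex st)) => mu1 st1.
  apply: wp_seqs; apply: (wp_mono (wp_get_ear n1 rw ru ry ey st1)) => mu2 st2.
  apply: wp_seqs; apply: (wp_mono (wp_link n1 ru rw ry st2)) => mu3 st3.
  apply: wp_seqs; apply: (wp_mono (wp_link n1 rv ru rw st3)) => mu4 st4.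
  apply: wp_seqs; apply: (wp_mono (wp_link n1 rx rv ru st4)) => mu5 st5.
  apply: wp_seqs; apply: (wp_mono (wp_set_ear n1 ru rx (@eval_clear _) st5)) => mu6 st6.
  apply: wp_seqs; apply: (wp_mono (wp_set_ear n1 ru ry (@eval_clear _) st6)) => mu7 st7.
  apply: wp_done; do 5!eexists; split; [| | exact: I' | exact: st7] => //.
  by rewrite /setear /same_edge !eqxx.
move=> /negbNE/eqP ey; apply: wp_skip; exists rho, ear, L, F, k; split=> //.
Qed.

Lemma wp_case E0 rho H ear port L F k mu0 mu :
  state rho H ear port L mu0 mu -> invariant E0 H ear port L F k ->
  nbrs2 H (rho RU) (rho RX) (rho RY) -> ear (rho RU) (rho RY) = None ->
  wp W case_cmd mu (fun nu => exists rho' ear' port' L' F' k',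
    [/\ same_uxy rho rho',
        invariant E0 (elim H (rho RU) (rho RX) (rho RY)) ear' port' L' F' k'
      & state rho' H ear' port' L' mu0 nu]).
Proof.
move=> st I nu ey; have [xy _] := nu.
have e_ear r s rho' ear' L' mu' : r \in registers -> s \in registers ->
    state rho' H ear' port L' mu0 mu' ->
    (eval W mu' (ear_of r s) != 0) = (ear' (rho' r) (rho' s) != None).
  by move=> rr sr st'; rewrite (eval_ear n1 rr sr st'); case: (ear' _ _).
have e_edge rho' ear' L' mu' : state rho' H ear' port L' mu0 mu' ->
    (eval W mu' (edge_of RX RY) != 0) = H (rho' RX) (rho' RY).
  by move=> st'; rewrite (eval_adj n1 rx ry st'); case: (H _ _).
have pE : setport port (rho RX) (rho RY) (port (rho RX) (rho RU)) (rho RY) (rho RU)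
    = port (rho RY) (rho RU).
  by rewrite setport_neq // negb_and eq_sym xy.
apply: (wp_if (e_ear RU RX _ _ _ _ ru rx st)).
  case ex: (ear (rho RU) (rho RX)) => [v|] // _.
  apply: wp_seq; apply: (wp_mono (wp_get_ear n1 rv ru rx ex st)) => mu1 st1.
  apply: (wp_if (e_edge _ _ _ _ st1)) => Hxy.
    have [F' I'] := inv_ear_present I nu ex ey Hxy.
    apply: wp_seqs; apply: (wp_mono (wp_link n1 rv rx ry st1)) => mu2 st2.
    apply: wp_seqs; apply: (wp_mono (wp_link n1 ru rv rx st2)) => mu3 st3.
    apply: wp_seqs; apply: (wp_mono (wp_link n1 rx ru ry st3)) => mu4 st4.
    apply: wp_seqs; apply: (wp_mono (wp_copy_port n1 rx ry ru st4)) => mu5 st5.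
    by apply: wp_done; do 6!eexists; split; [| exact: I' | exact: st5].
  have [F' I'] := inv_ear_absent I nu ex ey Hxy.
  apply: wp_seqs; apply: (wp_mono (wp_link n1 rx rv ru st1)) => mu2 st2.
  apply: wp_seqs; apply: (wp_mono (wp_link n1 rx ru ry st2)) => mu3 st3.
  apply: wp_seqs; apply: (wp_mono (wp_copy_port n1 rx ry ru st3)) => mu4 st4.
  apply: wp_seqs; apply: (wp_mono (wp_copy_port n1 ry rx ru st4)) => mu5 st5.
  apply: wp_seqs; apply: (wp_mono (wp_set_ear n1 rx ry (@eval_clear _) st5)) => mu6 st6.
  rewrite /= pE in st6.
  by apply: wp_done; do 6!eexists; split; [| exact: I' | exact: st6].
move=> /negbNE/eqP ex; apply: (wp_if (e_edge _ _ _ _ st)) => Hxy; last first.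
  have [F' I'] := inv_subdivide I nu ex ey Hxy.
  apply: wp_seqs; apply: (wp_mono (wp_link n1 rx ru ry st)) => mu3 st3.
  apply: wp_seqs; apply: (wp_mono (wp_copy_port n1 rx ry ru st3)) => mu4 st4.
  apply: wp_seqs; apply: (wp_mono (wp_copy_port n1 ry rx ru st4)) => mu5 st5.
  apply: wp_seqs; apply: (wp_mono (wp_set_ear n1 rx ry (@eval_clear _) st5)) => mu6 st6.
  rewrite /= pE in st6.
  by apply: wp_done; do 6!eexists; split; [| exact: I' | exact: st6].
apply: (wp_if (e_ear RX RY _ _ _ _ rx ry st)).
  case exy: (ear (rho RX) (rho RY)) => [w|] // _.
  have [F' I'] := inv_combine I nu ex ey Hxy exy.
  apply: wp_seqs; apply: (wp_mono (wp_get_ear n1 rw rx ry exy st)) => mu1 st1.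
  apply: wp_seqs; apply: (wp_mono (wp_link n1 rw rx ry st1)) => mu2 st2.
  apply: wp_seqs; apply: (wp_mono (wp_link n1 ru ry rw st2)) => mu3 st3.
  apply: wp_seqs; apply: (wp_mono (wp_link n1 rx ru ry st3)) => mu4 st4.
  apply: wp_seqs; apply: (wp_mono (wp_copy_port n1 rx ry ru st4)) => mu5 st5.
  apply: wp_seqs; apply: (wp_mono (wp_set_ear n1 rx ry (@eval_clear _) st5)) => mu6 st6.
  by apply: wp_done; do 6!eexists; split; [| exact: I' | exact: st6].
move=> /negbNE/eqP exy; have [F' I'] := inv_new_ear I nu ex ey Hxy exy.
have eU mu' : env rho mu' -> eval W mu' (succ (Var RU)) = code_opt (Some (rho RU)).
  by move=> rmu'; rewrite (eval_succ_reg n1 (rmu' _ ru)).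
apply: (wp_mono (wp_set_ear n1 rx ry eU st)) => mu1 st1.
by do 6!eexists; split; [| exact: I' | exact: st1].
Qed.

Lemma wp_update rho H ear port L mu0 mu :
  graph_rel H -> state rho H ear port L mu0 mu ->
  nbrs2 H (rho RU) (rho RX) (rho RY) ->
  wp W update_cmd mu
    (state rho (elim H (rho RU) (rho RX) (rho RY)) ear port L mu0).
Proof.
set u := rho RU; set x := rho RX; set y := rho RY.
move=> gH st nu; have [ux uy] := nbrs2_neq gH nu; have [xy Hu] := nu.
have [Hux Huy] : H u x /\ H u y by rewrite !Hu !eqxx orbT.
have ch1 := change_del gH Hux; set H1 := del_edge H u x in ch1.
have gH1 : graph_rel H1.
  split=> [a b|a]; first by rewrite /H1 /del_edge gH.1 same_edgeC.
  by rewrite /H1 /del_edge gH.2.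
have Huy1 : H1 u y by rewrite /H1 /del_edge Huy /same_edge !(neqF ux, neqF uy, neqF xy) andbF.
have ch2 := change_del gH1 Huy1; set H2 := del_edge H1 u y in ch2.
have H2E a b : H2 a b = [&& a != u, b != u & H a b].
  rewrite /H2 /H1 /del_edge /same_edge; have Ha := Hu a; have Hb := Hu b.
  have [E|au] := eqVneq a u.
    by subst a; rewrite Hb; move: ux uy xy; clear; dec_eq.
  have [E|bu] := eqVneq b u.
    by subst b; rewrite gH.1 Ha; move: ux uy xy au; clear; dec_eq.
  by rewrite !andbF !andbT.
apply: wp_seqs; apply: (wp_mono (wp_change_edge n1 ru rx ux ch1 st)) => mu1 st1.
apply: wp_seqs; apply: (wp_mono (wp_change_edge n1 ru ry uy ch2 st1)) => mu2 st2.
apply: wp_seqs; apply: (@wp_if _ (H2 x y)).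
- by rewrite (eval_adj n1 rx ry st2) -/x -/y; case: (H2 x y).
- move=> Hxy; apply: wp_skip; apply: wp_done; apply: eq_state st2 => a b.
  rewrite H2E /elim; have [s|_] := boolP (same_edge x y a b); last by rewrite orbF.
  move: Hxy; rewrite H2E => /and3P[_ _ Hxy].
  by move: s => /orP[]/andP[/eqP-> /eqP->]; rewrite ?Hxy // gH.1 Hxy.
move=> Hxy; have ch3 : edge_change Add true H2 (add_edge H2 x y) x y.
  apply: change_add => // a b; rewrite !H2E gH.1.
  by rewrite andbCA.
apply: (wp_mono (wp_change_edge n1 rx ry xy ch3 st2)) => mu3 st3.
apply: wp_done; apply: eq_state st3 => a b.
rewrite /add_edge H2E /elim; have [s|_] := boolP (same_edge x y a b); last by rewrite !orbF.
rewrite !orbT; move: s => /orP[]/andP[/eqP-> /eqP->]; by rewrite !(eq_sym _ u) ux uy.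
Qed.

Lemma wp_eliminate E0 rho H ear port L F k mu0 mu x y :
  state rho H ear port L mu0 mu -> roots mu0 -> invariant E0 H ear port L F k ->
  nbrs2 H (rho RU) x y ->
  wp W eliminate_cmd mu (fun nu => exists rho' ear' port' L' F' k',
    [/\ nbrs2 H (rho RU) (rho' RX) (rho' RY),
        invariant E0 (elim H (rho RU) (rho' RX) (rho' RY)) ear' port' L' F' k'
      & state rho' (elim H (rho RU) (rho' RX) (rho' RY)) ear' port' L' mu0 nu]).
Proof.
move=> st ro I; wlog yx : x y / y < x.
  move=> wl nu; have [yx|xy|E] := ltngtP y x; first exact: (wl x y).
    by apply: (wl y x) => //; apply: nbrs2C.
  by case: nu => /eqP[]; apply: val_inj.
move=> nu.
apply: wp_seqs; apply: (wp_mono (wp_decode st ro nu yx)) => mu1 st1.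
apply: wp_seqs; apply: (wp_mono (wp_swap st1 nu)) => mu2 [rho2 [u2 nu2 exy2 st2]].
apply: wp_seqs; apply: (wp_mono (wp_pair st2 I nu2 exy2)).
move=> mu3 [rho3 [ear3 [L3 [F3 [k3 [[u3 x3 y3] ey3 I3 st3]]]]]].
rewrite -u3 -x3 -y3 in nu2; rewrite -u3 -y3 in ey3.
apply: wp_seqs; apply: (wp_mono (wp_case st3 I3 nu2 ey3)).
move=> mu4 [rho4 [ear4 [port4 [L4 [F4 [k4 [[u4 x4 y4] I4 st4]]]]]]].
rewrite -u4 -x4 -y4 in nu2 I4.
have gH : graph_rel H by case: I.
apply: wp_seqs; apply: (wp_mono (wp_update gH st4 nu2)) => mu5 st5.
have E : rho4 RU = rho RU by rewrite u4 u3 u2.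
apply: wp_done; exists rho4, ear4, port4, L4, F4, k4.
by rewrite -E; split.
Qed.

End Eliminate.

(** * Computing the links of a cover *)

Definition incr r := set_reg r (succ (Var r)).
Definition push_cmd r := Seq (Write QUE (Var TAIL) (Var r)) (incr TAIL).

Definition init_body := seqs
  [:: Write ROOT (square_of TAIL) (Var TAIL); Write QUE (Var TAIL) (Var TAIL);
      incr TAIL].
Definition init_test := Binop Lt (Var TAIL) size_n.

Definition load_body := seqs
  [:: set_reg RX (Read 1 (Var POS)); set_reg RY (Read 2 (Var POS));
      set_port_cmd RX RY (Var RY); set_port_cmd RY RX (Var RX);
      change_edge_cmd Add true RX RY; incr POS].
Definition load_test := Binop Lt (Var POS) (Read 0 (Const 1)).

Definition degree_of r := Read DEG (Var r).

(** Queue entries may be outdated, hence the test of the degree. *)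
Definition main_body := seqs
  [:: set_reg RU (Read QUE (Var HEAD)); incr HEAD;
      If (Binop Lt (Const 1) (degree_of RU))
        (If (Binop Lt (degree_of RU) (Const 3))
          (seqs [:: eliminate_cmd; push_cmd RX; push_cmd RY]) Skip) Skip].
Definition main_test := Binop Lt (Var HEAD) (Var TAIL).

Definition final_cmd :=
  If (ear_of RX RY) (seqs [:: get_ear_cmd RV RX RY; link_cmd RX RV RY]) Skip.

Definition cover_cmd := seqs
  [:: While init_test init_body; While load_test load_body;
      While main_test main_body; final_cmd].

Section WhileCount.
Variable W : nat.

Lemma exec_while_count e c N (I : nat -> memory -> Prop) mu :
  loop_free c ->
  (forall j nu, j < N -> I j nu -> eval W nu e != 0 /\ wp W c nu (I j.+1)) ->
  (forall nu, I N nu -> eval W nu e = 0) -> I 0 mu ->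
  exists t nu, [/\ exec W (While e c) mu t nu,
    t <= N.+1 * (cost e + max_time c).+1 & I N nu].
Proof.
move=> lf step fin I0; set C := (cost e + max_time c).+1.
pose J phi nu := exists j, [/\ j <= N, I j nu & phi = (N - j) * C].
have J0 : J (N * C) mu by exists 0; rewrite subn0.
case: (@exec_while W e c J _ _ _ J0) => [phi nu [j [jN Ij ->]] ev|].
  have {}jN : j < N.
    by rewrite ltn_neqAle jN andbT; apply: contraNneq ev => E; rewrite fin // -E.
  have [_ w] := step _ _ jN Ij.
  have [t [xi [ex lt Ij']]] := exec_loop_free lf w.
  exists t, xi, ((N - j.+1) * C); split=> //; first by exists j.+1.
  have -> : N - j = (N - j.+1).+1 by rewrite subnSK.
  by rewrite mulSn {2}/C; clear -lt; lia.
move=> t [nu [psi [ex [j [jN Ij E]] ev le]]]; exists t, nu.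
have {}E : j = N.
  apply/eqP; rewrite eqn_leq jN /= leqNgt; apply/negP=> jN'.
  by have [] := step _ _ jN' Ij; rewrite ev.
split=> //; last by rewrite -E.
by apply: leq_trans (_ : N * C + (cost e).+1 <= _);
  rewrite ?mulSn /C; clear -le; lia.
Qed.

End WhileCount.

Section Phases.
Variable n : nat.
Hypothesis n1 : 1 < n.

Local Notation W := (n ^ 8).
Local Notation V := 'I_n.
Implicit Types (H : rel V) (ear : V -> V -> option V) (port : V -> V -> V).
Implicit Types (L : seq (V * V * V)) (rho : nat -> V) (mu nu : memory).

Variable es : seq (V * V).
Hypothesis sp_es : series_parallel es.
Hypothesis simple_es : simple_graph es.

Local Notation E0 := (map (@uedge V) es).
Local Notation input := (graph_input es).

Let ru : RU \in registers := isT.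
Let rx : RX \in registers := isT.
Let ry : RY \in registers := isT.
Let rv : RV \in registers := isT.

Lemma size_edges : size es + 6 <= 4 * n.
Proof.
have [gH rH] := series_parallel_reducible sp_es.
have le3 := card_arcs_reducible gH rH.
suff le : size es <= #|[set p : V * V | edge_rel es p.1 p.2]|.
  have := max_card (alive (edge_rel es)); rewrite card_ord => le2.
  apply: leq_trans (leq_trans (leq_add le (leqnn 6)) le3) _.
  by rewrite leq_mul2l le2 orbT.
have ues : uniq es by apply: map_uniq simple_es.
rewrite -(card_uniqP ues); apply/subset_leq_card/subsetP => [[a b] ab].
by rewrite inE; apply/mapP; exists (a, b).
Qed.

Lemma eval_zero mu : eval W mu (Const 0) = 0.
Proof. by rewrite eval_const // const_small. Qed.

Lemma small_word x : x <= 8 * (n * n) -> x < W.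
Proof. by have [W1 W2 W3] := word_size n1; clear -n1 W1 W2 W3; lia. Qed.

Lemma eval_lt mu e1 e2 x y :
  eval W mu e1 = x -> eval W mu e2 = y ->
  (eval W mu (Binop Lt e1 e2) != 0) = (x < y).
Proof.
move=> ev1 ev2; rewrite (eval_op ev1 ev2) /=; first by case: (x < y).
by apply: const_small; case: (x < y).
Qed.

Lemma wp_incr r x mu (Q : memory -> Prop) :
  mu r 0 = x -> x <= 2 * (n * n) -> Q (update mu r 0 x.+1) -> wp W (incr r) mu Q.
Proof.
move=> mx le q; apply: (@wp_write _ _ _ _ 0 x.+1) => //; first exact: eval_zero.
by apply: eval_succ; rewrite ?eval_var.
Qed.

Definition init_inv t mu :=
  [/\ mu TAIL 0 = t, forall d, d < t -> mu ROOT (d * d) = d,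
      forall d, d < t -> mu QUE d = d & frame [:: ROOT; QUE; TAIL] input mu].

Lemma exec_init : exists t nu,
  [/\ exec W (While init_test init_body) input t nu,
      t <= n.+1 * (cost init_test + max_time init_body).+1 & init_inv n nu].
Proof.
apply: (@exec_while_count W _ _ n init_inv) => //.
  move=> t mu tn [mT mR mQ fr].
  have test : (eval W mu init_test != 0) = (t < n).
    by apply: eval_lt; rewrite eval_var // fr.
  rewrite test tn; split=> //.
  have tt : t * t <= n * n by rewrite leq_mul // ltnW.
  apply: wp_seqs; apply: (@wp_write _ _ _ _ (t * t) t); rewrite ?eval_var //.
    apply: (@eval_op _ _ Mul _ _ t t); rewrite ?eval_var //.
    by apply: small_word; rewrite /=; clear -tt; lia.
  apply: wp_seqs; apply: (@wp_write _ _ _ _ t t); rewrite ?eval_var //.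
  apply: wp_seqs; apply: (wp_incr (x := t)) => //; first by clear -tn; nia.
  apply: wp_done; split=> //.
  - move=> d; rewrite ltnS leq_eqVlt => /orP[/eqP->|dt]; first by rewrite /update /= eqxx.
    by rewrite /update /= ltn_eqF ?ltn_mul // mR.
  - move=> d; rewrite ltnS leq_eqVlt => /orP[/eqP->|dt]; first by rewrite /update /= eqxx.
    by rewrite /update /= ltn_eqF // mQ.
  - by do 3!apply: frame_update => //.
move=> mu [mT _ _ fr]; apply/eqP; rewrite -[_ == 0]negbK.
by rewrite (@eval_lt _ _ _ n n) ?ltnn // eval_var // fr.
Qed.

(** Scalars and arrays of the loops around an elimination. *)
Definition loop_arrays := [:: ROOT; QUE; HEAD; TAIL; POS].

Lemma state_self rho H ear port L mu0 mu :
  state rho H ear port L mu0 mu -> state rho H ear port L mu mu.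
Proof. by case=> re rmu _; split. Qed.

Lemma state_other rho H ear port L mu a i v :
  a \in loop_arrays -> state rho H ear port L mu mu ->
  state rho H ear port L (update mu a i v) (update mu a i v).
Proof.
move=> ao [[mn madj mdeg msum msqs mport mear mlinks] rmu _].
split=> //; last first.
  by apply: env_update rmu; move: ao; rewrite !inE => /or4P[/eqP->|/eqP->|/eqP->|/orP[]/eqP->].
by move: ao; rewrite !inE => /or4P[/eqP->|/eqP->|/eqP->|/orP[]/eqP->]; split.
Qed.

Definition outputs_clear mu := frame (elim_arrays ++ loop_arrays) input mu.

Lemma outputs_clear_trans rs mu nu :
  outputs_clear mu -> frame rs mu nu -> all (fun r => r \in elim_arrays ++ loop_arrays) rs -> outputs_clear nu.
Proof.
move=> un fr sub r j rt; rewrite fr ?un //.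
by apply: contra rt => /(allP sub).
Qed.

Lemma outputs_clear_update mu a i v :
  a \in elim_arrays ++ loop_arrays -> outputs_clear mu -> outputs_clear (update mu a i v).
Proof. exact: frame_update. Qed.

Definition load_inv j mu := exists rho port,
  [/\ state rho (edge_rel (take j es)) (fun _ _ => None) port [::] mu mu,
      forall a b, edge_rel (take j es) a b -> port a b = b,
      mu POS 0 = j,
      [/\ mu TAIL 0 = n, mu HEAD 0 = 0, forall d, d < n -> mu QUE d = d & roots n mu]
    & outputs_clear mu].

Lemma load_init mu : init_inv n mu -> load_inv 0 mu.
Proof.
case=> mT mR mQ fr; have n0 := ltnW n1.
exists (fun _ => Ordinal n0), (fun _ _ => Ordinal n0).
split=> //; last 2 first.
- by split=> //; rewrite fr.
- move=> r j rt; apply: fr; apply: contra rt.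
  by rewrite !inE => /or3P[]/eqP->.
- rewrite take0; split=> [||r j _ //]; last first.
    by move=> r; rewrite !inE => /or4P[/eqP->|/eqP->|/eqP->|/orP[]/eqP->]; rewrite fr.
  split.
  - by rewrite fr.
  - by move=> a b; rewrite fr.
  - by move=> a; rewrite fr // big_pred0.
  - by move=> a; rewrite fr // big_pred0.
  - by move=> a; rewrite fr // big_pred0.
  - by move=> a b; rewrite fr.
  - by move=> a b; rewrite fr.
  - by split=> [a b|a b c //]; left; rewrite fr.
- by move=> a b; rewrite take0.
- by rewrite fr.
Qed.

Lemma edge_rel_take j (a b : V) : j < size es -> nth (a, b) es j = (a, b) ->
  edge_rel (take j.+1 es) =2 add_edge (edge_rel (take j es)) a b.
Proof.
move=> jm E c d; rewrite (take_nth (a, b) jm) E -cats1 edge_rel_cat /add_edge.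
by congr (_ || _); rewrite /edge_rel /= inE eq_set2.
Qed.

Lemma exec_load mu : load_inv 0 mu -> exists t nu,
  [/\ exec W (While load_test load_body) mu t nu,
      t <= (size es).+1 * (cost load_test + max_time load_body).+1
    & load_inv (size es) nu].
Proof.
have sE := size_edges.
apply: (@exec_while_count W _ _ (size es) load_inv) => // {mu}; last first.
  move=> mu [rho [port [_ _ mP _ un]]]; apply/eqP; rewrite -[_ == 0]negbK.
  rewrite (@eval_lt _ _ _ (size es) (size es)) ?ltnn ?eval_var //.
  by rewrite (@eval_read _ _ _ _ 1) ?eval_const ?const_small // un.
move=> j mu jm [rho [port [st pE mP [mT mH mQ mR] un]]].
have -> : (eval W mu load_test != 0) = (j < size es).
  apply: eval_lt; rewrite ?eval_var //.
  by rewrite (@eval_read _ _ _ _ 1) ?eval_const ?const_small // un.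
split=> //.
have [a [b Eab]] : exists a b, nth (a, b) es j = (a, b).
  pose o : V := Ordinal (ltnW n1); pose e := nth (o, o) es j.
  by exists e.1, e.2; rewrite (set_nth_default (o, o)) // -surjective_pairing.
have [gH rH] := series_parallel_reducible sp_es.
have Hab : edge_rel es a b.
  by apply/mapP; exists (a, b) => //; rewrite -Eab mem_nth.
have ab : a != b by apply: contraTneq Hab => ->; rewrite gH.2.
have nab : ~~ edge_rel (take j es) a b.
  have := simple_es; rewrite /simple_graph -{1}(cat_take_drop j es) map_cat cat_uniq.
  rewrite (drop_nth (a, b) jm) Eab /= => /and3P[_ + _].
  by rewrite negb_or => /andP[+ _]; apply: contra.
have eE := edge_rel_take jm Eab.
set H := edge_rel (take j es) in st pE nab eE.
apply: wp_seqs; apply: (wp_mono (wp_set_reg (v := a) n1 rx _ st)).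
  rewrite (@eval_read _ _ _ _ j) ?eval_var // un //=.
  by rewrite (nth_map (a, b)) // Eab.
move=> mu1 st1; have un1 := outputs_clear_trans un (state_frame st1) isT.
have P1 : mu1 POS 0 = j by rewrite (state_frame st1).
apply: wp_seqs; apply: (wp_mono (wp_set_reg (v := b) n1 ry _ st1)).
  rewrite (@eval_read _ _ _ _ j) ?eval_var // un1 //=.
  by rewrite (nth_map (a, b)) // Eab.
move=> mu2 st2.
apply: wp_seqs; apply: (wp_mono (wp_set_port (v := b) n1 rx ry _ st2)).
  by rewrite eval_var (state_env st2).
move=> mu3 st3.
apply: wp_seqs; apply: (wp_mono (wp_set_port (v := a) n1 ry rx _ st3)).
  by rewrite eval_var (state_env st3).
move=> mu4 st4.
have ch : edge_change Add true H (add_edge H a b) a b.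
  by apply: change_add => //; apply: edge_relC.
apply: wp_seqs; apply: (wp_mono (wp_change_edge n1 rx ry ab ch st4)) => mu5 st5.
have f5 := state_frame st5; have un5 := outputs_clear_trans un f5 isT.
apply: wp_seqs; apply: (wp_incr (x := j)); first by rewrite f5.
  by clear -sE jm n1; nia.
apply: wp_done.
have st6 := state_other (a := POS) 0 j.+1 isT (state_self st5).
do 2!eexists; split.
- by apply: eq_state st6 => c d; rewrite eE.
- move=> c d; rewrite eE /add_edge /setport /same_edge /= => Hcd.
  case: ifP => [/andP[_ /eqP->] //|n2].
  case: ifP => [/andP[_ /eqP->] //|n3].
  by apply: pE; move: Hcd; rewrite n2 n3 !orbF.
- by [].
- split=> //.
  + exact: (etrans (f5 TAIL 0 isT) mT).
  + exact: (etrans (f5 HEAD 0 isT) mH).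
  + by move=> d dn; apply: (etrans (f5 QUE d isT) (mQ d dn)).
  + by move=> d dn; apply: (etrans (f5 ROOT (d * d) isT) (mR d dn)).
- exact: outputs_clear_update.
Qed.

Lemma degree2_nbrs H z : \sum_(b | H z b) 1 = 2 -> exists x y, nbrs2 H z x y.
Proof.
rewrite sum1_card => E.
have : #|[set b | H z b]| == 2 by rewrite cardsE -E; apply/eqP/eq_card.
case/cards2P=> x [y [xy Ez]]; exists x, y; split=> // w.
by have := in_set2 w x y; rewrite -Ez inE.
Qed.

Definition main_cost := (cost main_test + max_time main_body).+1.

(** Every vertex of degree 2 is in the unread part of the queue. An elimination
    appends two entries and removes a vertex, so there are never more than
    [3 * n] entries, and this pays for the loop. The registers of the neighbours
    locate the edge that remains at last; before the first elimination they may
    not, but then there are no ears. *)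
Definition main_inv phi mu := exists rho H ear port L F k h t,
  [/\ state rho H ear port L mu mu, invariant E0 H ear port L F k,
      (forall a b, ear a b = None) \/ H (rho RX) (rho RY),
      [/\ mu HEAD 0 = h, mu TAIL 0 = t, h <= t & t + 2 * #|alive H| <= 3 * n]
    & [/\ forall j, j < t -> mu QUE j < n,
          forall z : V, \sum_(b | H z b) 1 = 2 ->
            exists2 j, h <= j < t & mu QUE j = z,
          roots n mu & outputs_clear mu]] /\ phi = (3 * n - h) * main_cost.

Lemma alive_le H : #|alive H| <= n.
Proof. by rewrite -[X in _ <= X]card_ord max_card. Qed.

Lemma main_init mu : load_inv (size es) mu -> main_inv (3 * n * main_cost) mu.
Proof.
case=> rho [port [st pE mP [mT mH mQ mR] un]]; rewrite take_size in st pE.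
exists rho, (edge_rel es), (fun _ _ => None), port, [::], [::], 0, 0, n.
split; last by rewrite subn0.
split=> //; [exact: inv_init | by left | |].
  by split=> //; have := alive_le (edge_rel es); clear; lia.
split=> // [j jn|z _]; first by rewrite mQ.
by exists z; rewrite /= ?mQ ?ltn_ord.
Qed.

Lemma wp_push rho H ear port L mu r t (v : V) (Q : memory -> Prop) :
  r \in registers -> rho r = v -> state rho H ear port L mu mu ->
  mu TAIL 0 = t -> t < 3 * n ->
  (forall nu, state rho H ear port L nu nu -> nu TAIL 0 = t.+1 ->
     (forall j, nu QUE j = if j == t then v : nat else mu QUE j) ->
     frame [:: QUE; TAIL] mu nu -> Q nu) ->
  wp W (push_cmd r) mu Q.
Proof.
move=> rr rhor st mT tn q.
apply: wp_seq; apply: (@wp_write _ _ _ _ t v).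
- by rewrite eval_var.
- by rewrite eval_var (state_env st) // rhor.
set mu1 := update _ _ _ _.
have st1 : state rho H ear port L mu1 mu1 by apply: state_other.
apply: (wp_incr (x := t)) => //; first by clear -tn n1; nia.
apply: q => //; first exact: state_other.
by do 2!apply: frame_update => //.
Qed.

(** Only the neighbours of the eliminated vertex can become candidates. *)
Lemma elim_degree H u x y z :
  graph_rel H -> nbrs2 H u x y -> z != x -> z != y -> z != u ->
  elim H u x y z =1 H z.
Proof.
move=> [Hs _] [_ Hu] zx zy zu w.
rewrite /elim /same_edge (negbTE zx) (negbTE zy) /= orbF zu /=.
have [->|//] := eqVneq w u.
by rewrite Hs Hu (negbTE zx) (negbTE zy).
Qed.

Lemma main_step phi mu : main_inv phi mu -> eval W mu main_test != 0 ->
  exists t nu psi, [/\ exec W main_body mu t nu, main_inv psi nu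
    & cost main_test + t + psi < phi].
Proof.
case=> rho [H [ear [port [L [F [k [h [t]]]]]]]].
case=> [[st I exy [mH mT ht tn] [mQn mQ mR un]] ->] test.
have {test} hlt : h < t.
  by move: test; rewrite (eval_lt (x := h) (y := t)) ?eval_var.
have gH : graph_rel H := inv_graph I.
(* The queue moves by one entry in any case, which pays for the iteration. *)
suff w : wp W main_body mu (main_inv ((3 * n - h.+1) * main_cost)).
  have [t' [nu [ex le iv]]] := exec_loop_free (c := main_body) isT w.
  exists t', nu, ((3 * n - h.+1) * main_cost); split=> //.
  have -> : 3 * n - h = (3 * n - h.+1).+1 by clear -hlt tn; lia.
  by rewrite [X in _ < X]mulSn ltn_add2r ltnS leq_add2l.
pose u : V := Ordinal (mQn h hlt).
apply: wp_seqs; apply: (wp_mono (wp_set_reg (v := u) n1 ru _ st)).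
  by rewrite (@eval_read _ _ _ _ h) ?eval_var.
move=> mu1 st1; have f1 := state_frame st1.
apply: wp_seqs; apply: (wp_incr (x := h)); first by rewrite f1.
  by clear -hlt tn n1; nia.
have st2 := state_other (a := HEAD) 0 h.+1 isT (state_self st1).
have un2 : outputs_clear (update mu1 HEAD 0 h.+1).
  by apply: outputs_clear_update => //; exact: (outputs_clear_trans un f1).
have H2 : update mu1 HEAD 0 h.+1 HEAD 0 = h.+1 by [].
have T2 : update mu1 HEAD 0 h.+1 TAIL 0 = t := etrans (f1 TAIL 0 isT) mT.
have Q2 j : update mu1 HEAD 0 h.+1 QUE j = mu QUE j := f1 QUE j isT.
have R2 : roots n (update mu1 HEAD 0 h.+1).
  by move=> d dn; apply: (etrans (f1 ROOT (d * d) isT) (mR d dn)).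
move: (update mu1 _ _ _) st2 un2 H2 T2 Q2 R2 => mu2 st2 un2 H2 T2 Q2 R2.
set rho2 := setrho rho RU u in st2.
set d := \sum_(b | H u b) 1.
have ed : eval W mu2 (degree_of RU) = d.
  rewrite (@eval_read _ _ _ _ u) ?eval_var ?(state_env st2) //.
  by case: st2 => [[]].
have skip : d != 2 -> main_inv ((3 * n - h.+1) * main_cost) mu2.
  move=> d2; exists rho2, H, ear, port, L, F, k, h.+1, t; split=> //.
  split=> //; split=> // [j jt|z z2]; first by rewrite Q2 mQn.
  have [j /andP[hj jt] Ez] := mQ z z2; exists j; rewrite ?Q2 // jt andbT.
  rewrite ltn_neqAle hj andbT; apply: contraNneq d2 => E.
  by rewrite /d (_ : u = z) ?z2 //; apply: val_inj; rewrite /= E.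
apply: wp_seqs; apply: (@wp_if _ (1 < d)).
- by apply: eval_lt => //; rewrite eval_const // const_small.
- move=> d1; apply: (@wp_if _ (d < 3)).
  + by apply: eval_lt => //; rewrite eval_const // const_small.
  + move=> d3; have {d1 d3} d2 : d = 2 by clear -d1 d3; lia.
    have [x0 [y0 nu0]] := degree2_nbrs d2.
    apply: wp_seqs; apply: (wp_mono (wp_eliminate n1 st2 R2 I nu0)).
    move=> mu3 [rho3 [ear3 [port3 [L3 [F3 [k3 [nu3 I3 st3]]]]]]].
    have f3 := state_frame st3; have un3 := outputs_clear_trans un2 f3 isT.
    have sA := alive_elim gH nu3.
    set H3 := elim _ _ _ _ in I3 st3 sA.
    have tn3 : t.+2 + 2 * #|alive H3| <= 3 * n.
      by move: tn; rewrite sA; clear; lia.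
    have T3 : mu3 TAIL 0 = t by rewrite f3.
    apply: wp_seqs; apply: (@wp_push _ _ _ _ _ _ _ _ _ _ rx erefl (state_self st3) T3).
      by clear -tn3; lia.
    move=> mu4 st4 T4 Q4 f4.
    apply: wp_seqs; apply: (@wp_push _ _ _ _ _ _ _ _ _ _ ry erefl st4 T4).
      by clear -tn3; lia.
    move=> mu5 st5 T5 Q5 f5; do 2!apply: wp_done.
    exists rho3, H3, ear3, port3, L3, F3, k3, h.+1, t.+2; split=> //; split=> //.
    * right; have [ux uy] := nbrs2_neq gH nu3.
      by rewrite /H3 /elim /same_edge !eqxx !(eq_sym _ u) ux uy orbT.
    * split=> //; last by clear -hlt; lia.
      by rewrite f5 // f4 // f3.
    have Q5' j : mu5 QUE j = if j == t.+1 then rho3 RY : nat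
        else if j == t then rho3 RX : nat else mu QUE j.
      by rewrite Q5 Q4 f3 // Q2.
    split.
    * move=> j jt; rewrite Q5'; case: ifP => [_|j1]; first exact: ltn_ord.
      case: ifP => [_|j2]; first exact: ltn_ord.
      apply: (mQn j); move: jt j1 j2; clear; lia.
    * move=> z z2; have [->|zx] := eqVneq z (rho3 RX).
        exists t; first by clear -hlt; lia.
        by rewrite Q5' eqxx ltn_eqF.
      have [->|zy] := eqVneq z (rho3 RY).
        by exists t.+1; [clear -hlt; lia | rewrite Q5' eqxx].
      have zu : z != u.
        by apply: contra_eq_neq z2 => ->; rewrite big_pred0 // => w; rewrite /H3 /elim eqxx.
      rewrite (eq_bigl _ _ (elim_degree gH nu3 zx zy zu)) in z2.
      have [j /andP[hj jt] Ez] := mQ z z2; exists j; last first.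
        by rewrite Q5' !ltn_eqF // ltnW.
      have : h != j by apply: contraNneq zu => E; apply/eqP/val_inj; rewrite /= -Ez E.
      by clear -hj jt; lia.
    * by move=> c cn; rewrite f5 // f4 // f3 // R2.
    have un4 := outputs_clear_trans un3 f4 isT.
    exact: (outputs_clear_trans un4 f5 isT).
  + by move=> d3; apply: wp_skip; apply: wp_done; apply: skip; clear -d3; lia.
by move=> d1; apply: wp_skip; apply: wp_done; apply: skip; clear -d1; lia.
Qed.


Lemma stores_links_eq (L L' : seq (V * V * V)) arr :
  (forall a b c, slink L a b c = slink L' a b c) -> stores_links L arr -> stores_links L' arr.
Proof.
move=> E [l1 l2]; split=> [a b|a b c]; last by rewrite -E; apply: l2.
by have [|[c Ec lc]] := l1 a b; [left | right; exists c; rewrite // -E].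
Qed.

Lemma wp_final phi mu : main_inv phi mu -> eval W mu main_test = 0 ->
  wp W final_cmd mu (fun nu => exists P,
    [/\ covers E0 P, size P <= uphalf n,
        stores_links (links (fun _ => id) P) (nu NXT) & outputs_clear nu]).
Proof.
case=> rho [H [ear [port [L [F [k [h [t]]]]]]]].
case=> [[st I exy [mH mT ht _] [_ mQ _ un]] _] test.
have {test} th : t <= h.
  have := @eval_lt mu (Var HEAD) (Var TAIL) h t; rewrite !eval_var => e.
  by rewrite leqNgt -(e mH mT) test.
have nn u x y : ~ nbrs2 H u x y.
  move=> nu; have [|j] := mQ u; first by rewrite (sum_nbrs2 _ nu).
  by move: th; clear; lia.
have gH := inv_graph I.
have [s [s' Hs]] : exists s s', H s s'.
  case: (inv_reducible I) => [H' s s' _ E|H' u x y [_ Hu] _].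
    by exists s, s'; rewrite E /same_edge !eqxx.
  by exists u, x; rewrite Hu eqxx.
apply: (@wp_if _ (ear (rho RX) (rho RY) != None)).
- by rewrite (eval_ear n1 rx ry st); case: (ear _ _).
- case exv: (ear (rho RX) (rho RY)) => [v|] // _.
  have Hxy : H (rho RX) (rho RY) by case: exy => // en; rewrite en in exv.
  have [P [cP sP lP]] := inv_final I nn Hxy; rewrite exv in lP.
  apply: wp_seqs; apply: (wp_mono (wp_get_ear n1 rv rx ry exv st)) => mu1 st1.
  apply: wp_seqs; apply: (wp_mono (wp_link n1 rx rv ry st1)) => mu2 st2.
  apply: wp_done; exists P; split=> //.
  + by move: sP; rewrite card_ord.
  + by apply: stores_links_eq (repr_links (state_repr st2)) => a b c; rewrite lP.
  + exact: (outputs_clear_trans un (state_frame st2) isT).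
move=> /negbNE/eqP exv; apply: wp_skip.
have [x [y [Hxy exy']]] : exists x y, H x y /\ ear x y = None.
  by case: exy => [en|Hxy]; [exists s, s' | exists (rho RX), (rho RY)].
have [P [cP sP lP]] := inv_final I nn Hxy; rewrite exy' in lP.
exists P; split=> //; first by move: sP; rewrite card_ord.
by apply: stores_links_eq (repr_links (state_repr st)) => a b c; rewrite lP.
Qed.

Definition cover_cost :=
  2 * (cost init_test + max_time init_body).+1 +
  4 * (cost load_test + max_time load_body).+1 +
  3 * main_cost + (cost main_test).+1 + max_time final_cmd + 5.

Lemma exec_cover : exists t nu P,
  [/\ exec W cover_cmd input t nu, t <= cover_cost * n,
      covers E0 P /\ size P <= uphalf n,
      stores_links (links (fun _ => id) P) (nu NXT) & outputs_clear nu].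
Proof.
have [t1 [mu1 [ex1 le1 I1]]] := exec_init.
have [t2 [mu2 [ex2 le2 I2]]] := exec_load (load_init I1).
have [t3 [mu3 [phi [ex3 I3 test3 le3]]]] := exec_while main_step (main_init I2).
have [t4 [mu4 [ex4 le4 [P [cP sP lP un]]]]] :=
  exec_loop_free (c := final_cmd) isT (wp_final I3 test3).
exists (t1 + (t2 + (t3 + (t4 + 1).+1).+1).+1).+1, mu4, P; split=> //.
  apply: ExecSeq ex1 _; apply: ExecSeq ex2 _; apply: ExecSeq ex3 _.
  by apply: ExecSeq ex4 _; apply: ExecSkip.
have m4 := size_edges.
move: le1 le2 le3 le4; rewrite /cover_cost.
move: (cost init_test + max_time init_body).+1 => c1.
move: (cost load_test + max_time load_body).+1 => c2.
move: main_cost (cost main_test).+1 (max_time final_cmd) => c3 c4 c5.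
move=> le1 le2 le3 le4.
have {}le1 : t1 <= 2 * c1 * n.
  apply: leq_trans le1 _; rewrite mulnAC leq_mul2r.
  by apply/orP; right; move: n1; clear; lia.
have {}le2 : t2 <= 4 * c2 * n.
  apply: leq_trans le2 _; rewrite mulnAC leq_mul2r.
  by apply/orP; right; move: m4; clear; lia.
have {}le3 : t3 <= 3 * c3 * n + c4 * n.
  apply: leq_trans (leq_addr phi _) _; apply: leq_trans le3 _.
  by rewrite mulnAC leq_add2l leq_pmulr // ltnW.
have {}le4 : t4 <= c5 * n by apply: leq_trans le4 _; rewrite leq_pmulr // ltnW.
by rewrite !mulnDl; move: n1 le1 le2 le3 le4; clear; lia.
Qed.

End Phases.

(** * Links determine the paths *)

Section Orient.
Variable V : finType.
Implicit Types (E : seq {set V}) (p q : seq V) (P Q : seq (seq V)).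
Implicit Types (a b c x y z : V).

Lemma covers_disjoint E p P q e :
  uniq E -> covers E (p :: P) -> q \in P -> e \in path_edges p -> e \notin path_edges q.
Proof.
move=> uE /andP[_ pP] qP ep.
have : uniq (flatten (map (@path_edges V) (p :: P))) by rewrite (perm_uniq pP).
rewrite /= cat_uniq => /and3P[_ /hasPn nh _].
by apply/negP=> eq; have := nh e (flatten_path_edges_mem qP eq); rewrite /= ep.
Qed.

Definition oriented P p := (p \in P) || (rev p \in P).

Lemma oriented_rev P p : oriented P (rev p) = oriented P p.
Proof. by rewrite /oriented revK orbC. Qed.

Lemma mem_path_edges_rev p e : (e \in path_edges (rev p)) = (e \in path_edges p).
Proof. exact: perm_mem (path_edges_rev p) _. Qed.

Lemma oriented_uniq E P p : covers E P -> oriented P p -> uniq p && (1 < size p).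
Proof.
by case/andP=> aP _ /orP[/(allP aP)//|/(allP aP)]; rewrite rev_uniq size_rev.
Qed.

Lemma slink_links P a b c :
  slink (links (fun _ => id) P) a b c ->
  exists p1 p2, oriented P (p1 ++ [:: a, b, c & p2]).
Proof.
case/orP=> /flatten_mapP[p pP /mem_plinks[p1 [a' [c' [p2 [E -> ->]]]]]].
  by exists p1, p2; rewrite /oriented -E pP.
exists (rev p2), (rev p1); rewrite /oriented; apply/orP; right.
by rewrite rev_cat !rev_cons !cat_rcons !revK -E.
Qed.

Lemma links_slink P p1 a b c p2 :
  oriented P (p1 ++ [:: a, b, c & p2]) -> slink (links (fun _ => id) P) a b c.
Proof.
have m := plinks_mem (fun _ => id) p1 a b c p2.
case/orP=> pP; apply/orP; [left | right]; apply/flatten_mapP.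
  by exists (p1 ++ [:: a, b, c & p2]).
by exists (rev (p1 ++ [:: a, b, c & p2])); rewrite // plinks_rev.
Qed.

Lemma oriented_eq E P p q e :
  uniq E -> covers E P -> oriented P p -> oriented P q ->
  e \in path_edges p -> e \in path_edges q -> q = p \/ q = rev p.
Proof.
move=> uE cP.
have eqP p0 q0 : p0 \in P -> q0 \in P ->
    e \in path_edges p0 -> e \in path_edges q0 -> q0 = p0.
  move=> pP qP ep eq; have pr := perm_to_rem pP.
  have := qP; rewrite (perm_mem pr) inE => /orP[/eqP//|qr].
  by have := covers_disjoint uE (covers_perm_paths pr cP) qr ep; rewrite eq.
rewrite -(mem_path_edges_rev p) -(mem_path_edges_rev q).
case/orP=> pP /orP[] qP ep eq.
- by left; apply: eqP => //; rewrite -mem_path_edges_rev.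
- right; apply: (can_inj revK); rewrite revK.
  by apply: eqP => //; rewrite -mem_path_edges_rev.
- by right; apply: eqP => //; rewrite -mem_path_edges_rev.
- by left; apply: (can_inj revK); apply: eqP.
Qed.

(** Disjoint paths share no edge, so a link at an edge belongs to the path of
    that edge; on a simple path it leads to the next vertex. *)
Lemma next_unique E P p1 a b p2 c :
  uniq E -> covers E P -> oriented P (p1 ++ [:: a, b & p2]) ->
  slink (links (fun _ => id) P) a b c -> exists r, p2 = c :: r.
Proof.
move=> uE cP op /slink_links[r1 [r2 oq]].
have /andP[up _] := oriented_uniq cP op.
have ep := path_edges_mem p1 a b p2; have eq := path_edges_mem r1 a b (c :: r2).
(* The path of the link is the given one, in the same or the other direction;
   in the other direction, [b] would precede [a]. *)
have [E1|E1] := oriented_eq uE cP op oq ep eq.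
  move/esym/eqP: E1; rewrite uniq_eqseq_pivotl // => /andP[_ /eqP[->]].
  by exists r2.
have : p1 ++ a :: b :: p2 == rcons (rev (c :: r2)) b ++ a :: rev r1.
  by apply/eqP/(can_inj revK); rewrite -E1 rev_cat rev_rcons revK rev_cons revK cat_rcons.
rewrite uniq_eqseq_pivotl // => /andP[/eqP Ep1 _].
by move: up; rewrite Ep1 cat_uniq /= !mem_rcons mem_head /= !orbT andbF.
Qed.

End Orient.

(** * Writing the paths *)

Notation IDX := 23 (only parsing).

Definition next_of r s := Read NXT (pair_at r s).
Definition emit r := Seq (Write 5 (Var OUT) (Var r)) (incr OUT).

Definition walk_start := seqs
  [:: Write DONE (pair_at RX RY) (Const 1); emit RX;
      set_reg LEN (Const 1); set_reg TMP2 (Const 1)].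
Definition walk_body := seqs
  [:: emit RY; incr LEN;
      If (next_of RX RY)
        (seqs [:: set_reg TMP (pred_of (next_of RX RY));
                  set_reg RX (Var RY); set_reg RY (Var TMP)])
        (set_reg TMP2 (Const 0))].
Definition walk_end := seqs
  [:: Write DONE (pair_at RY RX) (Const 1);
      Write 4 (Read 3 (Const 0)) (Var LEN); incr 3].
(** A path is written when one of its ends is met for the first time. The edge
    from [a] to [b] is an end at [a] if nothing continues from [b] to [a]. *)
Definition walk_cmd :=
  If (next_of RY RX) Skip
    (If (Read DONE (pair_at RX RY)) Skip
      (Seq walk_start (Seq (While (Var TMP2) walk_body) walk_end))).

Definition load_ends r1 r2 :=
  Seq (set_reg RX (Read r1 (Var IDX))) (set_reg RY (Read r2 (Var IDX))).
Definition output_body :=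
  Seq (load_ends 1 2) (Seq walk_cmd (Seq (load_ends 2 1) (Seq walk_cmd (incr IDX)))).
Definition output_test := Binop Lt (Var IDX) (Read 0 (Const 1)).

Lemma mkseq_update (f : nat -> nat) k v (l : seq nat) :
  mkseq f k = l -> mkseq (fun j => if j == k then v else f j) k.+1 = rcons l v.
Proof.
move=> <-; rewrite mkseqS eqxx; congr rcons.
by apply/eq_in_map => j; rewrite mem_iota add0n => jk; rewrite ltn_eqF.
Qed.

(** A path with at least one edge has at most twice as many vertices as edges. *)
Lemma size_flatten_paths (T : finType) (E : seq {set T}) P :
  covers E P -> size (flatten P) <= 2 * size E.
Proof.
case/andP=> aP pP; rewrite -(perm_size pP) {pP}.
elim: P aP => //= p P IH /andP[/andP[_ sp] /IH]; rewrite !size_cat.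
case: p sp => [|a [|b p]] //= _; rewrite size_pairmap; clear; lia.
Qed.

Section Output.
Variable n : nat.
Hypothesis n1 : 1 < n.

Local Notation W := (n ^ 8).
Local Notation V := 'I_n.
Implicit Types (mu nu : memory) (a b c d x y : V) (p q : seq V) (O Q P : seq (seq V)).

Variable es : seq (V * V).
Hypothesis sp_es : series_parallel es.
Hypothesis simple_es : simple_graph es.

Local Notation E0 := (map (@uedge V) es).
Local Notation input := (graph_input es).

Definition walk_frame := [:: 5; OUT; LEN; TMP; TMP2; RX; RY].

Lemma wp_emit r mu (k : nat) (v : V) (Q : memory -> Prop) :
  mu OUT 0 = k -> mu r 0 = v -> k <= 2 * (n * n) ->
  Q (update (update mu 5 k v) OUT 0 k.+1) -> wp W (emit r) mu Q.
Proof.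
move=> mk mv lk q; apply: wp_seq; apply: (@wp_write _ _ _ _ k v); rewrite ?eval_var //.
by apply: (wp_incr n1 (x := k)).
Qed.

(** After [j] steps the registers hold the last edge walked; at the end of the
    path it stays in place, whence the [minn]. *)
Definition walk_inv (s p : seq V) (x0 : V) mu j nu :=
  [/\ nu RX 0 = nth x0 p (minn j (size p).-2),
      nu RY 0 = nth x0 p (minn j (size p).-2).+1,
      nu TMP2 0 = (j < (size p).-1),
      [/\ nu LEN 0 = j.+1, nu OUT 0 = size s + j.+1 &
          mkseq (nu 5) (size s + j.+1) = map val (s ++ take j.+1 p)]
    & frame walk_frame mu nu].

Lemma exec_walk s p x0 mu nu :
  mu 0 0 = n -> 1 < size p -> size s + size p <= 2 * (n * n) ->
  (forall j, j.+1 < size p ->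
     mu NXT (nth x0 p j * n + nth x0 p j.+1) =
       if j.+2 < size p then (nth x0 p j.+2).+1 else 0) ->
  walk_inv s p x0 mu 0 nu ->
  exists t xi, [/\ exec W (While (Var TMP2) walk_body) nu t xi,
    t <= size p * (cost (Var TMP2) + max_time walk_body).+1
    & walk_inv s p x0 mu (size p).-1 xi].
Proof.
move=> mn sp sb nx I0.
have -> : size p = (size p).-1.+1 by rewrite prednK // ltnW.
apply: (@exec_while_count W _ _ (size p).-1 (walk_inv s p x0 mu)) => //; last first.
  by move=> xi [_ _ t2 _ _]; rewrite eval_var t2 ltnn.
move=> j xi jp [xX xY xT [xL xO x5] fr].
have xT1 : xi TMP2 0 = 1 by rewrite xT jp.
rewrite eval_var xT1; split=> //.
have jm : minn j (size p).-2 = j by apply/minn_idPl; move: jp; clear; lia.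
rewrite jm in xX xY.
have jp2 : j.+1 < size p by move: jp; clear; lia.
apply: wp_seqs; apply: (wp_emit xO xY); first by move: sb jp2; clear; lia.
set mu1 := update (update _ _ _ _) _ _ _.
apply: wp_seqs; apply: (wp_incr n1 (x := j.+1)) => //.
  by move: sb jp2; clear; lia.
set mu2 := update mu1 _ _ _.
have fr2 : frame walk_frame mu mu2 by do 3!apply: frame_update => //.
have n2 : mu2 0 0 = n by rewrite fr2.
have nxE : eval W mu2 (next_of RX RY) =
    if j.+2 < size p then (nth x0 p j.+2).+1 else 0.
  by rewrite (eval_read _ (@eval_pair n n1 mu2 RX RY _ _ n2 xX xY)) fr2 // nx.
have m5 : mkseq (mu2 5) (size s + j.+2) = map val (s ++ take j.+2 p).
  rewrite (take_nth x0 jp2) -rcons_cat map_rcons addnS.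
  exact: (mkseq_update _ x5).
have o2 : mu2 OUT 0 = size s + j.+2 by rewrite addnS.
apply: wp_seqs; apply: (@wp_if _ (j.+2 < size p)).
- by rewrite nxE; case: ifP.
- move=> jp3; rewrite jp3 in nxE.
  have jm3 : minn j.+1 (size p).-2 = j.+1.
    by apply/minn_idPl; move: jp3; clear; lia.
  set v := nth x0 p j.+2 in nxE.
  apply: wp_seqs; apply: (@wp_write _ _ _ _ 0 v).
  + by rewrite eval_zero.
  + have -> : v = eval_binop Defs.Sub v.+1 1 :> nat by rewrite /= subn1.
    apply: eval_op => //; first by rewrite eval_const // const_small.
    by apply: small_word; rewrite //= subn1 /=; have := ltn_ord v; move: n1; clear; nia.
  apply: wp_seqs; apply: (@wp_write _ _ _ _ 0 (nth x0 p j.+1)).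
  + by rewrite eval_zero.
  + by rewrite eval_var.
  apply: wp_seqs; apply: (@wp_write _ _ _ _ 0 v).
  + by rewrite eval_zero.
  + by rewrite eval_var.
  do 2!apply: wp_done; split=> //.
  + by rewrite jm3.
  + by rewrite jm3.
  + rewrite (_ : (_ < _) = true); first exact: xT1.
    by move: jp3; clear; lia.
  + by do 3!apply: frame_update => //.
move=> jp3; rewrite (negbTE jp3) in nxE.
have jm3 : minn j.+1 (size p).-2 = j.
  by move: jp3 jp; clear; lia.
apply: (@wp_write _ _ _ _ 0 0); rewrite ?eval_zero //.
apply: wp_done; split=> //.
- by rewrite jm3.
- by rewrite jm3.
- rewrite (_ : (_ < (size p).-1) = false) //.
  by move: jp3; clear; lia.
- exact: frame_update.
Qed.

Definition starts p a b := take 2 p == [:: a; b].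

Lemma startsP p a b : reflect (exists q, p = a :: b :: q) (starts p a b).
Proof.
apply: (iffP eqP) => [|[q ->]]; last by rewrite /= take0.
by case: p => [|a' [|b' q]] //=; rewrite take0 => -[-> ->]; exists q.
Qed.

Lemma startsE x0 p a b :
  1 < size p -> starts p a b = (nth x0 p 0 == a) && (nth x0 p 1 == b).
Proof.
by case: p => [|c [|d q]] // _; rewrite /starts /= take0 !eqseq_cons andbT.
Qed.

Lemma starts_cons a b q c d : starts (a :: b :: q) c d = (a == c) && (b == d).
Proof. by rewrite /starts /= take0 !eqseq_cons andbT. Qed.

(** [O] are the paths written, [Q] those to come, together a cover with the given
    links throughout: writing a path in the other direction changes neither.
    No path to come has an end among the directed edges [D] seen so far. *)
Record out_inv (D : seq (V * V)) O Q mu : Prop := OutInv {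
  out_covers : covers E0 (O ++ Q);
  out_links : stores_links (links (fun _ => id) (O ++ Q)) (mu NXT);
  out_done : forall a b, (mu DONE (a * n + b) != 0) =
    has (fun o => starts o a b || starts (rev o) a b) O;
  out_seen : forall a b, (a, b) \in D ->
    forall q, q \in Q -> ~~ (starts q a b || starts (rev q) a b);
  out_outputs : outputs mu O;
  out_size : mu OUT 0 = size (flatten O);
  out_input : forall r j, r < 3 -> mu r j = input r j
}.

Lemma next_cell P arr p1 a b p2 :
  covers E0 P -> stores_links (links (fun _ => id) P) arr ->
  oriented P (p1 ++ [:: a, b & p2]) ->
  arr (a * n + b) = if p2 is c :: _ then c.+1 else 0.
Proof.
move=> cP [l1 l2] op; have [E|[c Ec lc]] := l1 a b.
  case: p2 op => // c p2 op.
  by have := l2 _ _ _ (links_slink op); rewrite E.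
by have [r ->] := next_unique simple_es cP op lc.
Qed.

Lemma oriented_edge P a b :
  covers E0 P -> edge_rel es a b -> exists p1 p2, oriented P (p1 ++ [:: a, b & p2]).
Proof.
case/andP=> _ pP; rewrite /edge_rel -(perm_mem pP) => /flatten_mapP[p pP' /mem_path_edges].
case=> p1 [c [d [p2 [Ep /eqP]]]]; rewrite eq_set2 => /orP[]/andP[/eqP Ea /eqP Eb].
  by exists p1, p2; rewrite /oriented Ea Eb -Ep pP'.
exists (rev p2), (rev p1); rewrite -oriented_rev /oriented Ea Eb.
by rewrite rev_cat !rev_cons !cat_rcons !revK -Ep pP'.
Qed.

Definition walk_const := (cost (Var TMP2) + max_time walk_body).+1.
Definition start_const := cost (next_of RY RX) + cost (Read DONE (pair_at RX RY)) +
  max_time walk_start + max_time walk_end + 5.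

Lemma covers_small O Q : covers E0 (O ++ Q) ->
  size (flatten O) + size (flatten Q) <= 2 * (n * n) - 2.
Proof.
move/size_flatten_paths; rewrite flatten_cat size_cat size_map.
have sq : 8 * n <= 2 * (n * n) + 8 by case: (n) => [|[|k]] //; clear; nia.
have := size_edges sp_es simple_es.
move: (size es) (n * n) (size (flatten O)) (size (flatten Q)) sq; clear.
by move=> m N A B ? ? ?; lia.
Qed.

Lemma size_small O Q : covers E0 (O ++ Q) -> size O <= size (flatten O).
Proof.
case/andP; rewrite all_cat => /andP[aO _] _.
elim: O aO => //= o O IH /andP[/andP[_ so] /IH]; rewrite size_cat.
by move: so; clear; lia.
Qed.

Lemma out_skip D O Q mu a b :
  out_inv D O Q mu -> (mu NXT (b * n + a) != 0) || (mu DONE (a * n + b) != 0) ->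
  out_inv ((a, b) :: D) O Q mu.
Proof.
case=> cov lks done seen outs siz inp skip; split=> // c d.
rewrite inE => /orP[/eqP[-> ->]|/seen//] q qQ.
have oq : oriented (O ++ Q) q by rewrite /oriented mem_cat qQ orbT.
apply/negP=> st.
have [p [op stp]] : exists p, oriented (O ++ Q) p /\ starts p a b.
  by case/orP: st => st; [exists q | exists (rev q); rewrite oriented_rev].
case/startsP: (stp) => r Ep.
have nx : mu NXT (b * n + a) = 0.
  apply: (@next_cell (O ++ Q) _ (rev r) b a [::]) => //.
  by rewrite -oriented_rev rev_cat revK -[rev _]/[:: a; b] /= -Ep.
move: skip; rewrite nx /= done => /hasP[o oO sto].
have oo : oriented (O ++ Q) o by rewrite /oriented mem_cat oO.
have eo : [set a; b] \in path_edges o.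
  case/orP: sto => /startsP[r' E]; first by rewrite E mem_head.
  by rewrite -mem_path_edges_rev E mem_head.
have eq : [set a; b] \in path_edges q.
  case/orP: st => /startsP[r' E]; first by rewrite E mem_head.
  by rewrite -mem_path_edges_rev E mem_head.
have pr := perm_to_rem oO.
have cov' : covers E0 (o :: (rem o O ++ Q)).
  by apply: covers_perm_paths cov; rewrite -cat_cons perm_cat2r.
have := covers_disjoint simple_es cov' _ eo (q := q).
by rewrite mem_cat qQ orbT eq => /(_ isT).
Qed.

(** The potential of a path pays for walking along it. *)
Lemma exec_walk_cmd D O Q mu a b :
  out_inv D O Q mu -> mu RX 0 = a -> mu RY 0 = b -> edge_rel es a b ->
  exists t nu O' Q', [/\ exec W walk_cmd mu t nu,
    out_inv ((a, b) :: D) O' Q' nu,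
    t + walk_const * size (flatten Q') <= start_const + walk_const * size (flatten Q),
    nu IDX 0 = mu IDX 0 & size (O' ++ Q') = size (O ++ Q)].
Proof.
move=> I mX mY Hab; have mn : mu 0 0 = n by rewrite (out_input I).
have eN : eval W mu (next_of RY RX) = mu NXT (b * n + a).
  exact: (eval_read _ (@eval_pair n n1 mu RY RX _ _ mn mY mX)).
have eD : eval W mu (Read DONE (pair_at RX RY)) = mu DONE (a * n + b).
  exact: (eval_read _ (@eval_pair n n1 mu RX RY _ _ mn mX mY)).
have [nN|/negbNE/eqP nN] := boolP (mu NXT (b * n + a) != 0).
  exists (cost (next_of RY RX) + 1).+1, mu, O, Q; split=> //.
  - by apply: ExecIfTrue; [rewrite eN | apply: ExecSkip].
  - by apply: out_skip; rewrite ?nN.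
  - by rewrite leq_add2r /start_const; clear; lia.
have [nD|/negbNE/eqP nD] := boolP (mu DONE (a * n + b) != 0).
  exists (cost (next_of RY RX) + (cost (Read DONE (pair_at RX RY)) + 1).+1).+1, mu, O, Q.
  split=> //.
  - apply: ExecIfFalse; first by rewrite eN.
    by apply: ExecIfTrue; [rewrite eD | apply: ExecSkip].
  - by apply: out_skip; rewrite ?nD ?orbT.
  - by rewrite leq_add2r /start_const; clear; lia.
case: (I) => cov lks done seen [o3 o4 o5] siz inp.
(* As nothing continues from [b] to [a], the path through [ab] starts at [a];
   as this end is not marked, the path is not written yet. *)
have [p1 [p2 op]] := oriented_edge cov Hab.
have op' : oriented (O ++ Q) (rev p2 ++ [:: b, a & rev p1]).
  by rewrite -oriented_rev rev_cat !rev_cons !cat_rcons !revK.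
have {op'} := next_cell cov lks op'; rewrite nN.
case: p1 op => [|z p1] op; last by rewrite rev_cons; case: (rev p1).
move=> _; move: op; rewrite cat0s; move Dp: [:: a, b & p2] => p op.
have [p0 [p0Q Ep]] : exists p0, p0 \in Q /\ (p = p0 \/ p = rev p0).
  have nO o : o \in O -> ~~ (starts o a b || starts (rev o) a b).
    move=> oO; apply/negP=> so; move/eqP: nD; apply/negP.
    by rewrite done; apply/hasP; exists o.
  have sp : starts p a b by apply/startsP; exists p2; rewrite Dp.
  case/orP: op; rewrite mem_cat => /orP[/nO|pQ].
  - by rewrite sp.
  - by exists p; split=> //; left.
  - by rewrite revK sp orbT.
  - by exists (rev p); split=> //; right; rewrite revK.
have pr := perm_to_rem p0Q; set Q' := rem p0 Q in pr.
have szQ : size (flatten Q) = size p + size (flatten Q').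
  rewrite (perm_size (perm_flatten pr)) /= size_cat.
  by case: Ep => ->; rewrite ?size_rev.
have perm1 : perm_eq (O ++ Q) (p0 :: (O ++ Q')).
  by apply: perm_trans (perm_cat (perm_refl O) pr) _; rewrite -cat1s perm_catCA.
have perm2 : perm_eq (p :: (O ++ Q')) (rcons O p ++ Q').
  by rewrite -cats1 -catA -cat1s perm_catCA.
have cov1 : covers E0 (p :: (O ++ Q')).
  have c0 := covers_perm_paths perm1 cov.
  by case: Ep => ->; rewrite ?c0 //; apply: covers_rev.
have cov2 := covers_perm_paths perm2 cov1.
have lk2 c d e : slink (links (fun _ => id) (O ++ Q)) c d e =
    slink (links (fun _ => id) (rcons O p ++ Q')) c d e.
  rewrite (slink_perm_paths _ _ _ _ perm1) -(slink_perm_paths _ _ _ _ perm2).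
  by case: Ep => ->; rewrite ?slink_rev_head.
have lks2 := stores_links_eq lk2 lks.
have small := covers_small cov; rewrite szQ in small.
have small2 := size_small cov.
have sp : 1 < size p by rewrite -Dp.
pose s := flatten O.
set mu1 := update mu DONE (a * n + b) 1.
have e1 nu : eval W nu (Const 1) = 1 by rewrite eval_const // const_small.
have szO : size (flatten O) <= 2 * (n * n).
  by move: small; clear; move: (size _) (size _) (size _) (n * n) => *; lia.
have start : wp W walk_start mu (walk_inv s p a mu1 0).
  apply: wp_seqs; apply: (@wp_write _ _ _ _ (a * n + b) 1) => //.
    exact: (@eval_pair n n1 mu RX RY _ _ mn mX mY).
  rewrite -/mu1; apply: wp_seqs.
  apply: (@wp_emit RX mu1 (size s) a _ siz mX szO).
  apply: wp_seqs; apply: (@wp_write _ _ _ _ 0 1); rewrite ?eval_zero //.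
  apply: wp_seqs; apply: (@wp_write _ _ _ _ 0 1); rewrite ?eval_zero //.
  apply: wp_done; rewrite -Dp; split; rewrite ?min0n //; last first.
    by do 4!apply: frame_update => //.
  split; rewrite ?addn1 // -[take 1 _]/[:: a] cats1 map_rcons.
  exact: (mkseq_update (f := mu 5) _ o5).
have [t1 [nu1 [ex1 le1 I1]]] := exec_loop_free (c := walk_start) isT start.
have sb : size s + size p <= 2 * (n * n).
  by move: small; clear; move: (size _) (size _) (size _) (n * n) => *; lia.
have nx j : j.+1 < size p -> mu1 NXT (nth a p j * n + nth a p j.+1) =
    if j.+2 < size p then (nth a p j.+2).+1 else 0.
  move=> jp; have E : p = take j p ++ [:: nth a p j, nth a p j.+1 & drop j.+2 p].
    by rewrite -!drop_nth ?cat_take_drop // ltnW.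
  have := @next_cell _ _ (take j p) (nth a p j) (nth a p j.+1) (drop j.+2 p) cov lks.
  rewrite -E => /(_ op) nxE; rewrite -[mu1 NXT _]/(mu NXT _) nxE.
  case: ltnP => jp2; first by rewrite (drop_nth a jp2).
  by rewrite drop_oversize.
have [t2 [nu2 [ex2 le2 [X2 Y2 _ [L2 O2 S2] f2]]]] := exec_walk (mu := mu1) mn sp sb nx I1.
have pp : (size p).-1.+1 = size p by rewrite prednK // ltnW.
have pp2 : (size p).-2.+2 = size p by rewrite -[RHS]pp; case: (size p) sp => [|[]].
rewrite pp take_size in L2 O2 S2.
have mm : minn (size p).-1 (size p).-2 = (size p).-2 by apply/minn_idPr/leq_pred.
rewrite mm in X2 Y2; set x := nth a p _ in X2; set y := nth a p _ in Y2.
have finish : wp W walk_end nu2 (fun nu =>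
    out_inv ((a, b) :: D) (rcons O p) Q' nu /\ nu IDX 0 = mu IDX 0).
  apply: wp_seqs; apply: (@wp_write _ _ _ _ (y * n + x) 1) => //.
    by apply: (@eval_pair n n1 nu2 RY RX _ _ _ Y2 X2); rewrite f2.
  apply: wp_seqs; apply: (@wp_write _ _ _ _ (size O) (size p)).
  - rewrite (@eval_read _ _ _ _ 0) ?eval_zero //.
    exact: (etrans (f2 3 0 isT) o3).
  - by rewrite eval_var.
  apply: wp_seqs; apply: (wp_incr n1 (x := size O)).
  - exact: (etrans (f2 3 0 isT) o3).
  - exact: leq_trans small2 szO.
  apply: wp_done; split; last exact: (f2 IDX 0 isT).
  split=> //.
  - case: lks2 => l1 l2; split=> [c d|c d e lc].
      by have := l1 c d; rewrite -[mu NXT _](f2 NXT _ isT).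
    by have := l2 c d e lc; rewrite -[mu NXT _](f2 NXT _ isT).
  - move=> c d; rewrite has_rcons -done.
    have -> : starts p c d = (a == c) && (b == d) by rewrite -Dp starts_cons.
    have -> : starts (rev p) c d = (y == c) && (x == d).
      rewrite (startsE a) ?size_rev // !nth_rev // ?[0 < _]ltnW //.
      by rewrite -{1}pp2 -{2}pp2 subn1 subn2.
    rewrite -[update _ _ _ _ _ _]/(if c * n + d == y * n + x then 1
                                   else nu2 DONE (c * n + d)).
    rewrite (f2 DONE _ isT) -[mu1 _ _]/(if c * n + d == a * n + b then 1
                                         else mu DONE (c * n + d)).
    rewrite !(pair_inj n1) (eq_sym a) (eq_sym b) (eq_sym x) (eq_sym y).
    by case: ((c == a) && _); case: ((c == y) && _).
  - move=> c d; rewrite inE => /orP[/eqP[-> ->]|cD] q qQ; last first.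
      by apply: (seen c d cD); rewrite (perm_mem pr) inE qQ orbT.
    apply/negP=> st; have eq : [set a; b] \in path_edges q.
      case/orP: st => /startsP[r' E]; first by rewrite E mem_head.
      by rewrite -mem_path_edges_rev E mem_head.
    have := covers_disjoint simple_es cov1 (q := q) (e := [set a; b]).
    by rewrite mem_cat qQ orbT eq -Dp mem_head => /(_ isT isT).
  - split; first by rewrite size_rcons.
      rewrite size_rcons /shape map_rcons.
      apply: (mkseq_update (f := nu2 4)); rewrite -/(shape O) -o4.
      by apply/eq_map => j; rewrite (f2 4 _ isT).
    by rewrite flatten_rcons size_cat; apply: S2.
  - by rewrite flatten_rcons size_cat; apply: O2.
  - case=> [|[|[|]]] // j _; rewrite -inp //.
    + exact: (f2 0 j isT).
    + exact: (f2 1 j isT).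
    + exact: (f2 2 j isT).
have [t3 [nu3 [ex3 le3 [I3 ix]]]] := exec_loop_free (c := walk_end) isT finish.
exists (cost (next_of RY RX) + (cost (Read DONE (pair_at RX RY)) +
  (t1 + (t2 + t3).+1).+1).+1).+1, nu3, (rcons O p), Q'; split=> //; last first.
- by rewrite !size_cat size_rcons (perm_size pr) /= addSnnS.
- rewrite szQ mulnDr /start_const; move: le1 le2 le3.
  rewrite -/walk_const [walk_const * size p]mulnC; clear.
  move: (cost _) (cost _) (max_time walk_start) (max_time walk_end) => c1 c2 c3 c4.
  move: (size p * walk_const) (walk_const * _) => c5 c6.
  by move=> *; lia.
apply: ExecIfFalse; first by rewrite eN.
apply: ExecIfFalse; first by rewrite eD.
by apply: ExecSeq ex1 _; apply: ExecSeq ex2 ex3.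
Qed.

Lemma out_inv_reg D O Q mu r v :
  r \in [:: RX; RY; IDX] -> out_inv D O Q mu -> out_inv D O Q (update mu r 0 v).
Proof.
rewrite !inE => /or3P[]/eqP-> [cov lks done seen [o3 o4 o5] siz inp].
all: by split=> //; case=> [|[|[|]]] // j _; rewrite -inp.
Qed.

Lemma wp_load_ends D O Q mu r1 r2 i a b :
  out_inv D O Q mu -> r1 < 3 -> r2 < 3 -> mu IDX 0 = i ->
  input r1 i = a -> input r2 i = b ->
  wp W (load_ends r1 r2) mu (fun nu =>
    [/\ out_inv D O Q nu, nu RX 0 = a, nu RY 0 = b & nu IDX 0 = i]).
Proof.
move=> I l1 l2 mi ia ib.
apply: wp_seq; apply: (@wp_write _ _ _ _ 0 a); first exact: eval_zero.
  by rewrite (@eval_read _ _ _ _ i) ?eval_var // (out_input I).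
have I1 : out_inv D O Q (update mu RX 0 a) by apply: out_inv_reg.
apply: (@wp_write _ _ _ _ 0 b); first exact: eval_zero.
  by rewrite (@eval_read _ _ _ _ i) ?eval_var // (out_input I1).
by split=> //; apply: out_inv_reg.
Qed.

Definition output_const := 2 * start_const + 2 * max_time (load_ends 1 2) +
  max_time (incr IDX) + cost output_test + 8.

Definition output_inv N phi mu := exists i D O Q,
  [/\ i <= size es, mu IDX 0 = i, out_inv D O Q mu /\ size (O ++ Q) = N,
      forall e, e \in take i es -> (e \in D) && ((e.2, e.1) \in D)
    & phi = (size es - i) * output_const + walk_const * size (flatten Q)].

Lemma output_step N phi mu : output_inv N phi mu -> eval W mu output_test != 0 ->
  exists t nu psi, [/\ exec W output_body mu t nu, output_inv N psi nu
    & cost output_test + t + psi < phi].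
Proof.
case=> i [D [O [Q [im mi [I sN] seen ->]]]] test.
have {test} {}im : i < size es.
  move: test; rewrite (eval_lt n1 (x := i) (y := size es)) ?eval_var //.
  rewrite (@eval_read _ _ _ _ 1) ?(out_input I) //.
  by rewrite eval_const // const_small.
pose o : V := Ordinal (ltnW n1); case Eab : (nth (o, o) es i) => [a b].
have Hab : edge_rel es a b by apply/mapP; exists (a, b) => //; rewrite -Eab mem_nth.
have ia : input 1 i = a by rewrite /= (nth_map (o, o)) // Eab.
have ib : input 2 i = b by rewrite /= (nth_map (o, o)) // Eab.
have w1 := wp_load_ends I (isT : 1 < 3) (isT : 2 < 3) mi ia ib.
have [t1 [mu1 [ex1 le1 [I1 X1 Y1 i1]]]] :=
  exec_loop_free (c := load_ends 1 2) isT w1.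
have [t2 [mu2 [O2 [Q2 [ex2 I2 le2 i2 s2]]]]] := exec_walk_cmd I1 X1 Y1 Hab.
rewrite i1 in i2.
have w3 := wp_load_ends I2 (isT : 2 < 3) (isT : 1 < 3) i2 ib ia.
have [t3 [mu3 [ex3 le3 [I3 X3 Y3 i3]]]] :=
  exec_loop_free (c := load_ends 2 1) isT w3.
have Hba : edge_rel es b a by rewrite edge_relC.
have [t4 [mu4 [O4 [Q4 [ex4 I4 le4 i4 s4]]]]] := exec_walk_cmd I3 X3 Y3 Hba.
rewrite i3 in i4.
have w5 : wp W (incr IDX) mu4 (fun nu => nu = update mu4 IDX 0 i.+1).
  apply: (wp_incr n1 (x := i)) => //.
  have := size_edges sp_es simple_es; move: im n1; move: (size es) => m.
  by clear; nia.
have [t5 [mu5 [ex5 le5 E5]]] := exec_loop_free (c := incr IDX) isT w5.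
exists (t1 + (t2 + (t3 + (t4 + t5).+1).+1).+1).+1, mu5.
exists ((size es - i.+1) * output_const + walk_const * size (flatten Q4)).
split.
- by apply: ExecSeq ex1 _; apply: ExecSeq ex2 _; apply: ExecSeq ex3 _; apply: ExecSeq ex4 ex5.
- exists i.+1, [:: (b, a), (a, b) & D], O4, Q4; rewrite E5; split=> //.
    by split; [apply: out_inv_reg | rewrite s4 s2].
  move=> e; rewrite (take_nth (o, o)) // Eab mem_rcons !inE => /orP[/eqP->|/seen/andP[-> ->]].
    by rewrite !eqxx !orbT.
  by rewrite !orbT.
have le3' : t3 <= max_time (load_ends 1 2) := le3.
rewrite -(subnSK im) [in X in _ < X]mulSn.
move: (_ * output_const) => c0; rewrite /output_const.
move: le1 le2 le3' le4 le5; clear.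
move: (walk_const * size (flatten Q)) (walk_const * size (flatten Q2)).
move: (walk_const * size (flatten Q4)) (max_time _) (max_time _) (cost _) start_const.
by move=> *; lia.
Qed.

(** A path not yet written would end in some directed edge, but all of them have
    been seen. *)
Lemma output_final N phi mu : output_inv N phi mu -> eval W mu output_test = 0 ->
  exists P, [/\ covers E0 P, size P = N & outputs mu P].
Proof.
case=> i [D [O [Q [im mi [I sN] seen _]]]] test.
have {}im : i = size es.
  apply/eqP; rewrite eqn_leq im leqNgt /=; apply/negP=> lt.
  have := @eval_lt n n1 mu (Var IDX) (Read 0 (Const 1)) i (size es).
  rewrite test lt eval_var => /(_ mi).
  rewrite (@eval_read _ _ _ _ 1) ?(out_input I) ?eval_const ?const_small //.
  by move/(_ erefl).
have Q0 : Q = [::].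
  case: Q I sN => // q Q I _.
  have qP : q \in O ++ q :: Q by rewrite mem_cat mem_head orbT.
  have /andP[uq sq] := allP (proj1 (andP (out_covers I))) q qP.
  case: q sq uq qP I => [|a [|b q]] // _ _ qP I.
  have : [set a; b] \in E0.
    have /andP[_ pP] := out_covers I; rewrite -(perm_mem pP).
    by apply: flatten_path_edges_mem qP _; rewrite mem_head.
  case/mapP=> e eE /eqP; rewrite eq_set2 => ab.
  have := seen e; rewrite im take_size => /(_ eE)/andP[eD eD'].
  have abD : (a, b) \in D.
    by case/orP: ab => /andP[/eqP-> /eqP->]; rewrite -?surjective_pairing.
  have := out_seen I abD (mem_head _ _).
  by rewrite starts_cons !eqxx.
subst Q; exists O; split; [| by rewrite -sN cats0 | exact: out_outputs I].
by have := out_covers I; rewrite cats0.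
Qed.

Definition program := Seq cover_cmd (While output_test output_body).
Definition program_const :=
  cover_cost + 4 * (output_const + 2 * walk_const) + (cost output_test).+2.

Lemma exec_program : exists t mu P,
  [/\ exec W program input t mu, t <= program_const * n, outputs mu P,
      path_cover es P & size P <= uphalf n].
Proof.
have [t1 [mu1 [P [ex1 le1 [cP sP] lP un]]]] := exec_cover n1 sp_es simple_es.
have I : output_inv (size P) (size es * output_const +
    walk_const * size (flatten P)) mu1.
  exists 0, [::], [::], P; split=> //;
    [by rewrite un | | by move=> e; rewrite take0 | by rewrite subn0].
  split=> //; split=> //.
  - by move=> a b; rewrite un.
  - by split=> //; rewrite un.
  - by rewrite un.
  - by case=> [|[|[|]]] // j _; rewrite un.
have [t2 [mu2 [psi [ex2 I2 test le2]]]] := exec_while (@output_step (size P)) I.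
have [P' [cP' sP' out]] := output_final I2 test.
have sf := size_flatten_paths cP; rewrite size_map in sf.
have m4 := size_edges sp_es simple_es.
have {}m4 : size es <= 4 * n by move: m4; move: (size es) => m; clear; lia.
have {}sf : size (flatten P) <= 8 * n.
  by move: sf m4; move: (size es) (size _) => m k; clear; lia.
have {}le2 : t2 <= output_const * (4 * n) + walk_const * (8 * n) + (cost output_test).+1.
  apply: leq_trans (leq_addr psi t2) _; apply: leq_trans le2 _.
  by rewrite leq_add2r leq_add // ?leq_mul2l ?sf ?orbT // mulnC leq_mul2l m4 orbT.
exists (t1 + t2).+1, mu2, P'; split=> //.
- exact: ExecSeq ex1 ex2.
- move: le1 le2 n1; rewrite /program_const.
  move: cover_cost output_const walk_const (cost output_test) => c1 c2 c3 c4.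
  by clear; nia.
- exact: covers_path_cover.
- by rewrite sP'.
Qed.

End Output.

(* MathComp world.  [uphalf n] is the ceiling of n/2.  In the second part, the
   program is uniform in the graph and [n ^ k] bounds the words, i.e. words have
   k * log n bits. *)
Theorem theorem1 :
  (forall (V : finType) (es : seq (V * V)),
     series_parallel es -> simple_graph es ->
     exists P : seq (seq V), path_cover es P /\ size P <= uphalf #|V|)
  /\
  (exists (prog : cmd) (c k : nat),
     forall (n : nat) (es : seq ('I_n * 'I_n)),
       series_parallel es -> simple_graph es ->
       exists (t : nat) (mu : memory) (P : seq (seq 'I_n)),
         [/\ exec (n ^ k) prog (graph_input es) t mu,
             t <= c * n,
             outputs mu P,
             path_cover es P
           & size P <= uphalf n]).
Proof.
split=> [V es|]; first exact: series_parallel_path_cover.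
(* Sums of squares are below [n ^ 3]; the higher power leaves room for constant
   factors when [n] is small. *)
exists program, program_const, 8 => n es sp_es simple_es.
apply: exec_program => //.
by move: (size_edges sp_es simple_es); clear; lia.
Qed.
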